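(* Let $u$ be the solitary wave solution $u_C$ defined in the context. The continuous spectrum of the linear operator $$\mathcal{M}:=-(1-\partial_x^2)^{-1}\bigl(2uu''+u^2\partial_x^2\bigr)$$ in $H^1(\mathbb{R})$ is given by the closure of the image of $u^2$, that is, by $[0,1+e^{2C}]$.
   Context: Cusped soliton $u_{\rm cusp}$: $u_{\rm cusp}(0)=1$ and, for $x\ne0$, $u=u_{\rm cusp}(x)\in(0,1)$ is defined implicitly by $|x|=\int_u^1\frac{d\xi}{\sqrt{-\log(1-\xi^2)}}$. Solitary wave solution $u_C$, $C\in\mathbb{R}$: let $\ell_C:=\int_1^{\sqrt{1+e^{2C}}}\frac{du}{\sqrt{2C-\log(u^2-1)}}$ and $$u_C(x)=\begin{cases}u_{{\rm head},C}(x),&x\in[-\ell_C,\ell_C],\\ u_{\rm cusp}(|x|-\ell_C),&|x|>\ell_C,\end{cases}$$ where $u=u_{{\rm head},C}(x)\in[1,\sqrt{1+e^{2C}}]$ is defined implicitly by $\ell_C-|x|=\int_1^u\frac{d\xi}{\sqrt{2C-\log(\xi^2-1)}}$. By convention $C=-\infty$ corresponds to the cusped soliton: $u_{-\infty}=u_{\rm cusp}$, $\ell_{-\infty}=0$, $e^{2C}=0$. Away from the points $x=\pm\ell_C$, where $u=1$, the function $u=u_C$ satisfies $u''=u/(1-u^2)$, so that $2uu''=2u^2/(1-u^2)$ there. The operator $\mathcal{M}$ arises by linearizing the map $w\mapsto-(1-\partial_x^2)^{-1}(w^2\partial_x^2w)$ at $w=u$. *)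

(* Defs.v *)
From mathcomp Require Import all_boot all_order all_algebra.
From mathcomp Require Import complex.
From mathcomp Require Import all_classical all_reals all_analysis.

Set Implicit Arguments.
Unset Strict Implicit.
Unset Printing Implicit Defensive.

Import Order.TTheory GRing.Theory Num.Theory.
Import numFieldNormedType.Exports.

Local Open Scope classical_set_scope.
Local Open Scope ring_scope.

Section Waves.
Context {R : realType}.
Local Notation mu := (@lebesgue_measure R).

(* The endpoints are left out of the domains of integration below, because
   there ln may be evaluated at 0 or the square root may vanish. *)
Definition cusp (x : R) : R :=
  if x == 0 then 1
  else xget 0 [set u : R | 0 < u < 1 /\
    `|x| = \int[mu]_(xi in `]u, 1[) (Num.sqrt (- ln (1 - xi ^+ 2)))^-1].

Definition head_integral (c u : R) : R :=
  \int[mu]_(xi in `]1, u[) (Num.sqrt (2 * c - ln (xi ^+ 2 - 1)))^-1.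

Definition head_length (c : R) : R :=
  head_integral c (Num.sqrt (1 + expR (2 * c))).

Definition head (c x : R) : R :=
  xget 1 [set u : R | 1 <= u <= Num.sqrt (1 + expR (2 * c)) /\
    head_length c - `|x| = head_integral c u].

(* The parameter C ranges over the reals and -oo; +oo is a junk case. *)
Definition solitary_wave (C : \bar R) (x : R) : R :=
  if C is c%:E then
    if `|x| <= head_length c then head c x else cusp (`|x| - head_length c)
  else cusp x.

(* e^{2C}, equal to 0 at C = -oo *)
Definition exp2 (C : \bar R) : R := fine (expeR (2%:E * C)%E).

End Waves.

Section Sobolev.
Context {R : realType}.
Local Notation mu := (@lebesgue_measure R).

Definition C1c (phi : R -> R) : Prop :=
  [/\ forall x, derivable phi x 1, continuous (derive1 phi) &
      exists A : R, forall x, A < `|x| -> phi x = 0].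

Definition L2 (f : R -> R) : Prop := f \in Lfun mu 2%:E.

Definition weak_derivative (f g : R -> R) : Prop :=
  L2 g /\ forall phi, C1c phi ->
    \int[mu]_x (f x * derive1 phi x) = - \int[mu]_x (g x * phi x).

(* H^1(R) of real functions. Every class contains exactly one continuous
   function, and the class is identified with it; thus equality in H^1 is
   equality of functions. *)
Definition H1R (f : R -> R) : Prop :=
  [/\ continuous f, L2 f & exists g, weak_derivative f g].

(* defined up to a null set *)
Definition wderiv (f : R -> R) : R -> R := xget 0 [set g | weak_derivative f g].

Definition H1R_normsq (f : R -> R) : R :=
  \int[mu]_x (f x ^+ 2) + \int[mu]_x (wderiv f x ^+ 2).

(* Elements of H^{-1}(R) are represented by functionals of phi in H^1(R). *)

(* f'' for f in H^1(R) *)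
Definition dual_d2 (f phi : R -> R) : R :=
  - \int[mu]_x (wderiv f x * wderiv phi x).

(* the product a F of F in H^{-1}(R) and a in H^1(R), an algebra *)
Definition dual_mul (a : R -> R) (F : (R -> R) -> R) (phi : R -> R) : R :=
  F (fun x => a x * phi x).

(* (1 - d_x^2)^{-1} : H^{-1}(R) -> H^1(R) *)
Definition helmholtz_inv (F : (R -> R) -> R) : R -> R :=
  xget 0 [set w | H1R w /\
    forall phi, H1R phi -> \int[mu]_x (w x * phi x) - dual_d2 w phi = F phi].

(* M v for real v. The profile u only lies in H^1(R), and u'' is its
   distributional second derivative: that is what the linearization of
   w |-> - (1 - d_x^2)^{-1} (w^2 w'') at u produces. It agrees with u / (1 - u^2)
   where u <> 1; that function is not integrable near the points where u = 1. *)
Definition opMR (u v : R -> R) : R -> R :=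
  - helmholtz_inv (fun phi =>
      dual_mul (fun x => 2 * u x * v x) (dual_d2 u) phi
      + dual_mul (fun x => u x ^+ 2) (dual_d2 v) phi).

(* The spectrum is a set of complex numbers, so H^1(R) consists of complex
   functions and the real operator M acts on real and imaginary parts. *)
Local Notation re f := (fun x => complex.Re (f x)).
Local Notation im f := (fun x => complex.Im (f x)).

Definition H1 : set (R -> R[i]) := [set f | H1R (re f) /\ H1R (im f)].

Definition H1_norm (f : R -> R[i]) : R :=
  Num.sqrt (H1R_normsq (re f) + H1R_normsq (im f)).

Definition opM (u : R -> R) (v : R -> R[i]) : R -> R[i] :=
  fun x => Complex (opMR u (re v) x) (opMR u (im v) x).

End Sobolev.

Section Spectrum.
Context {R : realType} {V : lmodType R[i]}.
(* a subspace H of V with a norm N on it, and an operator T on H *)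
Variables (H : set V) (N : V -> R).

(* E / (E `&` F) is finite-dimensional; for F = {0}: E is finite-dimensional *)
Definition finite_codim (E F : set V) : Prop :=
  exists (n : nat) (e : 'I_n -> V), (forall i, E (e i)) /\
    forall v, E v -> exists c : 'I_n -> R[i], F (v - \sum_(i < n) c i *: e i).

Definition norm_closed (F : set V) : Prop :=
  forall f, H f -> (forall eps : R, 0 < eps -> exists2 g, F g & N (f - g) < eps) ->
  F f.

Definition fredholm (T : V -> V) : Prop :=
  [/\ finite_codim [set v | H v /\ T v = 0] [set 0],
      norm_closed (T @` H) & finite_codim H (T @` H)].

(* Continuous spectrum in the sense in which it is invariant under compact
   perturbations (Weyl's theorem), that is, the essential spectrum: the l for
   which T - l is not Fredholm. Eigenvalues are not removed: M u = 3 u, and 3 <= 1 + e^{2C} may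
   hold. *)
Definition continuous_spectrum (T : V -> V) : set R[i] :=
  [set l | ~ fredholm (fun v => T v - l *: v)].

End Spectrum.

(* Main.v *)
(** For a profile u in H^1, integration by parts gives M v = u^2 v + K v, where
    K is compact on H^1: the H^1 pairing of K v with phi is the integral of
    kappa * phi, with kappa integrable, and phi may be replaced by a step
    function up to a small error. If z stays away from the values of u^2, then
    multiplication by u^2 - z is invertible, K is a small operator plus one of
    finite rank, and M - z is Fredholm by a fixed point argument and linear
    algebra. If z is a limit of values of u^2, then there are disjoint intervals
    on which u^2 is nearly z; bump functions w_n on them are orthonormal, and
    the pairings of (M - z) v with w_n decay faster than those of suitable
    series of the w_n, so that the range has infinite codimension.

    The solitary wave satisfies the first-order equation (u')^2 = - ln (1 - u^2)
    or (u')^2 = 2 C - ln (u^2 - 1); it inverts the integrals that define it. The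
    derivative blows up where u = 1, but only logarithmically in u, and u is
    monotone on each side, so u' is square integrable. *)
Require Import Defs.
From mathcomp Require Import all_boot all_order all_algebra.
From mathcomp Require Import complex.
From mathcomp Require Import all_classical all_reals all_analysis.
From mathcomp Require Import measurable_realfun ring lra.

Import Order.TTheory GRing.Theory Num.Theory.
Import numFieldNormedType.Exports.

Local Open Scope classical_set_scope.
Local Open Scope ring_scope.

Set Implicit Arguments.
Unset Strict Implicit.
Unset Printing Implicit Defensive.

(** * Integration and absolutely continuous functions *)

Section L2.
Context {R : realType}.
Local Notation mu := (@lebesgue_measure R).
Implicit Types f g h : R -> R.

(** The splitting of [M] comes from the distributional identity [2 u v u'' + u^2 v'' = (u^2 v)'' - 2
    u'^2 v - 4 u u' v']: apart from the second derivative of [u^2 v], only [u'] occurs. This matters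
    because [u'] is unbounded where [u = 1]. The coefficients of the remainder are then merely
    integrable, and the estimates rest on the embedding of H^1 into functions that are bounded and
    Hoelder continuous of exponent 1/2. [M] is not symmetric in H^1, so the bumps do not serve as
    approximate eigenfunctions but as functionals on the range. The [n]-th bump has defect at most
    [16^-n] and the series have coefficients [4^-n], so that the coefficients outweigh every fixed
    multiple of the defects. Compactness enters only in quantitative form: for each [e] the
    remainder has finite rank up to an operator of norm at most [e], and [e] is chosen after the
    norm of multiplication by [1 / (u^2 - z)] is known. *)

Definition L1 f : Prop := mu.-integrable setT (EFin \o f).

Lemma L1_measurable f : L1 f -> measurable_fun setT f.
Proof. by move=> /measurable_int /measurable_EFinP. Qed.

Lemma L1D f g : L1 f -> L1 g -> L1 (fun x => f x + g x).
Proof. by move=> lf lg; exact: (integrableD measurableT lf lg). Qed.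

Lemma L1B f g : L1 f -> L1 g -> L1 (fun x => f x - g x).
Proof. by move=> lf lg; exact: (integrableB measurableT lf lg). Qed.

Lemma L1Z k f : L1 f -> L1 (fun x => k * f x).
Proof. by move=> lf; exact: (integrableZl measurableT k lf). Qed.

Lemma le_L1 g f : measurable_fun setT f -> (forall x, `|f x| <= g x) ->
  L1 g -> L1 f.
Proof.
move=> mf fg; apply: le_integrable => //; first exact/measurable_EFinP.
by move=> x _ /=; rewrite lee_fin (le_trans (fg x))// ler_norm.
Qed.

Lemma L1_norm f : L1 f -> L1 (fun x => `|f x|).
Proof. exact: integrable_norm. Qed.

Lemma L1_indic A f : measurable A -> L1 f -> L1 (fun x => f x * \1_A x).
Proof.
move=> mA lf; apply: (@le_L1 (fun x => `|f x|)); last exact: L1_norm.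
  by apply: measurable_funM; [exact: L1_measurable|exact: measurable_indic].
by move=> x; rewrite normrM indicE; case: (x \in A); rewrite ?normr1 ?normr0 ?mulr1 ?mulr0.
Qed.

Lemma L1_sum n (f : 'I_n -> R -> R) : (forall i, L1 (f i)) ->
  L1 (fun x => \sum_(i < n) f i x).
Proof.
elim: n f => [|n IH] f lf.
  have -> : (fun x => \sum_(i < 0) f i x) = cst 0 by apply/funext=> x; rewrite big_ord0.
  exact: integrable0.
under eq_fun do rewrite big_ord_recr /=.
by apply: L1D => //; apply: IH.
Qed.

Lemma int_sum n (f : 'I_n -> R -> R) : (forall i, L1 (f i)) ->
  \int[mu]_x (\sum_(i < n) f i x) = \sum_(i < n) \int[mu]_x f i x.
Proof.
elim: n f => [|n IH] f lf.
  under eq_Rintegral do rewrite big_ord0.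
  by rewrite big_ord0 Rintegral_cst//= mul0r.
under eq_Rintegral do rewrite big_ord_recr /=.
rewrite big_ord_recr /= RintegralD//; [by rewrite IH| |exact: lf].
by have := @L1_sum n (fun i => f (widen_ord (leqnSn n) i)) (fun i => lf _).
Qed.

Lemma int_indic A f : measurable A ->
  \int[mu]_(x in A) f x = \int[mu]_x (f x * \1_A x).
Proof.
move=> mA; rewrite Rintegral_mkcond; apply: eq_Rintegral => x _.
by rewrite patchE indicE; case: ifP; rewrite ?mulr1 ?mulr0.
Qed.

Lemma L1_setE A f : measurable A ->
  mu.-integrable A (EFin \o f) <-> L1 (fun x => f x * \1_A x).
Proof.
move=> mA; rewrite /L1 (integrable_mkcond _ mA).
suff -> : (EFin \o f) \_ A = EFin \o (fun x => f x * \1_A x) by [].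
apply/funext => x /=; rewrite patchE indicE; case: ifP; by rewrite ?mulr1 ?mulr0.
Qed.

Lemma L2P f : L2 f <-> measurable_fun setT f /\ L1 (fun x => f x ^+ 2).
Proof.
split=> [lf|[mf lf]].
  split; last exact: Lfun2_integrable_sqr.
  by move: lf; rewrite /L2 inE => /andP[/[!inE]].
rewrite /L2 inE; apply/andP; split; rewrite inE//=.
rewrite /finite_norm unlock /Lnorm poweR_lty//.
move/integrableP: lf => [_]; apply: le_lt_trans.
apply: ge0_le_integral => //=.
- apply/measurable_EFinP/(@measurableT_comp _ _ _ _ _ _ (fun x : R => x `^ 2)%R) => //.
  exact: measurableT_comp.
- by do 2 apply: measurableT_comp => //; exact: measurable_funX.
- by move=> x _; rewrite lee_fin powR_mulrn// real_normK ?num_real// ger0_norm// sqr_ge0.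
Qed.

Lemma L2_measurable f : L2 f -> measurable_fun setT f.
Proof. by move=> /L2P[]. Qed.

Lemma L2_sqr f : L2 f -> L1 (fun x => f x ^+ 2).
Proof. by move=> /L2P[]. Qed.

Lemma le_L2 g f : measurable_fun setT f -> (forall x, `|f x| <= `|g x|) ->
  L2 g -> L2 f.
Proof.
move=> mf fg lg; apply/L2P; split=> //.
apply: (le_L1 _ _ (L2_sqr lg)); first exact: measurable_funX.
by move=> x; rewrite normrX -[leRHS]real_normK ?num_real// lerXn2r ?nnegrE.
Qed.

Lemma L2M f g : L2 f -> L2 g -> L1 (fun x => f x * g x).
Proof. by move=> lf lg; apply/Lfun1_integrable; exact: Lfun2_mul_Lfun1. Qed.

Lemma L2Z k f : L2 f -> L2 (fun x => k * f x).
Proof.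
move=> lf; apply/L2P; split.
  by apply: measurable_funM => //; exact: L2_measurable.
by under eq_fun do rewrite exprMn; apply: L1Z; exact: L2_sqr.
Qed.

Lemma L2D f g : L2 f -> L2 g -> L2 (fun x => f x + g x).
Proof.
move=> lf lg; apply/L2P; split.
  by apply: measurable_funD; exact: L2_measurable.
have -> : (fun x => (f x + g x) ^+ 2) =
  (fun x => (f x ^+ 2 + 2 * (f x * g x)) + g x ^+ 2).
  by apply/funext => x; ring.
by apply: L1D; [apply: L1D; [exact: L2_sqr|apply/L1Z/L2M]|exact: L2_sqr].
Qed.

Lemma L2_0 : L2 (fun _ : R => 0).
Proof.
apply/L2P; split; first exact: measurable_cst.
under eq_fun do rewrite expr0n /=; exact: integrable0.
Qed.

Lemma L2_norm f : L2 f -> L2 (fun x => `|f x|).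
Proof.
move=> lf; apply: (@le_L2 f) => //; last by move=> x; rewrite normr_id.
by apply: measurableT_comp => //; exact: L2_measurable.
Qed.

Lemma L2Mb c f g : measurable_fun setT g -> (forall x, `|g x| <= c) -> L2 f ->
  L2 (fun x => g x * f x).
Proof.
move=> mg gc lf; apply: (@le_L2 (fun x => c * f x)).
- by apply: measurable_funM => //; exact: L2_measurable.
- by move=> x; rewrite !normrM ler_wpM2r// (le_trans (gc x))// ler_norm.
- exact: L2Z.
Qed.

Lemma L2_indic A f : measurable A -> L2 f -> L2 (fun x => f x * \1_A x).
Proof.
move=> mA lf; under eq_fun do rewrite mulrC.
apply: (@L2Mb 1) => //; move=> x.
by rewrite indicE; case: (x \in A); rewrite ?normr1 ?normr0.
Qed.

Definition ip f g := \int[mu]_x (f x * g x).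

Lemma ipC f g : ip f g = ip g f.
Proof. by apply: eq_Rintegral => x _; rewrite mulrC. Qed.

Lemma ipDl f g h : L2 f -> L2 g -> L2 h ->
  ip (fun x => f x + g x) h = ip f h + ip g h.
Proof.
move=> lf lg lh; rewrite /ip -RintegralD//; [|exact: L2M|exact: L2M].
by apply: eq_Rintegral => x _; rewrite mulrDl.
Qed.

Lemma ipZl k f h : L2 f -> L2 h -> ip (fun x => k * f x) h = k * ip f h.
Proof.
move=> lf lh; rewrite /ip -RintegralZl//; [|exact: L2M].
by apply: eq_Rintegral => x _; rewrite mulrA.
Qed.

Lemma ip_ge0 f : 0 <= ip f f.
Proof. by apply: Rintegral_ge0 => x _; rewrite -expr2 sqr_ge0. Qed.

End L2.

(** * Elementary real inequalities *)

Section quad.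
Context {R : realFieldType}.

Lemma discr_le (a b c : R) : 0 <= c -> (forall t : R, 0 <= a + 2 * t * b + t ^+ 2 * c) ->
  b ^+ 2 <= a * c.
Proof.
rewrite le_eqVlt => /predU1P[<-|c0] H.
  have [->|b0] := eqVneq b 0; first by rewrite expr0n mulr0.
  (* For [c = 0] the polynomial is affine in [t], and at this [t] it takes the value -1. *)
  have := H (- (a + 1) / (2 * b)).
  have -> : a + 2 * (- (a + 1) / (2 * b)) * b + (- (a + 1) / (2 * b)) ^+ 2 * 0 = -1.
    by field.
  by rewrite ler0N1.
(* The minimum of the quadratic polynomial. *)
have := H (- b / c).
have -> : a + 2 * (- b / c) * b + (- b / c) ^+ 2 * c = (a * c - b ^+ 2) / c.
  by field; rewrite gt_eqF.
by rewrite pmulr_lge0 ?invr_gt0// subr_ge0.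
Qed.

Lemma le_of_eps (x y c : R) : (forall e : R, 0 < e -> x <= y + e * c) -> x <= y.
Proof.
move=> H; rewrite leNgt; apply/negP => yx.
have c0 : 0 < `|c| + 1 by rewrite ltr_wpDl.
have e0 : 0 < (x - y) / 2 / (`|c| + 1) by rewrite !divr_gt0// subr_gt0.
have := H _ e0; apply/negP; rewrite -ltNge.
apply: (@le_lt_trans _ _ (y + (x - y) / 2)).
  rewrite lerD2l -[leRHS](@divfK _ (`|c| + 1)) ?gt_eqF//.
  by rewrite ler_pM2l// (le_trans (ler_norm c))// lerDl.
lra.
Qed.

End quad.

Section increments.
Context {R : realType}.

(** Real induction: the supremum of the points up to which the estimate holds is itself such a
    point, and unless it is [b] it is exceeded. Since the local hypothesis concerns increments
    across [z], a good point shortly before the supremum is joined to a point behind it in one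
    step. *)
Lemma le_of_small_increments (E W : R -> R) (a b : R) : a <= b ->
  (forall z : R, a <= z <= b -> exists2 d : R, 0 < d & forall x y : R, a <= x <= z -> z <= y <= b ->
    z - d < x -> y < z + d -> `|E y - E x| <= W y - W x) ->
  `|E b - E a| <= W b - W a.
Proof.
move=> ab H.
pose S := [set x | a <= x <= b /\ `|E x - E a| <= W x - W a].
have Sa : S a by split; rewrite ?lexx// !subrr normr0.
have hS : has_sup S by split; [exists a|exists b => x [/andP[]]].
have supl x : S x -> x <= sup S by move=> Sx; apply: ub_le_sup => //; case: hS.
have supab : a <= sup S <= b.
  by rewrite supl//= ge_sup//; [exists a|move=> x [/andP[]]].
have [d d0 Hd] := H _ supab.
have [x Sx xs] := sup_adherent d0 hS.
have key y : sup S <= y <= b -> y < sup S + d -> S y.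
  move=> /andP[sy yb] yd; have /andP[asup _] := supab.
  split; first by rewrite yb (le_trans asup).
  have [/andP[ax xb] Ex] := Sx.
  have := Hd x y; rewrite ax supl// sy yb => /(_ isT isT xs yd) Exy.
  have -> : E y - E a = (E y - E x) + (E x - E a) by ring.
  have -> : W y - W a = (W y - W x) + (W x - W a) by ring.
  by rewrite (le_trans (ler_normD _ _))// lerD.
have /andP[asup supb] := supab.
suff -> : b = sup S by case: (key (sup S)) => //; [rewrite lexx|rewrite ltrDl].
apply/eqP; rewrite eq_le supb andbT leNgt; apply/negP => sb.
pose y := Num.min b (sup S + d / 2).
have ys : sup S < y by rewrite /y lt_min sb ltrDl divr_gt0.
have /supl : S y.
  apply: key; first by rewrite (ltW ys) /y ge_min lexx.
  by rewrite /y gt_min; apply/orP; right; rewrite ltrD2l; lra.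
by rewrite leNgt ys.
Qed.

End increments.

(** * Functions with a locally integrable density *)

Section ac.
Context {R : realType}.
Local Notation mu := (@lebesgue_measure R).
Implicit Types (f g h F G q W D : R -> R) (a b c d e x y z : R).

Definition locL1 g : Prop := forall a b, mu.-integrable `[a, b] (EFin \o g).

(** Local absolute continuity in integral form. The density is part of the data, so that product and
    quotient rules are statements about integrals and no derivative has to exist at a given
    point. *)
Definition ac f g := locL1 g /\ forall a b, a <= b ->
  f b - f a = \int[mu]_(x in `[a, b]) g x.

Lemma locL1_measurable g : locL1 g -> measurable_fun setT g.
Proof.
move=> lg; have <- : \bigcup_n [set` `[- (n%:R : R), n%:R]] = setT.
  apply/seteqP; split => // x _; exists (Num.truncn `|x|).+1 => //=.
  rewrite in_itv/= -ler_norml ltW//.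
  by have /andP[] := truncn_itv (normr_ge0 x).
apply/measurable_fun_bigcup => // n.
by have /measurable_int/measurable_EFinP := lg (- n%:R) n%:R.
Qed.

Lemma locL1D f g : locL1 f -> locL1 g -> locL1 (fun x => f x + g x).
Proof. by move=> lf lg a b; exact: (integrableD _ (lf a b) (lg a b)). Qed.

Lemma locL1Z k f : locL1 f -> locL1 (fun x => k * f x).
Proof. by move=> lf a b; exact: (integrableZl _ k (lf a b)). Qed.

Lemma locL1_norm f : locL1 f -> locL1 (fun x => `|f x|).
Proof. by move=> lf a b; exact: integrable_norm (lf a b). Qed.

Lemma L1_loc f : L1 f -> locL1 f.
Proof. by move=> lf a b; apply: integrableS lf. Qed.

Lemma locL1_cont f : continuous f -> locL1 f.
Proof.
move=> cf a b; apply: continuous_compact_integrable; first exact: segment_compact.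
exact: continuous_subspaceT.
Qed.

Lemma locL1M f g : continuous f -> locL1 g -> locL1 (fun x => f x * g x).
Proof.
move=> cf lg a b; apply: (@integrableMr _ _ _ mu `[a, b] _ f (EFin \o g)) => //.
  by apply: measurable_funTS; exact: continuous_measurable_fun.
have : compact (f @` `[a, b]).
  by apply: continuous_compact; [exact: continuous_subspaceT|exact: segment_compact].
move=> /compact_bounded [M [Mr HM]]; exists M; split=> // x /HM {}HM y aby /=.
by apply: HM; exists y.
Qed.

Lemma int_split f a b c : locL1 f -> a <= b -> b <= c ->
  \int[mu]_(x in `[a, c]) f x = \int[mu]_(x in `[a, b]) f x + \int[mu]_(x in `[b, c]) f x.
Proof.
move=> lf ab bc; have := @Rintegral_itvB _ f (BLeft a) (BRight c) b (lf a c).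
rewrite !bnd_simp => /(_ ab bc) H.
rewrite -(@Rintegral_itv_obnd_cbnd _ b (BRight c) f); last first.
  by apply: integrableS (lf b c) => //; apply: subset_itvr; rewrite bnd_simp.
by rewrite -H addrC subrK.
Qed.

Lemma ac_primitive g : locL1 g ->
  exists f, ac f g /\ f 0 = 0.
Proof.
move=> lg.
exists (fun x => if 0 <= x then \int[mu]_(t in `[0, x]) g t
                 else - \int[mu]_(t in `[x, 0]) g t).
have H0 : \int[mu]_(t in `[0, 0 : R]) g t = 0 by rewrite set_itv1 Rintegral_set1.
split; last by rewrite lexx.
split=> // a b ab; have [a0|a0] := leP 0 a.
  by rewrite (le_trans a0 ab) (int_split lg a0 ab) addrC addKr.
have [b0|b0] := leP 0 b; first by rewrite opprK addrC -int_split// ltW.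
by rewrite (int_split lg ab (ltW b0)) opprK addrC addrK.
Qed.

Lemma acD f g F G : ac f F -> ac g G -> ac (fun x => f x + g x) (fun x => F x + G x).
Proof.
move=> [lF Hf] [lG Hg]; split; first exact: locL1D.
move=> a b ab; rewrite RintegralD//.
by rewrite -Hf// -Hg//; ring.
Qed.

Lemma acZ k f F : ac f F -> ac (fun x => k * f x) (fun x => k * F x).
Proof.
move=> [lF Hf]; split; first exact: locL1Z.
move=> a b ab; rewrite RintegralZl//.
by rewrite -Hf// mulrBr.
Qed.

Lemma ac_cst c : ac (fun=> c) (fun=> 0).
Proof.
split=> [a b|a b ab]; first exact: integrable0.
by rewrite subrr Rintegral_cst// mul0r.
Qed.

Lemma int_eps g z e : locL1 g -> 0 < e ->
  exists2 d : R, 0 < d & forall x y, x <= z -> z <= y -> z - d < x -> y < z + d ->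
    \int[mu]_(t in `[x, y]) `|g t| < e.
Proof.
move=> lg e0.
(* The cut-off function is globally integrable, so its integral over sets of small measure is small.
   The bound 1 in the window keeps the intervals inside the cut-off. *)
have lh : L1 (fun x => g x * \1_`[z - 1, z + 1] x) by have := lg (z - 1) (z + 1); move=> /(L1_setE _ (measurable_itv _)).
have [d [d0 Hd]] := @integral_normr_continuous _ _ R mu _ lh _ e0.
exists (Num.min (d / 2) 1); first by rewrite lt_min divr_gt0//=.
move=> x y xz zy; rewrite ltrBlDl -ltrBlDr => H1.
rewrite -ltrBlDl => H2.
have [x1 x2] : z - x < d / 2 /\ z - x < 1 by move: H1; rewrite lt_min => /andP[].
have [y1 y2] : y - z < d / 2 /\ y - z < 1 by move: H2; rewrite lt_min => /andP[].
have -> : \int[mu]_(t in `[x, y]) `|g t| =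
  \int[mu]_(t in `[x, y]) `|g t * \1_`[z - 1, z + 1] t|.
  apply: eq_Rintegral => t; rewrite inE/= in_itv/= => /andP[xt ty].
  rewrite indicE mem_set ?mulr1//= in_itv/=; apply/andP; split; lra.
apply: Hd => //.
have := lebesgue_measure_itv `[x, y]; rewrite /= => ->.
by case: ifPn => _; rewrite -?EFinB lte_fin//; lra.
Qed.

Lemma ac_norm_le f F a b : ac f F -> a <= b ->
  `|f b - f a| <= \int[mu]_(t in `[a, b]) `|F t|.
Proof.
by move=> [lF Hf] ab; rewrite Hf//; apply: le_normr_Rintegral => //; exact: lF.
Qed.

Lemma ac_continuous f F : ac f F -> continuous f.
Proof.
move=> acf z; apply/cvgrPdist_lt => e e0.
have [d d0 Hd] := int_eps z acf.1 e0.
exists d => // y /=; rewrite ltr_norml => /andP[zy1 zy2].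
have [yz|/ltW zy] := leP y z.
  by apply: le_lt_trans (ac_norm_le acf yz) _; apply: Hd => //; lra.
rewrite distrC.
by apply: le_lt_trans (ac_norm_le acf zy) _; apply: Hd => //; lra.
Qed.

(* [q] has the density [h] as soon as its increments over short intervals are
   integrals of functions uniformly close to [h] relative to a weight [W]. *)
Lemma ac_local q h W : locL1 h -> locL1 W ->
  (forall z e, 0 < e -> exists2 d : R, 0 < d & forall x y, x <= z -> z <= y ->
     z - d < x -> y < z + d -> exists k : R -> R,
     [/\ mu.-integrable `[x, y] (EFin \o k), q y - q x = \int[mu]_(t in `[x, y]) k t &
       forall t, x <= t <= y -> `|k t - h t| <= e * W t]) ->
  ac q h.
Proof.
move=> lh lW H; split=> // a b ab.
pose E x := q x - \int[mu]_(t in `[a, x]) h t.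
suff : E b = E a.
  rewrite /E [X in _ = _ - X -> _](_ : _ = 0) ?subr0; last first.
    by rewrite set_itv1 Rintegral_set1.
  by move=> <-; ring.
apply/eqP; rewrite -subr_eq0 -normr_le0.
apply: (@le_of_eps _ _ _ (\int[mu]_(t in `[a, b]) W t)) => e e0.
pose V x := e * \int[mu]_(t in `[a, x]) W t.
have -> : 0 + e * \int[mu]_(t in `[a, b]) W t = V b - V a.
  by rewrite /V set_itv1 Rintegral_set1; ring.
apply: le_of_small_increments => // z /andP[az zb].
have [d d0 Hd] := H z e e0; exists d => // x y /andP[ax xz] /andP[zy yb] zx yz.
have [k [ik qk kh]] := Hd x y xz zy zx yz.
have xy := le_trans xz zy.
have -> : E y - E x = \int[mu]_(t in `[x, y]) (k t - h t).
  rewrite RintegralB//.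
  by rewrite -qk /E (int_split lh ax xy); ring.
have -> : V y - V x = \int[mu]_(t in `[x, y]) (e * W t).
  by rewrite RintegralZl// /V (int_split lW ax xy); ring.
have ikh : mu.-integrable `[x, y] (EFin \o (fun t => k t - h t)).
  exact: (integrableB _ ik (lh x y)).
apply: le_trans (le_normr_Rintegral _ _) _ => //.
apply: le_Rintegral => //; first exact: integrable_norm ikh.
  exact: (integrableZl _ e (lW x y)).
Qed.

(** Discrete Leibniz rule: [f y g y - f x g x = g x (f y - f x) + f y (g y - g x)]. With the factors
    frozen at the ends of a short interval, the increment is exactly an integral, and by continuity
    its integrand is close to the expected density. *)
Lemma ac_mul f g F G : ac f F -> ac g G ->
  ac (fun x => f x * g x) (fun x => F x * g x + f x * G x).
Proof.
move=> acf acg; have [lF Hf] := acf; have [lG Hg] := acg.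
have cf := ac_continuous acf; have cg := ac_continuous acg.
apply: (@ac_local _ _ (fun x => `|F x| + `|G x|)).
- apply: locL1D; last exact: locL1M.
  by under [X in locL1 X]eq_fun do rewrite mulrC; exact: locL1M.
- by apply: locL1D; exact: locL1_norm.
move=> z e e0.
have e20 : 0 < e / 2 by rewrite divr_gt0.
have [d1 /= d10 Hd1] : \forall t \near z, `|f z - f t| < e / 2.
  by move: (cf z) => /cvgrPdist_lt; exact.
have [d2 /= d20 Hd2] : \forall t \near z, `|g z - g t| < e / 2.
  by move: (cg z) => /cvgrPdist_lt; exact.
exists (Num.min d1 d2); first by rewrite lt_min d10.
move=> x y xz zy; rewrite ltrBlDl -ltrBlDr lt_min -ltrBlDl lt_min => /andP[x1 x2] /andP[y1 y2].
have xy := le_trans xz zy.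
have fd s t : x <= s <= y -> x <= t <= y -> `|f s - f t| <= e.
  move=> /andP[xs sy] /andP[xt ty].
  have fs : `|f z - f s| < e / 2 by apply: Hd1; rewrite /= ltr_norml; apply/andP; split; lra.
  have ft : `|f z - f t| < e / 2 by apply: Hd1; rewrite /= ltr_norml; apply/andP; split; lra.
  have -> : f s - f t = (f z - f t) - (f z - f s) by ring.
  by rewrite (le_trans (ler_normB _ _))//; lra.
have gd s t : x <= s <= y -> x <= t <= y -> `|g s - g t| <= e.
  move=> /andP[xs sy] /andP[xt ty].
  have gs : `|g z - g s| < e / 2 by apply: Hd2; rewrite /= ltr_norml; apply/andP; split; lra.
  have gt : `|g z - g t| < e / 2 by apply: Hd2; rewrite /= ltr_norml; apply/andP; split; lra.
  have -> : g s - g t = (g z - g t) - (g z - g s) by ring.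
  by rewrite (le_trans (ler_normB _ _))//; lra.
exists (fun t => g x * F t + f y * G t); split.
- by apply: (integrableD _ (integrableZl _ (g x) (lF x y)) (integrableZl _ (f y) (lG x y))).
- rewrite RintegralD//; last 2 first.
  + exact: (integrableZl _ (g x) (lF x y)).
  + exact: (integrableZl _ (f y) (lG x y)).
  rewrite !RintegralZl//.
  by rewrite -Hf// -Hg//; ring.
- move=> t xty; have -> : g x * F t + f y * G t - (F t * g t + f t * G t) =
    (g x - g t) * F t + (f y - f t) * G t by ring.
  rewrite (le_trans (ler_normD _ _))// mulrDr !normrM lerD// ler_wpM2r//.
    by apply: gd; rewrite ?lexx ?xy.
  by apply: fd; rewrite ?lexx ?xy.
Qed.

Lemma ac_inv D h (delta : R) : 0 < delta -> (forall x, delta <= D x) -> ac D h ->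
  ac (fun x => (D x)^-1) (fun x => - (D x) ^- 2 * h x).
Proof.
move=> d0 Dd acD; have [lh HD] := acD.
have cD := ac_continuous acD.
have D0 x : 0 < D x by rewrite (lt_le_trans d0).
pose q x := (D x)^-1.
have cq : continuous q.
  by move=> x; apply: cvgV; [rewrite gt_eqF|exact: cD].
have q0 x : 0 <= q x <= delta^-1.
  by rewrite /q invr_ge0 (ltW (D0 x))/= lef_pV2// posrE.
apply: (@ac_local _ _ (fun x => `|h x|)).
- apply: locL1M => // x.
  have -> : (fun x0 => - D x0 ^- 2) = (fun x => - (q x * q x)).
    by apply/funext => y; rewrite /q -exprVn expr2.
  by apply: cvgN; apply: cvgM; exact: cq.
- exact: locL1_norm.
move=> z e e0.
have e20 : 0 < e * delta / 4 by rewrite !mulr_gt0.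
have [d1 /= d10 Hd1] : \forall t \near z, `|q z - q t| < e * delta / 4.
  by move: (cq z) => /cvgrPdist_lt; exact.
exists d1 => // x y xz zy zx yz.
have xy := le_trans xz zy.
have qd s t : x <= s <= y -> x <= t <= y -> `|q s - q t| <= e * delta / 2.
  move=> /andP[xs sy] /andP[xt ty].
  have fs : `|q z - q s| < e * delta / 4.
    by apply: Hd1; rewrite /= ltr_norml; apply/andP; split; lra.
  have ft : `|q z - q t| < e * delta / 4.
    by apply: Hd1; rewrite /= ltr_norml; apply/andP; split; lra.
  have -> : q s - q t = (q z - q t) - (q z - q s) by ring.
  by rewrite (le_trans (ler_normB _ _))//; lra.
(* From [1/D y - 1/D x = - (D y - D x) / (D x D y)]: again the increment is an exact integral with
   frozen coefficients. *)
exists (fun t => - (q x * q y) * h t); split.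
- exact: (integrableZl _ _ (lh x y)).
- rewrite RintegralZl//.
  rewrite -HD// /q; field.
  by rewrite !gt_eqF.
- move=> t xty; rewrite -mulrBl normrM ler_wpM2r//.
  have -> : - (q x * q y) - - D t ^- 2 = q t * (q t - q y) - q y * (q x - q t).
    by rewrite /q -exprVn; ring.
  rewrite (le_trans (ler_normB _ _))// !normrM.
  have -> : e = delta^-1 * (e * delta / 2) + delta^-1 * (e * delta / 2).
    by field; rewrite gt_eqF.
  apply: lerD; apply: ler_pM => //.
  + by have /andP[a1 a2] := q0 t; rewrite ger0_norm.
  + by apply: qd; rewrite ?lexx ?xy.
  + by have /andP[a1 a2] := q0 y; rewrite ger0_norm.
  + by apply: qd; rewrite ?lexx ?xy.
Qed.

Lemma ac_C1 f : (forall x, derivable f x 1) -> continuous (derive1 f) ->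
  ac f (derive1 f).
Proof.
move=> df cf; split; first exact: locL1_cont.
move=> a b; rewrite le_eqVlt => /predU1P[->|ab].
  by rewrite subrr set_itv1 Rintegral_set1.
rewrite /Rintegral (continuous_FTC2 ab (F := f)); [by []|exact: continuous_subspaceT| |by []].
have cff : continuous f by move=> x; apply/differentiable_continuous/derivable1_diffP.
split; first by move=> x _.
  by apply: cvg_at_right_filter; exact: cff.
by apply: cvg_at_left_filter; exact: cff.
Qed.

(** The difference of the densities has integral 0 over every interval, and by Lebesgue
    differentiation it is almost everywhere the derivative of that vanishing integral. *)
Lemma ac_uniq f F G : ac f F -> ac f G -> ae_eq mu setT F G.
Proof.
move=> acF acG.
have [lH H] := acD acF (acZ (-1) acG).
set h := fun x => F x + -1 * G x in lH H.
have loch : locally_integrable setT h.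
  split; [exact: locL1_measurable|exact: openT|].
  move=> K _ cK; have [M [Mr HM]] := compact_bounded cK.
  have := lH (- (M + 1)) (M + 1); move=> /integrableP[_] /=.
  apply: le_lt_trans.
  have mh (A : set R) : measurable_fun A (fun x => `|h x|%:E).
    apply/measurable_EFinP; apply: measurableT_comp => //.
    by apply: measurable_funTS; exact: locL1_measurable.
  apply: ge0_subset_integral => //; [exact: compact_measurable|exact: mh|].
  move=> x Kx; rewrite /= ?in_itv/= -ler_norml.
  by apply: (HM (M + 1)) => //; rewrite ltrDl.
(* Differentiation is applied to integrals with a fixed lower end; the lower ends [-n] exhaust the
   line, at the cost of countably many null sets. *)
have ae n : {ae mu, forall x, - n%:R < x -> h x = 0}.
  have := @FTC1 R h (BLeft (- n%:R)) (fun y => lH _ _) loch.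
  apply: filterS; first exact: (ae_filter_ringOfSetsType mu).
  move=> x /[swap] nx.
  move=> /(_ _)[]; first by rewrite lte_fin.
  move=> _ <-.
  have -> : (fun y => \int[mu]_(t in `[- n%:R, y]) h t) = cst 0.
    apply/funext => y; have [ny|yn] := leP (- n%:R) y; first by rewrite -H// /cst; ring.
    by rewrite set_itv_ge ?bnd_simp -?ltNge// Rintegral_set0.
  by rewrite derive1_cst.
have : {ae mu, forall x, forall n, - n%:R < x -> h x = 0} by exact/ae_foralln.
apply: filterS; first exact: (ae_filter_ringOfSetsType mu).
move=> x Hx _.
have : h x = 0.
  apply: (Hx (Num.truncn `|x|).+1).
  by rewrite ltrNl (le_lt_trans (ler_norm _))// normrN; have /andP[] := truncn_itv (normr_ge0 x).
by rewrite /h mulN1r => /eqP; rewrite subr_eq0 => /eqP.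
Qed.
End ac.

(** * Weak derivatives *)

Section testfun.
Context {R : realType}.
Local Notation mu := (@lebesgue_measure R).
Implicit Types (f g F G : R -> R) (a b c d e x y z : R).

Lemma is_derive_quad F x (l : R) : (forall h : R, `|F (h + x) - F x - h * l| <= h ^+ 2) ->
  is_derive x 1 F l.
Proof.
move=> H.
have cv : h^-1 *: (F (h *: (1 : R) + x) - F x) @[h --> 0^'] --> l.
  apply/cvgrPdist_le => e e0; near=> h.
  have h0 : h != 0 by near: h; exact: nbhs_dnbhs_neq.
  rewrite /GRing.scale/= mulr1 distrC.
  have -> : h^-1 * (F (h + x) - F x) - l = h^-1 * (F (h + x) - F x - h * l).
    by field.
  rewrite normrM normfV ler_pdivrMl ?normr_gt0//.
  apply: le_trans (H h) _; rewrite -[h ^+ 2]real_normK ?num_real// expr2 ler_wpM2l//.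
  by near: h; apply/dnbhs0_le.
by apply: DeriveDef; [apply/cvg_ex; exists l|apply: cvg_lim].
Unshelve. all: by end_near. Qed.

Definition pos_part x : R := Num.max x 0.

Lemma is_derive_pos_sqr a x :
  is_derive x 1 (fun y => pos_part (y - a) ^+ 2) (2 * pos_part (x - a)).
Proof.
apply: is_derive_quad => h; rewrite /pos_part ler_norml.
have [H1|H1] := leP (h + x - a) 0; have [H2|H2] := leP (x - a) 0;
  apply/andP; split; nra.
Qed.

Lemma pos_part_continuous a : continuous (fun y => pos_part (y - a)).
Proof.
move=> x; rewrite /pos_part.
apply: (@continuous_max _ _ (fun y => y - a) (fun=> 0)); last exact: cvg_cst.
by apply: cvgB; [exact: cvg_id|exact: cvg_cst].
Qed.

(** The tent over [[a - e, a + e]] with height [e], as a second difference of the positive part. *)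
Definition hat a e x := pos_part (x - (a - e)) - 2 * pos_part (x - a) + pos_part (x - (a + e)).

(** The primitive of [hat], rising from 0 to [e^2]. Being C^1 it has exactly the regularity asked of
    test functions. *)
Definition smooth_step a e x :=
  (pos_part (x - (a - e)) ^+ 2 - 2 * pos_part (x - a) ^+ 2 + pos_part (x - (a + e)) ^+ 2) / 2.

Lemma is_derive_smooth_step a e x : is_derive x 1 (smooth_step a e) (hat a e x).
Proof.
pose P b y := pos_part (y - b) ^+ 2.
have -> : smooth_step a e =
    (fun y => 2^-1 * (P (a - e) y + -2 * P a y + P (a + e) y)).
  by apply/funext => y; rewrite /smooth_step /P; ring.
change (is_derive x 1 (2^-1 \*: (P (a - e) + (-2) \*: P a + P (a + e))) (hat a e x)).
have dP b : is_derive x 1 (P b) (2 * pos_part (x - b)) by exact: is_derive_pos_sqr.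
apply: is_derive_eq.
by rewrite /hat /GRing.scale/=; field.
Qed.

Lemma hat_continuous a e : continuous (hat a e).
Proof.
move=> x; apply: cvgD; last exact: pos_part_continuous.
apply: cvgB; first exact: pos_part_continuous.
by apply: cvgM; [exact: cvg_cst|exact: pos_part_continuous].
Qed.

Lemma hat_ge0 a e x : 0 <= e -> 0 <= hat a e x.
Proof.
rewrite /hat /pos_part => e0.
have [?|?] := leP (x - (a - e)) 0; have [?|?] := leP (x - a) 0;
  have [?|?] := leP (x - (a + e)) 0; lra.
Qed.

Lemma hat_out a e x : 0 <= e -> e <= `|x - a| -> hat a e x = 0.
Proof.
rewrite /hat /pos_part ler_normr => e0 /orP[]?;
have [?|?] := leP (x - (a - e)) 0; have [?|?] := leP (x - a) 0;
  have [?|?] := leP (x - (a + e)) 0; lra.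
Qed.

Lemma hat_center a e : 0 <= e -> hat a e a = e.
Proof.
rewrite /hat /pos_part => e0.
have [?|?] := leP (a - (a - e)) 0; have [?|?] := leP (a - a) 0;
  have [?|?] := leP (a - (a + e)) 0; lra.
Qed.

Lemma smooth_step_left a e x : 0 <= e -> x <= a - e -> smooth_step a e x = 0.
Proof.
rewrite /smooth_step /pos_part => e0 xa.
have [?|?] := leP (x - (a - e)) 0; have [?|?] := leP (x - a) 0;
  have [?|?] := leP (x - (a + e)) 0; nra.
Qed.

Lemma smooth_step_right a e x : 0 <= e -> a + e <= x -> smooth_step a e x = e ^+ 2.
Proof.
rewrite /smooth_step /pos_part => e0 xa.
have [?|?] := leP (x - (a - e)) 0; have [?|?] := leP (x - a) 0;
  have [?|?] := leP (x - (a + e)) 0; nra.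
Qed.

Definition smooth_bump a b e x := smooth_step a e x - smooth_step b e x.

Lemma is_derive_smooth_bump a b e x :
  is_derive x 1 (smooth_bump a b e) (hat a e x - hat b e x).
Proof.
have := is_derive_smooth_step a e x; have := is_derive_smooth_step b e x.
by move=> H1 H2; exact: is_deriveB.
Qed.

Lemma derive1_smooth_bump a b e :
  derive1 (smooth_bump a b e) = fun x => hat a e x - hat b e x.
Proof.
apply/funext => x; rewrite derive1E.
by have H := is_derive_smooth_bump a b e x; rewrite derive_val.
Qed.

Lemma smooth_bump_out a b e x : 0 <= e -> `|a| + `|b| + e < `|x| ->
  smooth_bump a b e x = 0.
Proof.
move=> e0 xab; rewrite /smooth_bump.
have [x0|x0] := leP 0 x.
  rewrite !smooth_step_right ?subrr//.
    by have := ler_norm b; have := normr_ge0 a; rewrite (ger0_norm x0) in xab; lra.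
  by have := ler_norm a; have := normr_ge0 b; rewrite (ger0_norm x0) in xab; lra.
rewrite !smooth_step_left ?subrr//.
  by have := ler_norm (- b); have := normr_ge0 a; rewrite normrN (ltr0_norm x0) in xab *; lra.
by have := ler_norm (- a); have := normr_ge0 b; rewrite normrN (ltr0_norm x0) in xab *; lra.
Qed.

Lemma C1c_smooth_bump a b e : 0 <= e -> C1c (smooth_bump a b e).
Proof.
move=> e0; split.
- by move=> x; have [] := is_derive_smooth_bump a b e x.
- rewrite derive1_smooth_bump => x; apply: cvgB; exact: hat_continuous.
- by exists (`|a| + `|b| + e) => x; apply: smooth_bump_out.
Qed.

End testfun.

Section weak.
Context {R : realType}.
Local Notation mu := (@lebesgue_measure R).
Implicit Types (f g F G phi : R -> R) (a b c d e x y z : R).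

Lemma indic_support f a b : (forall x, f x != 0 -> a <= x <= b) ->
  (fun x => f x * \1_`[a, b] x) = f.
Proof.
move=> H; apply/funext => x; rewrite indicE.
case: (asboolP (x \in `[a, b]%classic)) => xab.
  by rewrite xab mulr1.
have [->|fx] := eqVneq (f x) 0; first by rewrite mul0r.
by case: xab; rewrite inE/= in_itv/= H.
Qed.

Lemma L1_support f a b : locL1 f -> (forall x, f x != 0 -> a <= x <= b) -> L1 f.
Proof.
move=> lf H; rewrite -(indic_support H).
exact: (proj1 (L1_setE _ (measurable_itv _)) (lf a b)).
Qed.

Lemma int_support f a b : (forall x, f x != 0 -> a <= x <= b) ->
  \int[mu]_x f x = \int[mu]_(x in `[a, b]) f x.
Proof.
move=> H; rewrite (@int_indic _ `[a, b]) //; congr (Rintegral mu setT _).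
exact/esym/indic_support.
Qed.

Lemma L1_cont_support f a b : continuous f -> (forall x, f x != 0 -> a <= x <= b) -> L1 f.
Proof. by move=> cf; apply: L1_support; exact: locL1_cont. Qed.

Lemma int_gt0 f x0 : L1 f -> continuous f -> (forall x, 0 <= f x) -> 0 < f x0 ->
  0 < \int[mu]_x f x.
Proof.
move=> lf cf f0 fx0.
have [d /= d0 Hd] : \forall t \near x0, `|f x0 - f t| < f x0 / 2.
  by move: (cf x0) => /cvgrPdist_lt; apply; rewrite divr_gt0.
pose A := `[x0 - d / 2, x0 + d / 2]%classic.
have mA : measurable A by exact: measurable_itv.
have l1 : L1 (fun x => f x0 / 2 * \1_A x).
  by apply: L1Z; rewrite /A; apply: integrable_indic_itv.
have : \int[mu]_x (f x0 / 2 * \1_A x) <= \int[mu]_x f x.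
  apply: le_Rintegral => // x _; rewrite indicE; case: (boolP (x \in A)).
    rewrite /A inE/= in_itv/= => /andP[x1 x2]; rewrite mulr1.
    have : `|f x0 - f x| < f x0 / 2.
      by apply: Hd; rewrite /= ltr_norml; apply/andP; split; lra.
    by rewrite ltr_norml => /andP[_]; lra.
  by rewrite mulr0.
apply: lt_le_trans; rewrite -int_indic// Rintegral_cst//.
have := lebesgue_measure_itv `[x0 - d / 2, x0 + d / 2].
rewrite /A /= => ->; rewrite lte_fin ifT; last by lra.
by rewrite /= !mulr_gt0//; lra.
Qed.

Lemma derive1_out phi A : (forall x, A < `|x| -> phi x = 0) ->
  forall x, A < `|x| -> derive1 phi x = 0.
Proof.
move=> H x Ax; rewrite derive1E.
rewrite (near_eq_derive (g := cst 0)); first by rewrite -derive1E derive1_cst.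
have : \forall y \near x, A < `|y|.
  by move: (@norm_continuous _ R x) => /cvgr_gt; exact.
by apply: filterS => y /H.
Qed.

Lemma ac_weak f F phi : ac f F -> C1c phi ->
  \int[mu]_x (f x * derive1 phi x) = - \int[mu]_x (F x * phi x).
Proof.
move=> acf [dphi cphi' [A HA]].
have acphi := ac_C1 dphi cphi'; have cphi := ac_continuous acphi.
have cf := ac_continuous acf; have lF := acf.1.
have HA' := derive1_out HA.
(* [A] may be negative; [B] is positive and strictly beyond the support, so that the boundary terms
   at [B] and [-B] vanish. *)
pose B := `|A| + 1.
have AB : A < B by rewrite /B (le_lt_trans (ler_norm A))// ltrDl.
have B0 : 0 < B by rewrite /B ltr_wpDl.
have supp (k : R -> R) : (forall x, A < `|x| -> k x = 0) ->
    forall x, k x != 0 -> - B <= x <= B.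
  move=> Hk x kx; rewrite -ler_norml leNgt; apply/negP => Bx.
  by rewrite Hk ?eqxx ?(lt_trans AB) in kx.
have supp1 : forall x, f x * derive1 phi x != 0 -> - B <= x <= B.
  by apply: supp => x /HA' ->; rewrite mulr0.
have supp2 : forall x, F x * phi x != 0 -> - B <= x <= B.
  by apply: supp => x /HA ->; rewrite mulr0.
have l1 : locL1 (fun x => f x * derive1 phi x) by apply: locL1M => //; exact: locL1_cont.
have l2 : locL1 (fun x => F x * phi x).
  by under [X in locL1 X]eq_fun do rewrite mulrC; exact: locL1M.
apply/eqP; rewrite -addr_eq0 (int_support supp1) (int_support supp2).
rewrite -RintegralD//; apply/eqP.
have [_ /(_ (- B) B)] := ac_mul acf acphi.
have phiB : phi B = 0 by apply: HA; rewrite ger0_norm ?ltW.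
have phiNB : phi (- B) = 0 by apply: HA; rewrite normrN ger0_norm ?ltW.
rewrite phiB phiNB !mulr0 subrr => H; rewrite [RHS]H; last by lra.
by apply: eq_Rintegral => x _; rewrite addrC.
Qed.

(** The du Bois-Reymond lemma. If [h a < h b], a bump that rises near [a] and falls near [b] has as
    derivative a tent at [a] minus a tent at [b], and the pairing of [h] with this derivative cannot
    vanish. *)
Lemma cst_of_weak0 (h : R -> R) : continuous h ->
  (forall phi, C1c phi -> \int[mu]_x (h x * derive1 phi x) = 0) ->
  forall a b, h a = h b.
Proof.
move=> ch H.
suff key (a b : R) : ~~ (h a < h b) by move=> a b; apply/eqP; rewrite eq_le !leNgt !key.
apply/negP => hab.
pose m := (h a + h b) / 2.
have e1 : 0 < (h b - h a) / 4 by lra.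
have [d1 /= d10 Hd1] : \forall t \near a, `|h a - h t| < (h b - h a) / 4.
  by move: (ch a) => /cvgrPdist_lt; exact.
have [d2 /= d20 Hd2] : \forall t \near b, `|h b - h t| < (h b - h a) / 4.
  by move: (ch b) => /cvgrPdist_lt; exact.
pose e := Num.min d1 d2.
have e0 : 0 < e by rewrite /e lt_min d10.
have [ed1 ed2] : e <= d1 /\ e <= d2 by rewrite /e !ge_min !lexx orbT.
(* With the mean value [m] subtracted, both tents contribute with the same sign; the constant [m]
   itself pairs to 0 with the derivative of a test function. *)
pose k x := (m - h x) * (hat a e x - hat b e x).
have k0 x : 0 <= k x.
  rewrite /k mulrBr subr_ge0; apply: (@le_trans _ _ 0).
    have [?|?] := ltP `|x - b| e; last by rewrite hat_out ?mulr0// ltW.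
    rewrite mulr_le0_ge0 ?hat_ge0 ?ltW//.
    have : `|h b - h x| < (h b - h a) / 4.
      by apply: Hd2; rewrite /= distrC (lt_le_trans _ ed2).
    by rewrite ltr_norml /m => /andP[? ?]; lra.
  have [?|?] := ltP `|x - a| e; last by rewrite hat_out ?mulr0// ltW.
  rewrite mulr_ge0 ?hat_ge0 ?ltW//.
  have : `|h a - h x| < (h b - h a) / 4.
    by apply: Hd1; rewrite /= distrC (lt_le_trans _ ed1).
  by rewrite ltr_norml /m => /andP[? ?]; lra.
have CC := C1c_smooth_bump a b (ltW e0).
have ck' : continuous (fun x => hat a e x - hat b e x).
  by move=> x; apply: cvgB; exact: hat_continuous.
have ck : continuous k.
  move=> x; apply: cvgM; last exact: ck'.
  by apply: cvgB; [exact: cvg_cst|exact: ch].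
pose B := `|a| + `|b| + e.
have supp (j : R -> R) x : j x * (hat a e x - hat b e x) != 0 -> - B <= x <= B.
  rewrite -ler_norml leNgt => kx; apply/negP => Bx.
  have := derive1_out (fun y => @smooth_bump_out R a b e y (ltW e0)) Bx.
  by rewrite derive1_smooth_bump => E; rewrite E mulr0 eqxx in kx.
have lk : L1 k by apply: (L1_cont_support ck (supp _)).
have ka : 0 < k a.
  (* Otherwise the midpoint lies in both windows, and there [h] would be close to [h a] and to [h b]
     at once. *)
  have ab : e <= `|a - b|.
    rewrite leNgt; apply/negP => /[dup] ba; rewrite distrC => ab.
    have : `|h a - h ((a + b) / 2)| < (h b - h a) / 4.
      apply: Hd1; rewrite /= (lt_le_trans _ ed1)// (_ : a - _ = (a - b) / 2); last by field.
      rewrite normrM (@ger0_norm _ 2^-1)//; apply: le_lt_trans ba.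
      by rewrite ler_piMr//; lra.
    have : `|h b - h ((a + b) / 2)| < (h b - h a) / 4.
      apply: Hd2; rewrite /= (lt_le_trans _ ed2)// (_ : b - _ = (b - a) / 2); last by field.
      rewrite normrM (@ger0_norm _ 2^-1)//; apply: le_lt_trans ab.
      by rewrite ler_piMr//; lra.
    by rewrite !ltr_norml => /andP[? ?] /andP[? ?]; lra.
  rewrite /k hat_center ?ltW// (hat_out _ ab) ?ltW// subr0 mulr_gt0//.
  by rewrite /m; lra.
have := int_gt0 lk ck k0 ka.
have -> : \int[mu]_x k x = \int[mu]_x (m * derive1 (smooth_bump a b e) x) -
    \int[mu]_x (h x * derive1 (smooth_bump a b e) x).
  rewrite -RintegralB//.
  - by apply: eq_Rintegral => x _; rewrite derive1_smooth_bump /k mulrBl.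
  - rewrite derive1_smooth_bump; apply: (L1_cont_support _ (supp (fun=> m))).
    by move=> x; apply: cvgM; [exact: cvg_cst|exact: ck'].
  - rewrite derive1_smooth_bump; apply: (L1_cont_support _ (supp h)).
    by move=> x; apply: cvgM; [exact: ch|exact: ck'].
rewrite (ac_weak (ac_cst m) CC) H// subr0.
under eq_Rintegral do rewrite mul0r.
by rewrite Rintegral_cst// mul0r oppr0 ltxx.
Qed.

Lemma L2_loc g : L2 g -> locL1 g.
Proof.
move=> lg a b.
have l : L2 (\1_`[a, b]%classic : R -> R).
  apply/L2P; split; first exact: measurable_indic.
  have -> : (fun x => \1_`[a, b] x ^+ 2) = (\1_`[a, b] : R -> R).
    by apply/funext => x; rewrite indicE; case: (_ \in _); rewrite ?expr1n ?expr0n.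
  exact: integrable_indic_itv.
exact: (proj2 (L1_setE _ (measurable_itv _)) (L2M lg l)).
Qed.

(** The weak derivative, tested against functions, becomes a density, which can be computed with:
    [f] minus a primitive of [g] has weak derivative 0 and is therefore constant. *)
Lemma weak_derivativeP f g : continuous f -> weak_derivative f g <-> L2 g /\ ac f g.
Proof.
move=> cf; split=> [[lg H]|[lg acg]]; split=> //; last by move=> phi; exact: ac_weak.
have [G [acG _]] := ac_primitive (L2_loc lg).
have cG := ac_continuous acG.
have ch : continuous (fun x => f x - G x) by move=> x; apply: cvgB; [exact: cf|exact: cG].
have cst a b : f a - G a = f b - G b.
  apply: (cst_of_weak0 ch) => phi cphi.
  have [dphi cphi' [A HA]] := cphi.
  have supp (j : R -> R) x : j x * derive1 phi x != 0 -> - A <= x <= A.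
    rewrite -ler_norml leNgt => kx; apply/negP => Bx.
    by rewrite (derive1_out HA Bx) mulr0 eqxx in kx.
  have l (j : R -> R) : continuous j -> L1 (fun x => j x * derive1 phi x).
    move=> cj; apply: (L1_cont_support _ (supp j)) => x.
    by apply: cvgM; [exact: cj|exact: cphi'].
  under eq_Rintegral do rewrite mulrBl.
  by rewrite RintegralB//; [rewrite H// (ac_weak acG cphi) subrr|exact: l|exact: l].
split=> [|a b ab]; first exact: L2_loc.
by rewrite -acG.2//; have := cst a b; lra.
Qed.

(** Keeps a concrete representative [F] of the derivative. [wderiv] is a choice determined only up
    to a null set, so calculations are done with [F] and transferred by [h1_uniq]. *)
Definition h1 f F := [/\ L2 f, L2 F & ac f F].

Lemma h1_H1R f F : h1 f F -> H1R f.
Proof.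
move=> [lf lF acf]; have cf := ac_continuous acf; split=> //; exists F.
exact/weak_derivativeP.
Qed.

Lemma H1R_h1 f : H1R f -> h1 f (wderiv f).
Proof.
move=> [cf lf [g Hg]]; have H : weak_derivative f (wderiv f) by rewrite /wderiv; apply: xgetPex; exists g.
by have [? ?] := proj1 (weak_derivativeP _ cf) H; split.
Qed.

Lemma h1_uniq f F : h1 f F -> ae_eq mu setT (wderiv f) F.
Proof. by move=> hf; have [_ _ a1] := H1R_h1 (h1_H1R hf); case: hf => _ _; exact: ac_uniq. Qed.

Lemma h1D f g F G : h1 f F -> h1 g G -> h1 (fun x => f x + g x) (fun x => F x + G x).
Proof. by move=> [? ? ?] [? ? ?]; split; [exact: L2D|exact: L2D|exact: acD]. Qed.

Lemma h1Z c f F : h1 f F -> h1 (fun x => c * f x) (fun x => c * F x).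
Proof. by move=> [? ? ?]; split; [exact: L2Z|exact: L2Z|exact: acZ]. Qed.

End weak.

(** * The inner product of H^1, its sup bound and its algebra structure *)

Section h1.
Context {R : realType}.
Local Notation mu := (@lebesgue_measure R).
Implicit Types (f g F G phi : R -> R) (a b c d e x y z : R).

Lemma int_itv_cst a b c : a <= b -> \int[mu]_(x in `[a, b]) c = c * (b - a).
Proof.
move=> ab; rewrite Rintegral_cst//; congr (_ * _).
have := lebesgue_measure_itv `[a, b]; rewrite /= => ->; rewrite lte_fin.
case: ifPn => //=; rewrite -leNgt => ba.
by apply/eqP; rewrite eq_sym subr_eq0 eq_le ab ba.
Qed.

Lemma int_indic_le A f : measurable A -> L1 f -> (forall x, 0 <= f x) ->
  \int[mu]_(x in A) f x <= \int[mu]_x f x.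
Proof.
move=> mA lf f0; rewrite (@int_indic _ A)//.
apply: le_Rintegral => //; first exact: L1_indic.
by move=> x _; rewrite indicE; case: (x \in A); rewrite ?mulr1 ?mulr0.
Qed.

Lemma L1_not_ge f a e : L1 f -> (forall x, 0 <= f x) -> 0 < e ->
  exists2 r, 0 < r & ~ (forall x, a <= x <= a + r -> e <= f x) /\
                     ~ (forall x, a - r <= x <= a -> e <= f x).
Proof.
move=> lf f0 e0.
(* An interval of this length on which [f] is at least [e] would alone contribute more than the
   whole integral. *)
pose r := (\int[mu]_x f x + 1) / e.
have I0 : 0 <= \int[mu]_x f x by apply: Rintegral_ge0.
have r0 : 0 < r by rewrite divr_gt0// ltr_wpDl.
have er : e * r = \int[mu]_x f x + 1 by rewrite mulrC divfK// gt_eqF.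
exists r => //.
have key c d : c <= d -> d - c = r -> ~ (forall x, c <= x <= d -> e <= f x).
  move=> cd dcr H.
  suff : e * r <= \int[mu]_x f x by rewrite er; lra.
  apply: le_trans (@int_indic_le `[c, d] _ _ lf f0) => //.
  rewrite -dcr -int_itv_cst//; apply: le_Rintegral => //.
  - exact: (locL1_cont (fun x => @cvg_cst _ e _ _ _)).
  - exact: L1_loc.
by split; apply: key; lra.
Qed.

Lemma L1_small_right f a e : L1 f -> (forall x, 0 <= f x) -> 0 < e ->
  exists2 y, a <= y & f y < e.
Proof.
move=> lf f0 e0; have [r r0 [H _]] := L1_not_ge a lf f0 e0.
have /existsNP [x /not_implyP[/andP[xa _] /negP]] := H.
by rewrite -ltNge; exists x.
Qed.

Lemma L1_small_left f a e : L1 f -> (forall x, 0 <= f x) -> 0 < e ->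
  exists2 y, y <= a & f y < e.
Proof.
move=> lf f0 e0; have [r r0 [_ H]] := L1_not_ge a lf f0 e0.
have /existsNP [x /not_implyP[/andP[_ xa] /negP]] := H.
by rewrite -ltNge; exists x.
Qed.

Lemma ae_imp (P Q : R -> Prop) : (forall x, P x -> Q x) ->
  {ae mu, forall x, P x} -> {ae mu, forall x, Q x}.
Proof. by move=> PQ; apply: filterS; first exact: (ae_filter_ringOfSetsType mu). Qed.

Lemma ip_ae f g k : L2 f -> L2 g -> L2 k -> ae_eq mu setT f g -> ip f k = ip g k.
Proof.
move=> lf lg lk fg; rewrite /ip /Rintegral; congr fine.
apply: ae_eq_integral => //.
- by apply/measurable_EFinP; apply: L1_measurable; exact: L2M.
- by apply/measurable_EFinP; apply: L1_measurable; exact: L2M.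
- by apply: ae_imp fg => x fg xT; rewrite /= fg.
Qed.

Lemma H1RD f g : H1R f -> H1R g -> H1R (fun x => f x + g x).
Proof. by move=> /H1R_h1 hf /H1R_h1 hg; apply: (h1_H1R (h1D hf hg)). Qed.

Lemma H1RZ c f : H1R f -> H1R (fun x => c * f x).
Proof. by move=> /H1R_h1 hf; apply: (h1_H1R (h1Z c hf)). Qed.

Lemma h1_0 : h1 (fun _ : R => 0) (fun=> 0).
Proof. by split; [exact: L2_0|exact: L2_0|exact: ac_cst]. Qed.

Lemma H1R0 : H1R (fun _ : R => 0).
Proof. exact: (h1_H1R h1_0). Qed.

Definition hip f g := ip f g + ip (wderiv f) (wderiv g).

Lemma hipE f g F G : h1 f F -> h1 g G -> hip f g = ip f g + ip F G.
Proof.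
move=> hf hg; have := h1_uniq hf; have := h1_uniq hg => eG eF.
have [_ lwf _] := H1R_h1 (h1_H1R hf); have [_ lwg _] := H1R_h1 (h1_H1R hg).
have [_ lF _] := hf; have [_ lG _] := hg.
by rewrite /hip (ip_ae lwf lF lwg eF) (ipC F) (ip_ae lwg lG lF eG) (ipC G).
Qed.

Lemma hip_normsq f : hip f f = H1R_normsq f.
Proof. by rewrite /hip /ip /H1R_normsq; congr (_ + _); apply: eq_Rintegral. Qed.

Lemma hipC f g : hip f g = hip g f.
Proof. by rewrite /hip ipC (ipC (wderiv f)). Qed.

Lemma hipDl f g k : H1R f -> H1R g -> H1R k ->
  hip (fun x => f x + g x) k = hip f k + hip g k.
Proof.
move=> /H1R_h1 hf /H1R_h1 hg /H1R_h1 hk.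
rewrite (hipE (h1D hf hg) hk) /hip.
case: (hf) (hg) (hk) => [lf lF _] [lg lG _] [lk lK _].
by rewrite (ipDl lf lg lk) (ipDl lF lG lK) addrACA.
Qed.

Lemma hipZl c f k : H1R f -> H1R k -> hip (fun x => c * f x) k = c * hip f k.
Proof.
move=> /H1R_h1 hf /H1R_h1 hk; rewrite (hipE (h1Z c hf) hk) /hip.
by case: hf hk => [? ? ?] [? ? ?]; rewrite !ipZl//; ring.
Qed.

Lemma hip_ge0 f : 0 <= hip f f.
Proof. by rewrite addr_ge0// ip_ge0. Qed.

(** Sobolev embedding with constant 1. Since [f^2] is integrable, it is smaller than [e] at some [y]
    to the left of [x]; from there it grows by the integral of [2 f F], at most that of
    [f^2 + F^2]. *)
Lemma h1_sup f F x : h1 f F -> f x ^+ 2 <= ip f f + ip F F.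
Proof.
move=> [lf lF acf].
have lk : L1 (fun t => f t * f t + F t * F t) by apply: L1D; exact: L2M.
apply: (@le_of_eps _ _ _ 1) => e e0; rewrite mulr1.
have [y yx fy] := L1_small_left x (L2_sqr lf) (fun t => sqr_ge0 (f t)) e0.
have H1 := (ac_mul acf acf).2 y x yx.
have H2 : \int[mu]_(t in `[y, x]) (F t * f t + f t * F t) <= ip f f + ip F F.
  have -> : ip f f + ip F F = \int[mu]_t (f t * f t + F t * F t).
    by rewrite RintegralD//; exact: L2M.
  apply: le_trans (@int_indic_le `[y, x] _ _ lk _) => //; last first.
    by move=> t; rewrite addr_ge0// -expr2 sqr_ge0.
  apply: le_Rintegral => //.
  - exact: (ac_mul acf acf).1.
  - exact: L1_loc.
  - have amgm (u v : R) : v * u + u * v <= u * u + v * v by have := sqr_ge0 (u - v); nra.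
    by move=> t _; exact: amgm.
move: fy; rewrite !expr2 => H3.
by rewrite -H1 lerBlDr in H2; apply: (le_trans H2); rewrite lerD2l ltW.
Qed.

Lemma H1R_sup f x : H1R f -> f x ^+ 2 <= hip f f.
Proof. by move=> hf; exact: h1_sup (H1R_h1 hf). Qed.

Lemma H1R_sup_norm f x : H1R f -> `|f x| <= Num.sqrt (hip f f).
Proof. by move=> hf; rewrite -sqrtr_sqr ler_wsqrtr// H1R_sup. Qed.

Lemma H1R_measurable f : H1R f -> measurable_fun setT f.
Proof. by move=> /H1R_h1[/L2_measurable]. Qed.

Lemma L2Mh f g : H1R f -> L2 g -> L2 (fun x => f x * g x).
Proof.
move=> hf; apply: (L2Mb (c := Num.sqrt (hip f f))); first exact: H1R_measurable.
by move=> x; exact: H1R_sup_norm.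
Qed.

Lemma h1M f g F G : h1 f F -> h1 g G ->
  h1 (fun x => f x * g x) (fun x => F x * g x + f x * G x).
Proof.
move=> hf hg; have Hf := h1_H1R hf; have Hg := h1_H1R hg.
case: hf hg => [lf lF af] [lg lG ag]; split; [exact: L2Mh| |exact: ac_mul].
apply: L2D; last exact: L2Mh.
by under [X in L2 X]eq_fun do rewrite mulrC; exact: L2Mh.
Qed.

Lemma H1RM f g : H1R f -> H1R g -> H1R (fun x => f x * g x).
Proof. by move=> /H1R_h1 hf /H1R_h1 hg; apply: (h1_H1R (h1M hf hg)). Qed.

Lemma H1R_eq0 f : H1R f -> hip f f = 0 -> f = fun=> 0.
Proof.
move=> hf f0; apply/funext => x; have := H1R_sup x hf; rewrite f0 => H.
by apply/eqP; rewrite -sqrf_eq0 eq_le H sqr_ge0.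
Qed.

End h1.

(** * Completeness of H^1 *)

Lemma le0_of_geometric (R : realType) (x c : R) :
  (forall n, x <= c / 4 ^+ n) -> x <= 0.
Proof.
move=> H; have [c0|c0] := leP c 0.
  by have := H 0%N; rewrite expr0 divr1 => /le_trans; apply.
apply: (@le_of_eps _ _ _ c) => e e0; rewrite add0r.
have e1 : 0 < e^-1 by rewrite invr_gt0.
have [n ne] : exists n : nat, e^-1 < n%:R.
  by exists (Num.truncn e^-1).+1; have /andP[] := truncn_itv (ltW e1).
apply: le_trans (H n) _; rewrite mulrC ler_wpM2r ?ltW//.
rewrite -[e]invrK ltf_pV2 ?posrE ?exprn_gt0//.
by rewrite (lt_le_trans ne)// -natrX ler_nat ltnW// ltn_expl.
Qed.

(** * Semi-inner products and the Riesz representation theorem *)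

Section semi_inner_product.
Context {R : realType} {V : lmodType R}.
Implicit Types (H : set V) (B : V -> V -> R).

(** Positivity without definiteness, on a subset of a space of functions: this covers L^2, where
    functions are not identified almost everywhere, as well as H^1. *)
Record semi_ip H B : Prop := SemiIp {
  sip_0 : H 0 ;
  sip_D : forall u v, H u -> H v -> H (u + v) ;
  sip_Z : forall k u, H u -> H (k *: u) ;
  sip_C : forall u v, B u v = B v u ;
  sip_Dl : forall u v w, H u -> H v -> H w -> B (u + v) w = B u w + B v w ;
  sip_Zl : forall k u w, H u -> H w -> B (k *: u) w = k * B u w ;
  sip_ge0 : forall u, H u -> 0 <= B u u }.

Definition nm B u := Num.sqrt (B u u).

(** Completeness for sequences with geometric increments, together with a rate. The minimising
    sequences, series and fixed point iterations below are all of this kind. *)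
Definition geom_complete H B := forall (x : nat -> V) (c : R), (forall n, H (x n)) ->
  (forall n, nm B (x n.+1 - x n) <= c / 4 ^+ n) ->
  exists2 l, H l & forall n, nm B (l - x n) <= 4 * c / 4 ^+ n.

Variables (H : set V) (B : V -> V -> R).
Hypothesis HB : semi_ip H B.
Local Notation N := (nm B).

Lemma sip_N u : H u -> H (- u).
Proof. by rewrite -scaleN1r; exact: (sip_Z HB). Qed.

Lemma sip_B u v : H u -> H v -> H (u - v).
Proof. by move=> Hu Hv; apply: (sip_D HB) => //; exact: sip_N. Qed.

Lemma sip_Dr u v w : H u -> H v -> H w -> B w (u + v) = B w u + B w v.
Proof. by move=> *; rewrite (sip_C HB) (sip_Dl HB)// !(sip_C HB w). Qed.

Lemma sip_Zr k u w : H u -> H w -> B w (k *: u) = k * B w u.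
Proof. by move=> *; rewrite (sip_C HB) (sip_Zl HB)// (sip_C HB w). Qed.

Lemma sip_Bl u v w : H u -> H v -> H w -> B (u - v) w = B u w - B v w.
Proof.
move=> Hu Hv Hw; rewrite (sip_Dl HB)//; last exact: sip_N.
by rewrite -scaleN1r (sip_Zl HB)// mulN1r.
Qed.

Lemma sip_sqr u v t : H u -> H v ->
  B (u + t *: v) (u + t *: v) = B u u + 2 * t * B u v + t ^+ 2 * B v v.
Proof.
move=> Hu Hv; have Hv' := sip_Z HB t Hv; have Hs := sip_D HB Hu Hv'.
rewrite (sip_Dl HB)// !sip_Dr// !(sip_Zl HB)// !sip_Zr// (sip_C HB v u).
by ring.
Qed.

Lemma sip_cs_sqr u v : H u -> H v -> B u v ^+ 2 <= B u u * B v v.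
Proof.
move=> Hu Hv; apply: discr_le; first exact: (sip_ge0 HB).
by move=> t; rewrite -sip_sqr//; apply: (sip_ge0 HB); apply: (sip_D HB) => //; exact: (sip_Z HB).
Qed.

Lemma nm_ge0 u : 0 <= N (u).
Proof. exact: sqrtr_ge0. Qed.

Lemma nm_sqr u : H u -> N (u) ^+ 2 = B u u.
Proof. by move=> Hu; rewrite sqr_sqrtr//; exact: (sip_ge0 HB). Qed.

Lemma sip_cs u v : H u -> H v -> `|B u v| <= N (u) * N (v).
Proof.
move=> Hu Hv; rewrite -sqrtr_sqr -sqrtrM; last exact: (sip_ge0 HB).
by rewrite ler_wsqrtr// sip_cs_sqr.
Qed.

Lemma nmD u v : H u -> H v -> N (u + v) <= N (u) + N (v).
Proof.
move=> Hu Hv; rewrite -(@ler_pXn2r _ 2)//; last 2 first.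
- by rewrite nnegrE nm_ge0.
- by rewrite nnegrE addr_ge0 ?nm_ge0.
rewrite nm_sqr; last exact: (sip_D HB).
have := sip_sqr 1 Hu Hv; rewrite scale1r => ->.
rewrite sqrrD !nm_sqr// expr1n !mul1r mulr1 lerD2r lerD2l -[leRHS]mulr_natl ler_wpM2l//.
exact: le_trans (ler_norm _) (sip_cs Hu Hv).
Qed.

Lemma nmZ k u : H u -> N (k *: u) = `|k| * N (u).
Proof.
move=> Hu; rewrite /nm (sip_Zl HB)//; last exact: (sip_Z HB).
by rewrite sip_Zr// mulrA -expr2 sqrtrM ?sqr_ge0// sqrtr_sqr.
Qed.

Lemma nmN u : H u -> N (- u) = N (u).
Proof. by move=> Hu; rewrite -scaleN1r nmZ// normrN1 mul1r. Qed.

Lemma nm_dist u v : H u -> H v -> N (u - v) = N (v - u).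
Proof. by move=> Hu Hv; rewrite -nmN ?opprB//; exact: sip_B. Qed.

Lemma nm0 : N (0) = 0.
Proof. by have := nmZ 0 (sip_0 HB); rewrite scale0r normr0 mul0r. Qed.

Lemma nm_geom (x : nat -> V) (c : R) n m : (forall n, H (x n)) ->
  (forall n, N (x n.+1 - x n) <= c / 4 ^+ n) -> (n <= m)%N ->
  N (x m - x n) <= 2 * c / 4 ^+ n.
Proof.
move=> Hx xc; move=> /subnK <-; move: (m - n)%N => k {m}.
have c0 : 0 <= c.
  by have := le_trans (nm_ge0 _) (xc 0%N); rewrite expr0 divr1.
suff : N (x (k + n)%N - x n) <= (2 * c - 2 * c / 4 ^+ k) / 4 ^+ n.
  move=> /le_trans; apply; rewrite ler_wpM2r ?invr_ge0 ?exprn_ge0//.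
  by rewrite lerBlDr lerDl divr_ge0 ?exprn_ge0// mulr_ge0.
elim: k => [|k IH].
  by rewrite add0n subrr nm0 expr0 divr1 subrr mul0r.
have -> : x (k.+1 + n)%N - x n = (x (k + n).+1 - x (k + n)%N) + (x (k + n)%N - x n).
  by rewrite addrA subrK.
apply: le_trans (nmD (sip_B (Hx _) (Hx _)) (sip_B (Hx _) (Hx _))) _.
apply: le_trans (lerD (xc _) IH) _.
have -> : c / 4 ^+ (k + n) = c / 4 ^+ k / 4 ^+ n.
  by rewrite exprD; field; rewrite !expf_neq0.
rewrite -mulrDl ler_wpM2r ?invr_ge0 ?exprn_ge0// exprS.
have -> : 2 * c / (4 * 4 ^+ k) = (c / 4 ^+ k) / 2.
  by field; rewrite !expf_neq0.
have : 0 <= c / 4 ^+ k by rewrite divr_ge0// exprn_ge0.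
by rewrite -mulrA; lra.
Qed.

(** The representing vector minimises [J w = B w w - 2 F w], which is bounded below by [- M^2]
    because [F] is bounded. The equation [B w u = F u] is the vanishing of the first variation at
    the minimum. *)
Lemma riesz (F : V -> R) (M : R) : geom_complete H B ->
  (forall u v, H u -> H v -> F (u + v) = F u + F v) ->
  (forall k u, H u -> F (k *: u) = k * F u) ->
  (forall u, H u -> `|F u| <= M * N (u)) ->
  exists2 w, H w & forall u, H u -> B w u = F u.
Proof.
move=> HC FD FZ FM.
pose J w := B w w - 2 * F w.
have Jge w : H w -> - M ^+ 2 <= J w.
  move=> Hw; rewrite /J -nm_sqr//; have := FM w Hw.
  rewrite ler_norml => /andP[_]; have := sqr_ge0 (N (w) - M); nra.
have JD u v t : H u -> H v ->
    J (u + t *: v) = J u + 2 * t * (B u v - F v) + t ^+ 2 * B v v.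
  by move=> Hu Hv; rewrite /J sip_sqr// FD// ?FZ//; [ring|exact: (sip_Z HB)].
pose S := [set J w | w in H].
have S0 : S !=set0 by exists (J 0), 0 => //; exact: (sip_0 HB).
have hS : has_inf S by split => //; exists (- M ^+ 2) => _ [w Hw <-]; exact: Jge.
pose m := inf S.
have Jm w : H w -> m <= J w by move=> Hw; apply: ge_inf; [case: hS|exists w].
(* [J] is quadratic, so errors [16^-n] in its value yield errors of order [4^-n] in the norm, as
   [geom_complete] requires. *)
have e0 n : 0 < (1 / 4 ^+ n) ^+ 2 :> R by rewrite exprn_gt0// divr_gt0// exprn_gt0.
have /choice [x Hx] : forall n, exists w, H w /\ J w < m + (1 / 4 ^+ n) ^+ 2.
  by move=> n; have [_ [w Hw <-] Jw] := inf_adherent (e0 n) hS; exists w.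
have HHx n := (Hx n).1.
have xn n : N (x n.+1 - x n) <= 2 / 4 ^+ n.
  have Hd : H (x n.+1 - x n) by exact: sip_B.
  rewrite -(@ler_pXn2r _ 2)// ?nnegrE ?nm_ge0 ?divr_ge0 ?exprn_ge0// nm_sqr//.
  (* Parallelogram law: a quarter of the squared distance is the mean of [J] at the two points minus
     [J] at their midpoint, and the latter is at least [m]. *)
  have h1 := JD _ _ 1 (HHx n) Hd; have h2 := JD _ _ (1 / 2) (HHx n) Hd.
  rewrite scale1r addrC subrK in h1.
  have h3 : m <= J (x n + (1 / 2) *: (x n.+1 - x n)).
    by apply: Jm; apply: (sip_D HB) => //; exact: (sip_Z HB).
  have h4 := (Hx n).2; have h5 := (Hx n.+1).2.
  have h6 : (1 / 4 ^+ n.+1) ^+ 2 <= (1 / 4 ^+ n) ^+ 2 :> R.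
    rewrite lerXn2r ?nnegrE ?divr_ge0 ?exprn_ge0// !div1r.
    by rewrite lef_pV2 ?posrE ?exprn_gt0// ler_weXn2l// ler1n.
  have -> : (2 / 4 ^+ n) ^+ 2 = 4 * (1 / 4 ^+ n) ^+ 2 :> R by ring.
  by rewrite h2 in h3; rewrite h1 in h5; nra.
have [l Hl xl] := HC x 2 HHx xn.
exists l => // u Hu; apply/eqP; rewrite -subr_eq0 -normr_le0.
apply: (@le0_of_geometric _ _ (9 * N (u))) => n.
have h1 : `|B (x n) u - F u| <= N (u) / 4 ^+ n.
  (* The polynomial [J (x n + t *: u) - m] in [t] is nonnegative, so its discriminant bounds the
     first variation at an almost minimal point. *)
  have : (B (x n) u - F u) ^+ 2 <= (1 / 4 ^+ n) ^+ 2 * B u u.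
    apply: discr_le; first exact: (sip_ge0 HB).
    move=> t; have := Jm (x n + t *: u); rewrite JD//.
    move=> /(_ (sip_D HB (HHx n) (sip_Z HB t Hu))); have := (Hx n).2; lra.
  rewrite -nm_sqr// -exprMn -[X in X <= _]real_normK ?num_real//.
  rewrite ler_pXn2r// ?nnegrE ?mulr_ge0 ?nm_ge0 ?divr_ge0 ?exprn_ge0//.
  by rewrite div1r mulrC.
have h2 : `|B (l - x n) u| <= 8 * N (u) / 4 ^+ n.
  apply: le_trans (sip_cs (sip_B Hl (HHx n)) Hu) _.
  have := ler_wpM2r (nm_ge0 u) (xl n); move=> /le_trans; apply.
  by rewrite le_eqVlt; apply/orP; left; apply/eqP; ring.
have -> : B l u - F u = B (l - x n) u + (B (x n) u - F u).
  by rewrite sip_Bl//; ring.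
apply: le_trans (ler_normD _ _) _; apply: le_trans (lerD h2 h1) _.
by rewrite le_eqVlt; apply/orP; left; apply/eqP; ring.
Qed.

End semi_inner_product.

Lemma cvg_of_geometric (R : realType) (u : nat -> R) (M : R) :
  (forall n, `|u n.+1 - u n| <= M / 2 ^+ n) -> cvgn u.
Proof.
move=> H.
have -> : u = (fun n => u 0%N + series (telescope u) n).
  by apply/funext => n; exact: eq_sum_telescope.
apply: is_cvgD; first exact: is_cvg_cst.
apply: normed_cvg; apply: (@series_le_cvg _ _ (geometric M (2^-1))).
- by move=> n; exact: normr_ge0.
- by move=> n; rewrite /geometric/= mulr_ge0// ?exprn_ge0//; have := le_trans (normr_ge0 _) (H 0%N); rewrite expr0 divr1.
- by move=> n; rewrite /geometric/= exprVn; exact: H.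
- by apply: is_cvg_geometric_series; rewrite ger0_norm// invf_lt1// ltr1n.
Qed.

Lemma cvg_geom_bound (R : realType) (u : nat -> R) (l C : R) :
  (forall n, `|u n - l| <= C / 4 ^+ n) -> u @ \oo --> l.
Proof.
move=> H; apply/cvgrPdist_le => e e0.
have : geometric C (4^-1) @ \oo --> (0 : R).
  by apply: cvg_geometric; rewrite ger0_norm// invf_lt1// ltr1n.
move=> /cvgrPdist_le /(_ e e0); apply: filterS => n.
rewrite /geometric/= sub0r normrN exprVn distrC => /(le_trans _); apply.
exact: le_trans (H n) (ler_norm _).
Qed.

(** * Completeness of L^2 and passage to H^1 *)

Section completeness.
Context {R : realType}.
Local Notation mu := (@lebesgue_measure R).
Implicit Types (f g F G phi : R -> R) (a b c d e x y z : R).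

Lemma semi_ip_L2 : semi_ip (@L2 R) ip.
Proof.
split.
- exact: L2_0.
- by move=> *; exact: L2D.
- by move=> *; exact: L2Z.
- by move=> *; exact: ipC.
- by move=> *; exact: ipDl.
- by move=> *; exact: ipZl.
- by move=> *; exact: ip_ge0.
Qed.

Lemma semi_ip_H1R : semi_ip (@H1R R) hip.
Proof.
split.
- exact: H1R0.
- by move=> *; exact: H1RD.
- by move=> *; exact: H1RZ.
- by move=> *; exact: hipC.
- by move=> *; exact: hipDl.
- by move=> *; exact: hipZl.
- by move=> *; exact: hip_ge0.
Qed.

Lemma int_sqr f : L2 f -> (\int[mu]_x ((f x ^+ 2)%:E) = (ip f f)%:E)%E.
Proof.
move=> lf; rewrite /ip /Rintegral fineK; last first.
  by apply: integrable_fin_num => //; exact: L2M.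
by apply: eq_integral => x _; rewrite expr2.
Qed.

Lemma L2_limit (g : nat -> R -> R) G c : (forall n, L2 (g n)) ->
  (forall n, nm ip (g n.+1 - g n) <= c / 4 ^+ n) -> measurable_fun setT G ->
  {ae mu, forall t, g n t @[n --> \oo] --> G t} ->
  forall n, L2 (G - g n) /\ nm ip (G - g n) <= 2 * c / 4 ^+ n.
Proof.
move=> lg gc mG aeG.
have mg n : measurable_fun setT (g n) by exact: L2_measurable.
have lgB n m : L2 (g n - g m) by exact: (sip_B semi_ip_L2).
have c0 : 0 <= c by have := le_trans (nm_ge0 _ _) (gc 0%N); rewrite expr0 divr1.
have bound n : (\int[mu]_t ((G t - g n t) ^+ 2)%:E <= ((2 * c / 4 ^+ n) ^+ 2)%:E)%E.
  pose v m t := ((g (m + n)%N t - g n t) ^+ 2)%:E.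
  have mv m : measurable_fun setT (v m).
    by apply/measurable_EFinP; apply: measurable_funX; apply: measurable_funB.
  have -> : (\int[mu]_t ((G t - g n t) ^+ 2)%:E = \int[mu]_t limn_einf (v^~ t))%E.
    apply: ae_eq_integral => //.
    - apply/measurable_EFinP; apply: measurable_funX.
      by apply: measurable_funB; [exact: mG|exact: mg].
    - apply: measurableT_comp; first exact: oppe_measurable.
      apply: (measurable_fun_limn_esup (f := fun m t => (- v m t)%E)) => m.
      exact: measurableT_comp.
    - apply: ae_imp aeG => t gt _.
      have : v m t @[m --> \oo] --> ((G t - g n t) ^+ 2)%:E.
        apply: cvg_EFin; first exact: nearW.
        apply: cvgM; apply: cvgB; try exact: cvg_cst.
          by have := gt; rewrite -(cvg_shiftn n).
        by have := gt; rewrite -(cvg_shiftn n).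
      by move=> /cvg_limn_einf_sup[-> _].
  apply: le_trans (fatou _ _ _ _) _ => //.
    by move=> m t _; rewrite lee_fin sqr_ge0.
  rewrite limn_einf_lim; apply: lime_le; first exact: is_cvg_einfs.
  apply: nearW => m.
  apply: (@le_trans _ _ (\int[mu]_t v m t)%E).
    by apply: ereal_inf_lbound; exists m => /=.
  rewrite (int_sqr (lgB (m + n)%N n)) lee_fin -(nm_sqr semi_ip_L2)//.
  have H := nm_geom semi_ip_L2 lg gc (leq_addl m n).
  by rewrite lerXn2r// nnegrE ?nm_ge0// (le_trans (nm_ge0 _ _) H).
have lGB n : L2 (G - g n).
  apply/L2P; split; first by apply: measurable_funB.
  apply/integrableP; split.
    apply/measurable_EFinP; apply: measurable_funX.
    by apply: measurable_funB; [exact: mG|exact: mg].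
  apply: le_lt_trans (ltry _); apply: le_trans (bound n).
  rewrite le_eqVlt; apply/orP; left; apply/eqP; apply: eq_integral => t _.
  by rewrite /= ger0_norm ?sqr_ge0.
move=> n; split=> //.
rewrite -(@ler_pXn2r _ 2)// ?nnegrE ?nm_ge0 ?divr_ge0 ?exprn_ge0 ?mulr_ge0//.
by rewrite (nm_sqr semi_ip_L2)// -lee_fin -int_sqr//; exact: bound.
Qed.

Lemma L2_complete (g : nat -> R -> R) c : (forall n, L2 (g n)) ->
  (forall n, nm ip (g n.+1 - g n) <= c / 4 ^+ n) ->
  exists2 G, L2 G & forall n, nm ip (G - g n) <= 2 * c / 4 ^+ n.
Proof.
move=> lg gc.
have mg n : measurable_fun setT (g n) by exact: L2_measurable.
have lgB n m : L2 (g n - g m) by exact: (sip_B semi_ip_L2).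
(* The weight [4^n] leaves integrals of order [4^-n], so the series is integrable and almost
   everywhere finite; where it is finite, the increments are at most [M / 2^n] and [g n t]
   converges. *)
pose D n t := ((4 ^+ n * (g n.+1 t - g n t) ^+ 2)%:E : \bar R).
have D0 n t : (0 <= D n t)%E by rewrite lee_fin mulr_ge0 ?sqr_ge0// exprn_ge0.
have mD n : measurable_fun setT (D n).
  apply/measurable_EFinP; apply: measurable_funM => //.
  by apply: measurable_funX; apply: measurable_funB.
pose T t := (\sum_(0 <= n <oo) D n t)%E.
have mT : measurable_fun setT T.
  by apply: ge0_emeasurable_sum => // n t _ _; exact: D0.
have T0 t : (0 <= T t)%E by apply: nneseries_ge0 => n _ _; exact: D0.
have c0 : 0 <= c by have := le_trans (nm_ge0 _ _) (gc 0%N); rewrite expr0 divr1.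
have intD n : (\int[mu]_t D n t <= (c ^+ 2 / 4 ^+ n)%:E)%E.
  have -> : (\int[mu]_t D n t = (4 ^+ n * ip (g n.+1 - g n) (g n.+1 - g n))%:E)%E.
    rewrite EFinM -int_sqr// -ge0_integralZl//.
    - apply/measurable_EFinP; apply: measurable_funX.
      exact: (L2_measurable (lgB n.+1 n)).
    - by move=> t _; rewrite lee_fin sqr_ge0.
  rewrite lee_fin -(nm_sqr semi_ip_L2)//.
  apply: (@le_trans _ _ (4 ^+ n * (c / 4 ^+ n) ^+ 2)).
    rewrite ler_wpM2l ?exprn_ge0// lerXn2r ?nnegrE ?nm_ge0//.
    by rewrite divr_ge0// exprn_ge0.
  by rewrite le_eqVlt; apply/orP; left; apply/eqP; field; rewrite expf_neq0.
have intTN N : (\sum_(0 <= n < N) \int[mu]_t D n t <=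
    (2 * c ^+ 2 - 2 * c ^+ 2 / 4 ^+ N)%:E)%E.
  rewrite big_mkord; elim: N => [|N IH]; first by rewrite big_ord0 expr0 divr1 subrr.
  rewrite big_ord_recr /=; apply: le_trans (leeD IH (intD N)) _.
  rewrite -EFinD lee_fin [4 ^+ N.+1]exprS.
  have -> : 2 * c ^+ 2 / (4 * 4 ^+ N) = (c ^+ 2 / 4 ^+ N) / 2.
    by field; rewrite expf_neq0.
  have : 0 <= c ^+ 2 / 4 ^+ N by rewrite divr_ge0 ?exprn_ge0.
  by rewrite -mulrA; lra.
have intT : (\int[mu]_t T t <= (2 * c ^+ 2)%:E)%E.
  rewrite integral_nneseries//.
  apply: lime_le; first by apply: is_cvg_nneseries => n _ _; exact: integral_ge0.
  apply: nearW => N; apply: le_trans (intTN N) _.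
  by rewrite lee_fin gerBl divr_ge0 ?exprn_ge0// mulr_ge0// exprn_ge0.
have iT : mu.-integrable setT T.
  apply/integrableP; split => //.
  under eq_integral do rewrite gee0_abs//.
  by apply: le_lt_trans intT _; rewrite ltry.
have aeT : {ae mu, forall t, T t \is a fin_num}.
  by have := integrable_ae measurableT iT; apply: ae_imp => t; exact.
(* The upper limit exists everywhere and is measurable; it is the limit wherever [T] is finite. *)
pose G t := fine (limn_esup (fun n => (g n t)%:E)).
have mG : measurable_fun setT G.
  apply: measurableT_comp => //; apply: measurable_fun_limn_esup => n.
  exact/measurable_EFinP.
have cvgG t : T t \is a fin_num -> g n t @[n --> \oo] --> G t.
  move=> Tt; pose M := Num.sqrt (fine (T t)).
  have H n : `|g n.+1 t - g n t| <= M / 2 ^+ n.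
    have : (D n t <= T t)%E.
      by rewrite /T (@nneseriesD1 _ _ n)// leeDl// nneseries_ge0.
    rewrite -(fineK Tt) lee_fin => H.
    rewrite -[leLHS]sqrtr_sqr /M ler_pdivlMr ?exprn_gt0//.
    have -> : 2 ^+ n = Num.sqrt (4 ^+ n) :> R.
      have -> : 4 = 2 ^+ 2 :> R by ring.
      by rewrite -exprM mulnC exprM sqrtr_sqr ger0_norm// exprn_ge0.
    by rewrite -sqrtrM ?sqr_ge0// ler_wsqrtr// mulrC.
  have cv := cvg_of_geometric H.
  have cvE : (g n t)%:E @[n --> \oo] --> (limn (fun n => g n t))%:E.
    by apply: cvg_EFin; [exact: nearW|exact: cv].
  have [_ E] := cvg_limn_einf_sup cvE.
  by rewrite /G E.
have H := L2_limit lg gc mG (ae_imp cvgG aeT).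
exists G => [|n].
  by rewrite -[G](subrK (g 0%N)); apply: (sip_D semi_ip_L2) => //; case: (H 0%N).
by case: (H n).
Qed.

Lemma int_itv_cs g a b : a <= b -> L2 g ->
  `|\int[mu]_(x in `[a, b]) g x| <= Num.sqrt (b - a) * nm ip g.
Proof.
move=> ab lg.
pose k : R -> R := \1_`[a, b]%classic.
have ik x : k x * k x = k x by rewrite /k indicE; case: (_ \in _); rewrite ?mulr1 ?mulr0.
have lk : L2 k.
  apply/L2P; split; first exact: measurable_indic.
  under eq_fun do rewrite expr2 ik.
  exact: integrable_indic_itv.
have -> : \int[mu]_(x in `[a, b]) g x = ip g k by rewrite (@int_indic _ `[a, b]).
have -> : Num.sqrt (b - a) = nm ip k.
  congr Num.sqrt; rewrite -[LHS]mul1r -int_itv_cst// (@int_indic _ `[a, b])//.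
  by apply: eq_Rintegral => x _; rewrite mul1r ik.
by rewrite mulrC; exact: (sip_cs semi_ip_L2).
Qed.

Lemma h1B f g F G : h1 f F -> h1 g G -> h1 (f - g) (F - G).
Proof.
move=> hf hg; have := h1D hf (h1Z (-1) hg).
have E h k : (fun x => h x + -1 * k x) = h - k :> (R -> R).
  by apply/funext => x; rewrite mulN1r.
by rewrite !E.
Qed.

Lemma nm_h1_le f F : h1 f F ->
  (nm ip f <= nm hip f) * (nm ip F <= nm hip f).
Proof.
move=> hf; have E := hipE hf hf.
by split; rewrite ler_wsqrtr// E ?lerDl ?lerDr ip_ge0.
Qed.

Lemma nm_h1_ge f F : h1 f F -> nm hip f <= nm ip f + nm ip F.
Proof.
move=> hf; case: (hf) => lf lF _.
rewrite -(@ler_pXn2r _ 2)// ?nnegrE ?addr_ge0 ?nm_ge0//.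
rewrite (nm_sqr semi_ip_H1R) ?(hipE hf hf); last exact: h1_H1R hf.
rewrite sqrrD !(nm_sqr semi_ip_L2)// lerD2r lerDl.
by rewrite mulrn_wge0// mulr_ge0 ?nm_ge0.
Qed.

(** The functions converge pointwise by the sup bound, their derivatives in L^2; integrals over
    bounded intervals pass to the limit, so the second limit is the density of the first. The factor
    4 adds the 2 for the functions and the 2 for the derivatives. *)
Lemma H1R_complete : geom_complete (@H1R R) hip.
Proof.
move=> x c Hx xc.
have hx n := H1R_h1 (Hx n).
pose g n := wderiv (x n).
have hd n : h1 (x n.+1 - x n) (g n.+1 - g n) by exact: h1B.
have lx n : L2 (x n) by case: (hx n).
have lg n : L2 (g n) by case: (hx n).
have xr n : nm ip (x n.+1 - x n) <= c / 4 ^+ n by rewrite (le_trans (nm_h1_le (hd n)).1).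
have gr n : nm ip (g n.+1 - g n) <= c / 4 ^+ n by rewrite (le_trans (nm_h1_le (hd n)).2).
have c0 : 0 <= c by have := le_trans (nm_ge0 _ _) (xc 0%N); rewrite expr0 divr1.
have cx t : cvgn (fun n => x n t).
  apply: (@cvg_of_geometric _ _ c) => n.
  apply: le_trans (H1R_sup_norm t (h1_H1R (hd n))) _.
  apply: le_trans (xc n) _; rewrite ler_wpM2l// lef_pV2 ?posrE ?exprn_gt0//.
  by rewrite lerXn2r ?nnegrE// ler_nat.
pose l t := limn (fun n => x n t).
have xl t : x n t @[n --> \oo] --> l t by exact: cx.
have ml : measurable_fun setT l.
  apply: (measurable_fun_cvg (h := x)); last by move=> t _; exact: xl.
  by move=> n; exact: L2_measurable.
have HL := L2_limit lx xr ml (aeW mu xl).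
have [F lF gF] := L2_complete lg gr.
have ll : L2 l by rewrite -[l](subrK (x 0%N)); apply: (sip_D semi_ip_L2) => //; case: (HL 0%N).
have acl : ac l F.
  split=> [|a b ab]; first exact: L2_loc.
  have H n : x n b - x n a = \int[mu]_(t in `[a, b]) g n t by case: (hx n) => _ _ [_ ->].
  have c1 : (fun n => x n b - x n a) @ \oo --> l b - l a by apply: cvgB; exact: xl.
  have c2 : (fun n => x n b - x n a) @ \oo --> \int[mu]_(t in `[a, b]) F t.
    apply: (@cvg_geom_bound _ _ _ (Num.sqrt (b - a) * (2 * c))) => n.
    rewrite H -RintegralB//; last 2 first.
    - exact: L2_loc.
    - exact: L2_loc.
    apply: le_trans (int_itv_cs ab _) _; first exact: (sip_B semi_ip_L2).
    rewrite -mulrA ler_wpM2l ?sqrtr_ge0//.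
    by apply: le_trans (gF n); rewrite le_eqVlt -(nm_dist semi_ip_L2 lF (lg n)) eqxx.
  exact: (cvg_unique _ c1 c2).
have hl : h1 l F by [].
exists l => [|n]; first exact: h1_H1R hl.
apply: le_trans (nm_h1_ge (h1B hl (hx n))) _.
apply: le_trans (lerD (HL n).2 (gF n)) _.
by rewrite -mulrDl ler_wpM2r ?invr_ge0 ?exprn_ge0//; lra.
Qed.

End completeness.

(** * The operator as a multiplication plus a compact remainder *)

(** Here [i] is the value of an indicator. The factors [u] and [v] are replaced by their bounds [a]
    and [b], and the two functions [U] and [V] that are only square integrable are left as a
    product. *)
Lemma kappa_pointwise (R : realFieldType) (u U v V a b i : R) :
  `|v| <= b -> `|u| <= a -> i * i = i -> 0 <= i ->
  `|(2 * U ^+ 2 * v + 4 * u * U * V - u ^+ 2 * v) * i| <=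
  2 * b * ((U * i) * (U * i)) + 4 * a * (`|U * i| * `|V|) + b * ((u * i) * (u * i)).
Proof.
move=> vb ua i2 i0.
have -> : (U * i) * (U * i) = U ^+ 2 * i by rewrite -[in RHS]i2; ring.
have -> : (u * i) * (u * i) = u ^+ 2 * i by rewrite -[in RHS]i2; ring.
have hU : 0 <= U ^+ 2 * i by rewrite mulr_ge0// sqr_ge0.
have h3 : 0 <= u ^+ 2 * i by rewrite mulr_ge0// sqr_ge0.
have hV : 0 <= `|U * i| * `|V| by rewrite mulr_ge0.
have -> : (2 * U ^+ 2 * v + 4 * u * U * V - u ^+ 2 * v) * i =
  2 * (U ^+ 2 * i) * v + 4 * u * ((U * i) * V) - (u ^+ 2 * i) * v by ring.
apply: le_trans (ler_normB _ _) _; apply: lerD.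
  apply: le_trans (ler_normD _ _) _; apply: lerD.
    have h2 : 0 <= 2 * (U ^+ 2 * i) by rewrite mulr_ge0.
    rewrite normrM (ger0_norm h2) -mulrA (mulrCA 2 b) -mulrA.
    by rewrite mulrA [leRHS]mulrC ler_wpM2l.
  rewrite !normrM (@ger0_norm _ 4)// -!mulrA ler_pM2l// ler_wpM2r//.
by rewrite normrM (ger0_norm h3) mulrC ler_wpM2r.
Qed.

Section operator.
Context {R : realType}.
Local Notation mu := (@lebesgue_measure R).
Local Notation N := (nm (@hip R)).
Implicit Types (f g F G phi v : R -> R) (a b c d e x y z : R).

Lemma H1R_nm_sup v x : H1R v -> `|v x| <= N v.
Proof. exact: H1R_sup_norm. Qed.

Lemma L1Mb c f g : measurable_fun setT g -> (forall x, `|g x| <= c) -> L1 f ->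
  L1 (fun x => f x * g x).
Proof.
move=> mg gc lf; apply: (@le_L1 _ (fun x => c * `|f x|)).
- by apply: measurable_funM => //; exact: L1_measurable.
- by move=> x; rewrite normrM mulrC ler_wpM2r.
- by apply: L1Z; exact: L1_norm.
Qed.

Lemma int_normM_le c f g : measurable_fun setT g -> (forall x, `|g x| <= c) -> L1 f ->
  `|\int[mu]_x (f x * g x)| <= c * \int[mu]_x `|f x|.
Proof.
move=> mg gc lf.
have l : L1 (fun x => f x * g x) by exact: L1Mb gc lf.
apply: le_trans (le_normr_Rintegral _ _) _ => //.
rewrite -RintegralZl//; last exact: L1_norm.
apply: le_Rintegral => //; first exact: L1_norm.
  by apply: L1Z; exact: L1_norm.
by move=> x _; rewrite normrM mulrC ler_wpM2r.
Qed.

Variable u : R -> R.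
Hypothesis hu : H1R u.
Local Notation U := (wderiv u).

(* The density of [M v - u^2 v] in the H^1 pairing: the second derivatives
   cancel in the integration by parts. *)
Definition kappa v x :=
  2 * U x ^+ 2 * v x + 4 * u x * U x * wderiv v x - u x ^+ 2 * v x.

Let lU : L2 U. Proof. by case: (H1R_h1 hu). Qed.
Let lu : L2 u. Proof. by case: (H1R_h1 hu). Qed.

Lemma L1_kappa v : H1R v -> L1 (kappa v).
Proof.
move=> hv; have [lv lV _] := H1R_h1 hv; apply: L1B.
- apply: L1D.
    apply: (L1Mb (H1R_measurable hv) (fun x => H1R_nm_sup x hv)).
    by apply: L1Z; exact: L2_sqr.
  have := L1Z 4 (L2M (L2Mh hu lU) lV).
  by apply: eq_integrable => // x _ /=; congr EFin; ring.
- apply: (L1Mb (H1R_measurable hv) (fun x => H1R_nm_sup x hv)).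
  exact: L2_sqr.
Qed.

(** The factor by which the H^1 norm of [v] controls the L^1 norm of [kappa v] on [A]. It depends on
    [A] only through the L^2 mass of [u] and [U] there, so it is small for neighbourhoods of
    infinity. *)
Definition weight (A : set R) :=
  2 * ip (fun x => U x * \1_A x) (fun x => U x * \1_A x)
  + 4 * N u * nm ip (fun x => U x * \1_A x)
  + ip (fun x => u x * \1_A x) (fun x => u x * \1_A x).

Lemma weight_ge0 A : 0 <= weight A.
Proof. by rewrite !addr_ge0 ?ip_ge0 ?mulr_ge0 ?ip_ge0 ?nm_ge0. Qed.

Lemma int_kappa_indic A v : measurable A -> H1R v ->
  \int[mu]_x `|kappa v x * \1_A x| <= weight A * N v.
Proof.
move=> mA hv; have [lv lV _] := H1R_h1 hv.
have lUA := L2_indic mA lU; have luA := L2_indic mA lu.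
have lV' := L2_norm lV; have lUA' := L2_norm lUA.
have l1 : L1 (fun x => 2 * N v * ((U x * \1_A x) * (U x * \1_A x))) by exact/L1Z/L2M.
have l2 : L1 (fun x => 4 * N u * (`|U x * \1_A x| * `|wderiv v x|)) by exact/L1Z/L2M.
have l3 : L1 (fun x => N v * ((u x * \1_A x) * (u x * \1_A x))) by exact/L1Z/L2M.
have lk : L1 (fun x => `|kappa v x * \1_A x|).
  by apply: L1_norm; apply: L1_indic => //; exact: L1_kappa.
apply: le_trans (le_Rintegral _ lk (L1D (L1D l1 l2) l3) _) _ => //.
  move=> x _; rewrite /kappa.
  apply: kappa_pointwise; [exact: H1R_nm_sup|exact: H1R_nm_sup| |].
    by rewrite indicE; case: (x \in A); rewrite ?mulr1 ?mulr0.
  by rewrite indicE ler0n.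
rewrite (RintegralD measurableT (L1D l1 l2) l3) (RintegralD measurableT l1 l2).
rewrite !RintegralZl//; [|exact: L2M|exact: L2M|exact: L2M].
rewrite -![Rintegral mu setT _]/(ip _ _) /weight.
have hV : nm ip (wderiv v) <= N v by case: (nm_h1_le (H1R_h1 hv)).
have := sip_cs semi_ip_L2 lUA' lV'.
have E1 f : nm ip (fun x => `|f x|) = nm ip f.
  by congr Num.sqrt; apply: eq_Rintegral => x _; rewrite -normrM ger0_norm// -expr2 sqr_ge0.
rewrite !E1 => /(le_trans (ler_norm _)) H.
have H2 : 4 * N u * ip (fun x => `|U x * \1_A x|) (fun x => `|wderiv v x|) <=
    4 * N u * (nm ip (fun x => U x * \1_A x) * N v).
  rewrite ler_wpM2l ?mulr_ge0 ?nm_ge0//; apply: le_trans H _.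
  by rewrite ler_wpM2l ?nm_ge0.
apply: le_trans (lerD (lerD (lexx _) H2) (lexx _)) _.
have aux (p q r a n : R) : 2 * n * p + 4 * a * (q * n) + n * r <= (2 * p + 4 * a * q + r) * n.
  by rewrite le_eqVlt; apply/orP; left; apply/eqP; ring.
exact: aux.
Qed.

Lemma int_kappa v : H1R v -> \int[mu]_x `|kappa v x| <= weight setT * N v.
Proof.
move=> hv; have := int_kappa_indic measurableT hv.
by under eq_Rintegral do rewrite indicT mulr1.
Qed.

Lemma L1_kappaM v phi : H1R v -> H1R phi -> L1 (fun x => kappa v x * phi x).
Proof.
move=> hv hp; apply: (L1Mb (H1R_measurable hp) (fun x => H1R_nm_sup x hp)).
exact: L1_kappa.
Qed.

Lemma kappa_bound v phi : H1R v -> H1R phi ->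
  `|\int[mu]_x (kappa v x * phi x)| <= weight setT * N v * N phi.
Proof.
move=> hv hp.
have := int_normM_le (H1R_measurable hp) (fun x => H1R_nm_sup x hp) (L1_kappa hv).
move=> /le_trans; apply; rewrite mulrC ler_wpM2r ?nm_ge0//; exact: int_kappa.
Qed.

(** The functional is bounded because [kappa v] is integrable and [phi] is bounded. The hypothesis
    on [v] stands under the quantifier so that choice yields an operator on all functions. *)
Lemma opK_ex v : exists w, H1R v ->
  H1R w /\ forall phi, H1R phi -> hip w phi = \int[mu]_x (kappa v x * phi x).
Proof.
have [hv|] := pselect (H1R v); last by exists 0.
pose F phi := \int[mu]_x (kappa v x * phi x).
have [|||w Hw E] := @riesz _ _ _ _ semi_ip_H1R F (weight setT * N v) (@H1R_complete R).
- move=> f g hf hg; rewrite /F -RintegralD//; [|exact: L1_kappaM|exact: L1_kappaM].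
  by apply: eq_Rintegral => x _; rewrite mulrDr.
- move=> k f hf; rewrite /F -RintegralZl//; last exact: L1_kappaM.
  by apply: eq_Rintegral => x _; rewrite /GRing.scale/= mulrCA.
- by move=> f hf; exact: kappa_bound.
by exists w.
Qed.

Definition opK v := sval (cid (opK_ex v)).

Lemma H1R_opK v : H1R v -> H1R (opK v).
Proof. by move=> hv; have [] := svalP (cid (opK_ex v)) hv. Qed.

Lemma hip_opK v phi : H1R v -> H1R phi ->
  hip (opK v) phi = \int[mu]_x (kappa v x * phi x).
Proof. by move=> hv; have [_] := svalP (cid (opK_ex v)) hv; apply. Qed.

Lemma h1_usqr : h1 (fun x => u x * u x) (fun x => U x * u x + u x * U x).
Proof. by have h := H1R_h1 hu; exact: h1M. Qed.

(** After expansion by the product rule, the terms with the derivative of [phi] are those of the H^1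
    pairing with [u^2 v]; the remaining ones multiply [phi] itself and form [kappa]. *)
Lemma opMR_form v phi : H1R v -> H1R phi ->
  dual_mul (fun x => 2 * u x * v x) (dual_d2 u) phi
    + dual_mul (fun x => u x ^+ 2) (dual_d2 v) phi =
  - (hip (fun x => u x ^+ 2 * v x) phi + \int[mu]_x (kappa v x * phi x)).
Proof.
move=> hv hp; have h_v := H1R_h1 hv; have h_p := H1R_h1 hp; have h_u := H1R_h1 hu.
have [lv lV _] := h_v; have [lp lP _] := h_p.
have h1' := h1M (h1M (h1Z 2 h_u) h_v) h_p.
have h2' : h1 (fun x => u x ^+ 2 * phi x) _ := h1M h1_usqr h_p.
have h3' : h1 (fun x => u x ^+ 2 * v x) _ := h1M h1_usqr h_v.
rewrite (hipE h3' h_p) /dual_mul /dual_d2.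
rewrite -!/(ip _ _) (ipC U) (ip_ae _ _ _ (h1_uniq h1')) //; last 2 first.
- by case: (H1R_h1 (h1_H1R h1')).
- by case: h1'.
rewrite (ipC (wderiv v)) (ip_ae _ _ _ (h1_uniq h2')) //; last 2 first.
- by case: (H1R_h1 (h1_H1R h2')).
- by case: h2'.
rewrite -opprD; congr (- _).
have [_ m1 _] := h1'; have [_ m2 _] := h2'; have [m3 m4 _] := h3'.
rewrite /ip -RintegralD//; [|exact: L2M|exact: L2M].
rewrite -RintegralD//; [|by apply: L1D; exact: L2M|exact: L1_kappaM].
rewrite -RintegralD//; [|exact: L2M|exact: L2M].
by apply: eq_Rintegral => x _; rewrite /kappa; ring.
Qed.

(** [helmholtz_inv] is defined by choice. The right-hand side, up to sign, is admissible, and two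
    admissible functions coincide because their difference is orthogonal to itself. *)
Lemma opMRE v : H1R v -> opMR u v = (fun x => u x ^+ 2 * v x) + opK v.
Proof.
move=> hv.
have husv : H1R (fun x => u x ^+ 2 * v x) by exact: (H1RM (h1_H1R h1_usqr) hv).
have hK := H1R_opK hv.
have hw := sip_D semi_ip_H1R husv hK.
pose w := - ((fun x => u x ^+ 2 * v x) + opK v).
have Hw : H1R w by exact: (sip_N semi_ip_H1R).
have spec phi : H1R phi -> hip w phi =
    dual_mul (fun x => 2 * u x * v x) (dual_d2 u) phi
    + dual_mul (fun x => u x ^+ 2) (dual_d2 v) phi.
  move=> hp; rewrite opMR_form// -hip_opK//.
  have -> : hip w phi = - hip ((fun x => u x ^+ 2 * v x) + opK v) phi.
    by rewrite /w -scaleN1r (sip_Zl semi_ip_H1R)// mulN1r.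
  by rewrite (sip_Dl semi_ip_H1R).
rewrite /opMR /helmholtz_inv; case: xgetP => [w' _ [hw' Hw']|/(_ w) []]; last first.
  split=> // phi hp; rewrite -spec// /hip /ip /dual_d2 opprK//.
suff -> : w' = w by rewrite /w opprK.
apply/eqP; rewrite -subr_eq0; apply/eqP.
have hd := sip_B semi_ip_H1R hw' Hw.
apply: H1R_eq0 => //; rewrite {1}/GRing.add/=.
rewrite (sip_Bl semi_ip_H1R)// spec// -Hw'// /hip /ip /dual_d2 !opprK subrr //.
Qed.

End operator.

(** * Infinite codimension on the range of the square of the profile *)

Section bump.
Context {R : realType}.
Local Notation mu := (@lebesgue_measure R).
Local Notation N := (nm (@hip R)).
Implicit Types (f g F G phi v w : R -> R) (a b c d e x y z : R).

Lemma h1_smooth_bump a b e : 0 <= e ->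
  h1 (smooth_bump a b e) (fun x => hat a e x - hat b e x).
Proof.
move=> e0; have [dS cS _] := C1c_smooth_bump a b e0.
have acS := ac_C1 dS cS; rewrite derive1_smooth_bump in acS cS.
pose B := `|a| + `|b| + e.
have supp f : continuous f -> (forall x, B < `|x| -> f x = 0) -> L2 f.
  move=> cf fB; apply/L2P; split; first exact: continuous_measurable_fun.
  apply: (@L1_cont_support _ _ (- B) B) => [x|x].
    by apply: (@cvgM _ _ _ _ f f); exact: cf.
  by rewrite -ler_norml leNgt => fx; apply/negP => /fB E; rewrite E expr0n eqxx in fx.
split=> //; apply: supp.
- exact: ac_continuous acS.
- by move=> x; exact: smooth_bump_out.
- exact: cS.
- move=> x Bx; have := derive1_out (fun y => @smooth_bump_out R a b e y e0) Bx.
  by rewrite derive1_smooth_bump.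
Qed.

Lemma bump_ex a b : a < b -> exists w W, [/\ h1 w W, hip w w = 1,
  (forall x, ~~ (a <= x <= b) -> w x = 0 /\ W x = 0) &
  (forall x, `|w x| <= Num.sqrt (b - a))].
Proof.
(* With a quarter of the length, the bump rises on the first half of [[a, b]] and falls on the
   second, reaching [e^2] at the midpoint. *)
move=> ab; pose e := (b - a) / 4.
have e0 : 0 < e by rewrite divr_gt0// subr_gt0.
have ee : e = (b - a) / 4 by [].
have hB := h1_smooth_bump (a + e) (b - e) (ltW e0).
set s := smooth_bump (a + e) (b - e) e in hB.
set S := (fun x => hat (a + e) e x - hat (b - e) e x) in hB.
have out x : ~~ (a <= x <= b) -> s x = 0 /\ S x = 0.
  rewrite negb_and -!ltNge => xab; split.
    rewrite /s /smooth_bump; case/orP: xab => xab.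
      by rewrite !(smooth_step_left (ltW e0)) ?subrr//; lra.
    by rewrite !(smooth_step_right (ltW e0)) ?subrr//; lra.
  have h1 : e <= `|x - (a + e)|.
    by rewrite ler_normr; case/orP: xab => xab; apply/orP; [right|left]; lra.
  have h2 : e <= `|x - (b - e)|.
    by rewrite ler_normr; case/orP: xab => xab; apply/orP; [right|left]; lra.
  by rewrite /S (hat_out (ltW e0) h1) (hat_out (ltW e0) h2) subrr.
have Hs := h1_H1R hB.
have smid : s ((a + b) / 2) = e ^+ 2.
  rewrite /s /smooth_bump (smooth_step_right (ltW e0)); last by lra.
  by rewrite (smooth_step_left (ltW e0)) ?subr0//; lra.
have N0 : N s != 0.
  apply/negP => /eqP Ns; have /(H1R_eq0 Hs) E : hip s s = 0.
    by rewrite -(nm_sqr semi_ip_H1R)// Ns expr0n.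
  by have := smid; rewrite E => /esym/eqP; rewrite sqrf_eq0 gt_eqF.
have hw := h1Z (N s)^-1 hB.
exists (fun x => (N s)^-1 * s x), (fun x => (N s)^-1 * S x).
have w1 : hip (fun x => (N s)^-1 * s x) (fun x => (N s)^-1 * s x) = 1.
  rewrite (sip_Zl semi_ip_H1R)//; last exact: h1_H1R hw.
  rewrite (sip_Zr semi_ip_H1R)// -(nm_sqr semi_ip_H1R)//.
  by rewrite expr2 mulrA -expr2 exprVn -expr2 mulVf// expf_neq0.
split=> //.
- by move=> x /out[-> ->]; rewrite !mulr0.
- move=> x; have [xab|xab] := boolP (a <= x <= b); last first.
    by rewrite (out _ xab).1 mulr0 normr0 sqrtr_ge0.
  have /andP[ax xb] := xab.
  have sa : s a = 0.
    by rewrite /s /smooth_bump !(smooth_step_left (ltW e0)) ?subrr//; lra.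
  (* The bump vanishes at [a] and its derivative has L^2 norm at most 1, so Cauchy-Schwarz makes it
     uniformly small on a short interval although its H^1 norm is 1. *)
  have [_ lW acw] := hw; have := acw.2 a x ax; rewrite sa mulr0 subr0 => ->.
  apply: le_trans (int_itv_cs ax lW) _.
  have n1 : nm ip (fun x => (N s)^-1 * S x) <= 1.
    by apply: le_trans (nm_h1_le hw).2 _; rewrite /nm w1 sqrtr1.
  apply: le_trans (ler_wpM2l (sqrtr_ge0 _) n1) _; rewrite mulr1 ler_wsqrtr//.
  by rewrite lerD2r.
Qed.

End bump.

(** The integrand of the pairing with a bump; [i] is the indicator of its support. Every term
    contains [u^2 - l] on the support, or [w] itself, or [U] restricted to the support, and each of
    these is small in its own norm. *)
Lemma bump_pointwise (R : realFieldType) (u U v V w W k i l eta nu nv : R) :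
  `|v| <= nv -> `|u| <= nu -> 0 <= eta -> `|w| <= eta ->
  (i = 1 -> `|u * u - l| <= eta) -> (i = 0 \/ i = 1) -> w = w * i -> W = W * i ->
  `|(u * u * v - l * v) * w + ((U * u + u * U) * v + u * u * V - l * V) * W + k * w| <=
  eta * (`|v| * `|w|) + 2 * nu * nv * (`|U * i| * `|W|) + eta * (`|V| * `|W|) + eta * `|k|.
Proof.
move=> vn un e0 we uli i01 wi Wi.
have -> : (u * u * v - l * v) * w + ((U * u + u * U) * v + u * u * V - l * V) * W + k * w =
  (u * u - l) * i * (v * w) + 2 * (u * v) * ((U * i) * W)
  + (u * u - l) * i * (V * W) + k * w.
  by rewrite wi Wi; case: i01 => ->; ring.
have ui : `|(u * u - l) * i| <= eta.
  by case: i01 uli => -> H; rewrite ?mulr0 ?normr0 ?mulr1//; exact: H.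
have nv0 : 0 <= nv by exact: le_trans (normr_ge0 _) vn.
have nu0 : 0 <= nu by exact: le_trans (normr_ge0 _) un.
apply: le_trans (ler_normD _ _) _; apply: lerD; last first.
  by rewrite normrM mulrC ler_wpM2r.
apply: le_trans (ler_normD _ _) _; apply: lerD; last first.
  by rewrite normrM -[`|V| * _]normrM ler_wpM2r.
apply: le_trans (ler_normD _ _) _; apply: lerD.
  by rewrite normrM -[`|v| * _]normrM ler_wpM2r.
rewrite normrM -[`|U * i| * _]normrM ler_wpM2r// normrM (@ger0_norm _ 2)// -mulrA.
by rewrite ler_wpM2l// normrM ler_pM.
Qed.

Section bump_bound.
Context {R : realType}.
Local Notation mu := (@lebesgue_measure R).
Local Notation N := (nm (@hip R)).
Implicit Types (f g F G phi v w : R -> R) (a b c d e x y z : R).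
Variable u : R -> R.
Hypothesis hu : H1R u.
Local Notation U := (wderiv u).

(** The bump acts as a functional that almost annihilates the range of [M - l], with an error
    relative to the norm of [v]. The four summands stem from the values, from the derivative of
    [u^2], from the derivative of [v] and from [kappa]. *)
Lemma bump_bound l a b eta v w W : H1R v -> a <= b -> 0 <= eta ->
  (forall x, a <= x <= b -> `|u x * u x - l| <= eta) -> Num.sqrt (b - a) <= eta ->
  nm ip (fun x => U x * \1_`[a, b] x) <= eta ->
  h1 w W -> hip w w = 1 -> (forall x, ~~ (a <= x <= b) -> w x = 0 /\ W x = 0) ->
  (forall x, `|w x| <= Num.sqrt (b - a)) ->
  `|hip (opMR u v - l *: v) w| <=
  (N v + 2 * N u * N v + N v + weight u setT * N v) * eta.
Proof.
move=> hv ab e0 Hl Hr HU hw w1 wout wsup.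
have h_v := H1R_h1 hv; have [lv lV _] := h_v; have [lw lW _] := hw.
have [lu lU _] := H1R_h1 hu.
have h3 := h1M (h1_usqr hu) h_v.
have Hw := h1_H1R hw.
have H3 := h1_H1R h3.
have hlv : h1 (fun x => l * v x) (fun x => l * wderiv v x) by exact: h1Z.
have h4 := h1B h3 hlv.
have -> : hip (opMR u v - l *: v) w =
  hip ((fun x => u x * u x * v x) - (fun x => l * v x)) w + \int[mu]_x (kappa u v x * w x).
  have E : opMR u v - l *: v =
      ((fun x => u x * u x * v x) - (fun x => l * v x)) + opK hu v.
    by rewrite (opMRE hu hv) addrAC.
  by rewrite E (sip_Dl semi_ip_H1R (h1_H1R h4) (H1R_opK hu hv) Hw) (hip_opK hu hv Hw).
rewrite (hipE h4 hw) /ip.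
have [l3 l3' _] := h4.
have lk : L1 (kappa u v) by exact: L1_kappa.
rewrite -RintegralD//; [|exact: L2M|exact: L2M].
rewrite -RintegralD//; [|by apply: L1D; exact: L2M|exact: L1_kappaM].
have lp : L1 (fun x => ((fun x0 => u x0 * u x0 * v x0) - (fun x0 => l * v x0)) x * w x +
   ((fun x0 => (U x0 * u x0 + u x0 * U x0) * v x0 + u x0 * u x0 * wderiv v x0) -
    (fun x0 => l * wderiv v x0)) x * W x + kappa u v x * w x).
  by apply: L1D; [apply: L1D; exact: L2M|exact: L1_kappaM].
apply: le_trans (le_normr_Rintegral _ lp) _ => //.
pose UA x := U x * \1_`[a, b] x.
have lUA : L2 UA by exact: L2_indic.
have lv' := L2_norm lv; have lV' := L2_norm lV; have lw' := L2_norm lw.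
have lW' := L2_norm lW; have lUA' := L2_norm lUA.
have b1 : L1 (fun x => eta * (`|v x| * `|w x|)) by exact/L1Z/L2M.
have b2 : L1 (fun x => 2 * N u * N v * (`|UA x| * `|W x|)) by exact/L1Z/L2M.
have b3 : L1 (fun x => eta * (`|wderiv v x| * `|W x|)) by exact/L1Z/L2M.
have b4 : L1 (fun x => eta * `|kappa u v x|) by exact/L1Z/L1_norm.
apply: le_trans (le_Rintegral _ (L1_norm lp) (L1D (L1D (L1D b1 b2) b3) b4) _) _ => //.
  move=> x _; apply: bump_pointwise => //.
  - exact: H1R_nm_sup.
  - exact: H1R_nm_sup.
  - exact: le_trans (wsup x) Hr.
  - rewrite indicE => /eqP; case: (boolP (x \in `[a, b]%classic)) => [|_]; last by rewrite eq_sym oner_eq0.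
    by rewrite inE/= in_itv/= => xab _; exact: Hl.
  - by rewrite indicE; case: (x \in _); [right|left].
  - rewrite indicE; case: (boolP (x \in `[a, b]%classic)) => [|xab]; first by rewrite mulr1.
    by rewrite mulr0; have [] := wout x _ => //; apply: contra xab; rewrite inE/= in_itv.
  - rewrite indicE; case: (boolP (x \in `[a, b]%classic)) => [|xab]; first by rewrite mulr1.
    by rewrite mulr0; have [] := wout x _ => //; apply: contra xab; rewrite inE/= in_itv.
rewrite (RintegralD measurableT (L1D (L1D b1 b2) b3) b4).
rewrite (RintegralD measurableT (L1D b1 b2) b3) (RintegralD measurableT b1 b2).
rewrite (RintegralZl eta measurableT (L2M lv' lw')).
rewrite (RintegralZl (2 * N u * N v) measurableT (L2M lUA' lW')).
rewrite (RintegralZl eta measurableT (L2M lV' lW')).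
rewrite (RintegralZl eta measurableT (L1_norm lk)).
have E1 f : nm ip (fun x => `|f x|) = nm ip f.
  by congr Num.sqrt; apply: eq_Rintegral => x _; rewrite -normrM ger0_norm// -expr2 sqr_ge0.
have Nw1 : N w = 1 by rewrite /nm w1 sqrtr1.
have cs f g : L2 f -> L2 g -> nm ip g <= 1 ->
    \int[mu]_x (`|f x| * `|g x|) <= nm ip f.
  move=> lf lg g1.
  have := sip_cs semi_ip_L2 (L2_norm lf) (L2_norm lg); rewrite !E1.
  move=> /(le_trans (ler_norm _)) /le_trans; apply.
  by rewrite ler_piMr ?nm_ge0.
have nw1 : nm ip w <= 1 by rewrite -Nw1; exact: (nm_h1_le hw).1.
have nW1 : nm ip W <= 1 by rewrite -Nw1; exact: (nm_h1_le hw).2.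
have H1' : \int[mu]_x (`|v x| * `|w x|) <= N v.
  by apply: le_trans (cs _ _ lv lw nw1) (nm_h1_le h_v).1.
have H2' : \int[mu]_x (`|UA x| * `|W x|) <= eta by apply: le_trans (cs _ _ lUA lW nW1) HU.
have H3' : \int[mu]_x (`|wderiv v x| * `|W x|) <= N v.
  by apply: le_trans (cs _ _ lV lW nW1) (nm_h1_le h_v).2.
have H4' := int_kappa hu hv.
have aux (p q r e : R) : (p + q + p + r) * e = e * p + q * e + e * p + e * r by ring.
rewrite aux.
apply: lerD; last by rewrite ler_wpM2l.
apply: lerD; last by rewrite ler_wpM2l.
apply: lerD; first by rewrite ler_wpM2l.
by rewrite ler_wpM2l// !mulr_ge0 ?nm_ge0.
Qed.

End bump_bound.

(** * Complex functions through real and imaginary parts *)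

Section complexified.
Context {R : realType}.
Local Notation N := (nm (@hip R)).
Local Notation re f := (fun x => complex.Re (f x)).
Local Notation im f := (fun x => complex.Im (f x)).
Implicit Types (f g : R -> R[i]).

Lemma re_scale (c : R[i]) f :
  re (c *: f) = complex.Re c *: re f - complex.Im c *: im f.
Proof.
apply/funext => x; change (complex.Re (c * f x) =
  complex.Re c * complex.Re (f x) - complex.Im c * complex.Im (f x)).
by case: c (f x) => [a b] [p q].
Qed.

Lemma im_scale (c : R[i]) f :
  im (c *: f) = complex.Re c *: im f + complex.Im c *: re f.
Proof.
apply/funext => x; change (complex.Im (c * f x) =
  complex.Re c * complex.Im (f x) + complex.Im c * complex.Re (f x)).
by case: c (f x) => [a b] [p q].
Qed.

Lemma re_add f g : re (f + g) = re f + re g.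
Proof.
apply/funext => x; change (complex.Re (f x + g x) = complex.Re (f x) + complex.Re (g x)).
by case: (f x) (g x) => [a b] [p q].
Qed.

Lemma im_add f g : im (f + g) = im f + im g.
Proof.
apply/funext => x; change (complex.Im (f x + g x) = complex.Im (f x) + complex.Im (g x)).
by case: (f x) (g x) => [a b] [p q].
Qed.

Lemma re_opp f : re (- f) = - re f.
Proof.
apply/funext => x; change (complex.Re (- f x) = - complex.Re (f x)).
by case: (f x) => [a b].
Qed.

Lemma im_opp f : im (- f) = - im f.
Proof.
apply/funext => x; change (complex.Im (- f x) = - complex.Im (f x)).
by case: (f x) => [a b].
Qed.

Lemma H1D f g : H1 f -> H1 g -> H1 (f + g).
Proof.
move=> [f1 f2] [g1 g2]; split; first by rewrite re_add; exact: (sip_D semi_ip_H1R).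
by rewrite im_add; exact: (sip_D semi_ip_H1R).
Qed.

Lemma H1Z (c : R[i]) f : H1 f -> H1 (c *: f).
Proof.
move=> [f1 f2]; split.
  by rewrite re_scale; apply: (sip_B semi_ip_H1R); exact: (sip_Z semi_ip_H1R).
by rewrite im_scale; apply: (sip_D semi_ip_H1R); exact: (sip_Z semi_ip_H1R).
Qed.

Lemma H1_0 : H1 (0 : R -> R[i]).
Proof. by split; exact: H1R0. Qed.

Lemma H1N f : H1 f -> H1 (- f).
Proof. by rewrite -scaleN1r; exact: H1Z. Qed.

Lemma H1B f g : H1 f -> H1 g -> H1 (f - g).
Proof. by move=> hf hg; apply: H1D => //; exact: H1N. Qed.

Lemma H1_sum n (F : 'I_n -> R -> R[i]) : (forall i, H1 (F i)) -> H1 (\sum_(i < n) F i).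
Proof.
elim: n F => [|n IH] F HF; first by rewrite big_ord0; exact: H1_0.
by rewrite big_ord_recr /=; apply: H1D => //; exact: IH.
Qed.

(** Complex linear in [f], because [w] is real. *)
Definition cpair (w : R -> R) f : R[i] := Complex (hip (re f) w) (hip (im f) w).

Lemma cpairD w f g : H1R w -> H1 f -> H1 g -> cpair w (f + g) = cpair w f + cpair w g.
Proof.
move=> hw [f1 f2] [g1 g2]; rewrite /cpair re_add im_add.
by rewrite !(sip_Dl semi_ip_H1R).
Qed.

Lemma cpairZ w c f : H1R w -> H1 f -> cpair w (c *: f) = c * cpair w f.
Proof.
move=> hw [f1 f2]; rewrite /cpair re_scale im_scale.
have h1 k : H1R (k *: re f) by exact: (sip_Z semi_ip_H1R).
have h2 k : H1R (k *: im f) by exact: (sip_Z semi_ip_H1R).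
rewrite (sip_Bl semi_ip_H1R)// (sip_Dl semi_ip_H1R)// !(sip_Zl semi_ip_H1R)//.
by case: c.
Qed.

Lemma cpair_sum n w (c : 'I_n -> R[i]) (F : 'I_n -> R -> R[i]) : H1R w ->
  (forall i, H1 (F i)) ->
  cpair w (\sum_(i < n) c i *: F i) = \sum_(i < n) c i * cpair w (F i).
Proof.
move=> hw; elim: n c F => [|n IH] c F HF.
  rewrite !big_ord0 /cpair.
  have -> : hip (re (0 : R -> R[i])) w = 0.
    by have := sip_Zl semi_ip_H1R 0 H1R0 hw; rewrite mul0r => <-; congr hip;
      apply/funext => x; rewrite scaler0.
  by [].
rewrite !big_ord_recr /= cpairD//; last 2 first.
- by apply: H1_sum => i; apply: H1Z.
- by apply: H1Z.
by rewrite cpairZ// IH.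
Qed.

End complexified.

(** * Orthonormal series and infinite codimension *)

Section nonfredholm.
Context {R : realType}.
Local Notation mu := (@lebesgue_measure R).
Local Notation N := (nm (@hip R)).
Local Notation re f := (fun x => complex.Re (f x)).
Local Notation im f := (fun x => complex.Im (f x)).

Lemma hip_disjoint (f g F G : R -> R) : h1 f F -> h1 g G ->
  (forall x, (f x = 0 /\ F x = 0) \/ (g x = 0 /\ G x = 0)) -> hip f g = 0.
Proof.
move=> hf hg H; rewrite (hipE hf hg) /ip.
have -> : (fun x => f x * g x) = cst 0.
  by apply/funext => x; case: (H x) => -[-> _]; rewrite ?mul0r ?mulr0.
have -> : (fun x => F x * G x) = cst 0.
  by apply/funext => x; case: (H x) => -[_ ->]; rewrite ?mul0r ?mulr0.
by rewrite Rintegral_cst// !mul0r addr0.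
Qed.

(** The sum of [4^-m w m] over the indices in [p]. The coefficients are those for which
    [geom_complete] applies, and the pairing with [w m] does not change once the partial sum
    includes that term. *)
Lemma orthonormal_sum (w : nat -> R -> R) (p : pred nat) :
  (forall n, H1R (w n)) -> (forall n, hip (w n) (w n) = 1) ->
  (forall n m, n <> m -> hip (w n) (w m) = 0) ->
  exists2 y, H1R y & forall m, hip y (w m) = if p m then 1 / 4 ^+ m else 0.
Proof.
move=> Hw w1 w0.
pose a m : R := if p m then 1 / 4 ^+ m else 0.
pose x n := \sum_(i < n) a i *: w i.
have Hx n : H1R (x n).
  rewrite /x; elim: n => [|n IH]; first by rewrite big_ord0; exact: H1R0.
  by rewrite big_ord_recr; apply: (sip_D semi_ip_H1R) => //; exact: (sip_Z semi_ip_H1R).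
have xx n : x n.+1 - x n = a n *: w n by apply/eqP; rewrite subr_eq addrC /x big_ord_recr.
have xc n : N (x n.+1 - x n) <= 1 / 4 ^+ n.
  rewrite xx (nmZ semi_ip_H1R)// /nm w1 sqrtr1 mulr1 /a.
  have p0 : 0 <= 1 / 4 ^+ n :> R by rewrite divr_ge0// exprn_ge0.
  by case: (p n); rewrite ?normr0// ger0_norm.
have [y hy yx] := H1R_complete Hx xc.
exists y => // m; rewrite -/(a m).
have xS k : hip (x k.+1) (w m) = a k * hip (w k) (w m) + hip (x k) (w m).
  rewrite -[x k.+1](subrK (x k)) xx (sip_Dl semi_ip_H1R)//.
    by rewrite (sip_Zl semi_ip_H1R).
  exact: (sip_Z semi_ip_H1R).
have x0 k : (k <= m)%N -> hip (x k) (w m) = 0.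
  elim: k => [|k IH] km.
    rewrite /x big_ord0; have := sip_Zl semi_ip_H1R 0 (Hw m) (Hw m).
    by rewrite scale0r mul0r.
  rewrite xS w0 ?mulr0 ?add0r ?IH ?(ltnW km)// => E.
  by rewrite E ltnn in km.
have xm n : hip (x (n + m).+1) (w m) = a m.
  elim: n => [|n IH]; first by rewrite add0n xS x0// w1 mulr1 addr0.
  rewrite addSn xS IH w0 ?mulr0 ?add0r// => E.
  by have := leq_addl n m; rewrite -ltnS E ltnn.
apply/eqP; rewrite -subr_eq0 -normr_le0; apply: (@le0_of_geometric _ _ 4) => n.
rewrite -{1}(xm n) -(sip_Bl semi_ip_H1R)//.
apply: le_trans (sip_cs semi_ip_H1R (sip_B semi_ip_H1R hy (Hx _)) (Hw m)) _.
rewrite [X in _ * X]/nm w1 sqrtr1 mulr1; apply: le_trans (yx _) _.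
rewrite mulr1 ler_wpM2l// lef_pV2 ?posrE ?exprn_gt0// ler_weXn2l ?ler1n//.
by rewrite -addnS leq_addr.
Qed.

End nonfredholm.

Section singular.
Context {R : realType}.
Local Notation mu := (@lebesgue_measure R).
Local Notation N := (nm (@hip R)).
Local Notation re f := (fun x => complex.Re (f x)).
Local Notation im f := (fun x => complex.Im (f x)).

(* [u^2] is close to [l] on [a, b], and H^1 functions supported there see
   almost nothing of the remaining part of the operator. *)
Definition singular_at (u : R -> R) (l eta a b : R) :=
  [/\ a < b, forall x, a <= x <= b -> `|u x * u x - l| <= eta,
      Num.sqrt (b - a) <= eta & nm ip (fun x => wderiv u x * \1_`[a, b] x) <= eta].

Lemma le_normc_ReIm (z : R[i]) : Normc.normc z <= `|complex.Re z| + `|complex.Im z|.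
Proof.
case: z => a b /=; rewrite -(@ler_pXn2r _ 2)// ?nnegrE ?sqrtr_ge0 ?addr_ge0//.
rewrite sqr_sqrtr ?addr_ge0 ?sqr_ge0// sqrrD !real_normK ?num_real//.
by rewrite lerD2r lerDl mulrn_wge0// mulr_ge0.
Qed.

Lemma normc_sum n (F : 'I_n -> R[i]) :
  Normc.normc (\sum_(i < n) F i) <= \sum_(i < n) Normc.normc (F i).
Proof.
elim: n F => [|n IH] F; first by rewrite !big_ord0 Normc.normc0.
by rewrite !big_ord_recr /=; apply: le_trans (le_normcD _ _) _; rewrite lerD2r.
Qed.

(** If [k] vectors complemented the range, then of [k + 1] series of bumps some nontrivial
    combination would lie in it. Such an element pairs with [w m] to at most a constant times
    [16^-m], whereas the coefficient of one of the series shows up as a multiple of [4^-m] for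
    infinitely many [m]. *)
Lemma not_finite_codim_of_singular (u : R -> R) (l : R) (a b : nat -> R) :
  H1R u -> (forall n, singular_at u l (1 / 16 ^+ n) (a n) (b n)) ->
  (forall n, b n < a n.+1) ->
  ~ finite_codim H1 ((fun v => opM u v - (real_complex R l) *: v) @` H1).
Proof.
move=> hu Hs ba [k [e [He fin]]].
have ab n : a n < b n by case: (Hs n).
have /choice [wW HwW] : forall n, exists wW : (R -> R) * (R -> R),
    [/\ h1 wW.1 wW.2, hip wW.1 wW.1 = 1,
    (forall x, ~~ (a n <= x <= b n) -> wW.1 x = 0 /\ wW.2 x = 0) &
    (forall x, `|wW.1 x| <= Num.sqrt (b n - a n))].
  by move=> n; have [w [W H]] := bump_ex (ab n); exists (w, W).
pose w n := (wW n).1; pose W n := (wW n).2.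
have hw n : h1 (w n) (W n) by case: (HwW n).
have Hw n : H1R (w n) by exact: h1_H1R (hw n).
have w1 n : hip (w n) (w n) = 1 by case: (HwW n).
have lt_ab n m : (n < m)%N -> b n < a m.
  elim: m => // m IH; rewrite ltnS leq_eqVlt => /predU1P[->//|/IH H].
  by rewrite (lt_trans H)// (lt_trans (ab m)).
have w0' n m : (n < m)%N -> hip (w n) (w m) = 0.
  move=> nm; apply: (hip_disjoint (hw n) (hw m)) => x.
  have [xb|bx] := leP x (b n).
    right; case: (HwW m) => _ _ H _; apply: H.
    by rewrite negb_and -ltNge (le_lt_trans xb)// lt_ab.
  left; case: (HwW n) => _ _ H _; apply: H.
  by rewrite negb_and -!ltNge bx orbT.
have w0 n m : n <> m -> hip (w n) (w m) = 0.
  move=> /eqP; rewrite neq_ltn => /orP[|] nm; first exact: w0'.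
  by rewrite hipC w0'.
(* The indices are distributed by residues modulo [k + 1], so each [w m] detects exactly one of the
   series and each series is detected infinitely often. *)
have /choice [y Hy] : forall j : 'I_k.+1, exists y, H1R y /\
    forall m, hip y (w m) = if (m %% k.+1 == j)%N then 1 / 4 ^+ m else 0.
  move=> j; have [y y1 y2] := orthonormal_sum (fun m => m %% k.+1 == j)%N Hw w1 w0.
  by exists y.
pose Y j : R -> R[i] := fun x => Complex (y j x) 0.
have HY j : H1 (Y j) by split; [exact: (Hy j).1|exact: H1R0].
have /choice [c Hc] := fun j => fin _ (HY j).
have /choice [v Hv] : forall j, exists v, H1 v /\
    opM u v - (real_complex R l) *: v = Y j - \sum_(i < k) c j i *: e i.
  by move=> j; have [v hv E] := Hc j; exists v.
pose A : 'M[R[i]]_(k.+1, k) := \matrix_(j, i) c j i.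
(* [A] has [k + 1] rows and only [k] columns, hence a nonzero row vector annihilates it. *)
have [d d0 dA] : exists2 d : 'rV[R[i]]_k.+1, d != 0 & d *m A = 0.
  have : kermx A != 0.
    by rewrite kermx_eq0 /row_free; apply/negP => /eqP E; have := rank_leq_col A; rewrite E ltnn.
  move=> /rowV0Pn [d dk d0]; exists d; first exact: d0.
  by apply/sub_kermxP.
have [j0 dj0] : exists j0, d ord0 j0 != 0.
  apply/existsP; rewrite -negb_forall; apply: contra d0 => /forallP H.
  by apply/eqP/rowP => j; rewrite mxE; apply/eqP; exact: H.
pose L m f := cpair (w m) f.
have LY m j : L m (Y j) = real_complex R (if (m %% k.+1 == j)%N then 1 / 4 ^+ m else 0).
  rewrite /L /cpair (Hy j).2; congr Complex.
  have := sip_Zl semi_ip_H1R 0 H1R0 (Hw m); rewrite mul0r => <-; congr hip.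
  by apply/funext => x; rewrite scaler0.
(* In this combination the contributions of the [e i] cancel. *)
have sumL m : \sum_(j < k.+1) d ord0 j * L m (opM u (v j) - (real_complex R l) *: v j) =
    \sum_(j < k.+1) d ord0 j * L m (Y j).
  have E j : L m (opM u (v j) - (real_complex R l) *: v j) =
      L m (Y j) - \sum_(i < k) c j i * L m (e i).
    rewrite (Hv j).2 /L cpairD//; last by apply/H1N/H1_sum => i; exact: H1Z.
    rewrite -scaleN1r cpairZ//; last by apply: H1_sum => i; exact: H1Z.
    by rewrite cpair_sum// mulN1r.
  transitivity (\sum_(j < k.+1) (d ord0 j * L m (Y j) -
      d ord0 j * \sum_(i < k) c j i * L m (e i))).
    by apply: eq_bigr => j _; rewrite -mulrBr; congr (_ * _); exact: E.
  rewrite sumrB [X in _ - X](_ : _ = 0) ?subr0//.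
  under eq_bigr do rewrite mulr_sumr.
  rewrite exchange_big /=; apply: big1 => i _.
  under eq_bigr do rewrite mulrA.
  rewrite -mulr_suml.
  have -> : \sum_(j < k.+1) d ord0 j * c j i = (d *m A) ord0 i.
    by rewrite mxE; apply: eq_bigr => j _; rewrite mxE.
  by rewrite dA mxE mul0r.
have LT j : exists D, 0 <= D /\ forall m,
    Normc.normc (L m (opM u (v j) - (real_complex R l) *: v j)) <= D / 16 ^+ m.
  have [hr hi] := (Hv j).1.
  pose Cst f := N f + 2 * N u * N f + N f + weight u setT * N f.
  have C0 f : 0 <= Cst f.
    by rewrite /Cst !addr_ge0 ?mulr_ge0 ?nm_ge0 ?weight_ge0.
  exists (Cst (re (v j)) + Cst (im (v j))); split; first by rewrite addr_ge0.
  move=> m; apply: le_trans (le_normc_ReIm _) _; rewrite mulrDl /L /cpair.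
  have [s1 s2 s3 s4] := Hs m.
  have [_ _ o1 o2] := HwW m.
  have e0 : 0 <= 1 / 16 ^+ m :> R by rewrite divr_ge0// exprn_ge0.
  have B f (hf : H1R f) := bump_bound hu hf (ltW s1) e0 s2 s3 s4 (hw m) (w1 m) o1 o2.
  have -> : re (opM u (v j) - (real_complex R l) *: v j) =
      opMR u (re (v j)) - l *: re (v j).
    rewrite re_add re_opp re_scale /= scale0r subr0.
    by [].
  have -> : im (opM u (v j) - (real_complex R l) *: v j) =
      opMR u (im (v j)) - l *: im (v j).
    rewrite im_add im_opp im_scale /= scale0r addr0.
    by [].
  by apply: lerD; [move: (B _ hr)|move: (B _ hi)]; rewrite div1r; apply.
have /choice [D HD] := LT.
pose DD := \sum_(j < k.+1) Normc.normc (d ord0 j) * D j.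
have DD0 : 0 <= DD.
  apply: sumr_ge0 => j _; rewrite mulr_ge0//; last by case: (HD j).
  by case: (d ord0 j) => p q /=; exact: sqrtr_ge0.
have key m : (m %% k.+1)%N = j0 -> Normc.normc (d ord0 j0) <= DD / 4 ^+ m.
  move=> mj0.
  have : Normc.normc (d ord0 j0 * L m (Y j0)) <= DD / 16 ^+ m.
    have -> : d ord0 j0 * L m (Y j0) = \sum_(j < k.+1) d ord0 j * L m (Y j).
      rewrite (bigD1 j0)//= big1 ?addr0// => j jj0.
      rewrite LY ifF ?mulr0//; apply/negbTE; rewrite mj0.
      by apply: contra jj0 => /eqP E; apply/eqP/val_inj.
    rewrite -sumL; apply: le_trans (normc_sum _) _.
    rewrite mulr_suml; apply: ler_sum => j _.
    rewrite Normc.normcM -mulrA ler_wpM2l//; last by have [_] := HD j; apply.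
    by case: (d ord0 j) => p q /=; exact: sqrtr_ge0.
  rewrite LY mj0 eqxx Normc.normcM.
  have -> : Normc.normc (real_complex R (1 / 4 ^+ m)) = 1 / 4 ^+ m :> R.
    by rewrite /= expr0n addr0 sqrtr_sqr ger0_norm// divr_ge0// exprn_ge0.
  rewrite mulrA mulr1 ler_pdivrMr ?exprn_gt0// => /le_trans; apply.
  rewrite -mulrA ler_wpM2l//.
  have -> : 16 = 4 * 4 :> R by ring.
  by rewrite exprMn invfM mulfVK// expf_neq0.
have : Normc.normc (d ord0 j0) <= 0.
  apply: (@le0_of_geometric _ _ DD) => n.
  (* An index in the residue class of [j0] that is at least [n]. *)
  apply: le_trans (key (n * k.+1 + j0)%N _) _.
    by rewrite modnMDl modn_small.
  rewrite ler_wpM2l// lef_pV2 ?posrE ?exprn_gt0// ler_weXn2l ?ler1n//.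
  by rewrite (leq_trans _ (leq_addr _ _))// leq_pmulr.
move=> H; have /eqP : Normc.normc (d ord0 j0) = 0.
  apply/eqP; rewrite eq_le H /=.
  by case: (d ord0 j0) => p q /=; exact: sqrtr_ge0.
by move=> /eqP/Normc.eq0_normc /eqP; apply/negP.
Qed.

End singular.

(** * Construction of the intervals *)

Section SingularIntervals.
Context {R : realType}.
Local Notation mu := (@lebesgue_measure R).
Implicit Types (u : R -> R) (a b x y z t l eta : R).

Lemma singular_at_near u z l eta : H1R u -> 0 < eta -> `|u z * u z - l| < eta ->
  exists2 d : R, 0 < d & forall a b, z - d < a -> a < b -> b <= z -> singular_at u l eta a b.
Proof.
move=> hu eta0 uz; have [_ lw _] := H1R_h1 hu; have [cu _ _] := hu.
have lw2 := L2_sqr lw.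
have [d1 d10 H1] := @int_eps _ _ z (eta ^+ 2) (L1_loc lw2) (exprn_gt0 2 eta0).
have cuu : {for z, continuous (fun x => u x * u x)} by apply: cvgM; exact: cu.
have e0 : 0 < eta - `|u z * u z - l| by rewrite subr_gt0.
have /cvgrPdist_le/(_ _ e0)[d2 /= d20 H2] := cuu.
(* The three bounds serve, in order, the length of the interval, the L^2 mass of [wderiv u] on it
   and the oscillation of [u^2]. *)
exists (Num.min (eta ^+ 2) (Num.min d1 d2)).
  by rewrite !lt_min exprn_gt0// d10 d20.
move=> a b; rewrite ltrBlDl -ltrBlDr !lt_min => /and3P[ae a1 a2] ab bz.
have az : a < z by rewrite (lt_le_trans ab).
have sqrt_le (w : R) : w <= eta ^+ 2 -> Num.sqrt w <= eta.
  by move=> h; rewrite (le_trans (ler_wsqrtr h))// sqrtr_sqr ger0_norm// ltW.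
split=> //.
- move=> x /andP[ax xb].
  have -> : u x * u x - l = (u z * u z - l) - (u z * u z - u x * u x) by ring.
  apply: le_trans (ler_normB _ _) _; rewrite -lerBrDl; apply: H2.
  rewrite /ball_/= ger0_norm; last by rewrite subr_ge0 (le_trans xb).
  by apply: le_lt_trans a2; lra.
- by apply: sqrt_le; move: ae bz; clear; lra.
- apply: sqrt_le; rewrite /ip.
  have -> : \int[mu]_x (wderiv u x * \1_`[a, b] x * (wderiv u x * \1_`[a, b] x)) =
      \int[mu]_(x in `[a, b]) `|wderiv u x ^+ 2|.
    rewrite (@int_indic _ `[a, b]%classic)//; apply: eq_Rintegral => x _; rewrite (ger0_norm (sqr_ge0 _)).
    by rewrite indicE; case: (x \in _); rewrite /=; ring.
  apply: le_trans (_ : \int[mu]_(x in `[a, z]) `|wderiv u x ^+ 2| <= _).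
    rewrite (@int_split _ _ a b z (L1_loc (L1_norm lw2)) (ltW ab) bz).
    by rewrite lerDl Rintegral_ge0.
  by apply/ltW/H1; rewrite ?lexx ?(ltW az)//; lra.
Qed.

(** The intervals are laid out from left to right, and [P t] says that there is still room to the
    right of [t]. This covers intervals accumulating at a point as well as intervals escaping to
    infinity. *)
Lemma not_finite_codim_of_approx u l (P : R -> Prop) t0 : H1R u -> P t0 ->
  (forall t eta, P t -> 0 < eta -> exists z,
     [/\ t < z, forall b, b < z -> P b & `|u z * u z - l| < eta]) ->
  ~ finite_codim H1 ((fun v => opM u v - (real_complex R l) *: v) @` H1).
Proof.
move=> hu P0 H.
have H' (p : nat * R) : exists q : R * R, P p.2 ->
    [/\ p.2 < q.1, P q.2 & singular_at u l (1 / 16 ^+ p.1) q.1 q.2].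
  case: p => n t /=; have [Pt|nPt] := pselect (P t); last by exists (0, 0).
  have e0 : 0 < 1 / 16 ^+ n :> R by rewrite divr_gt0// exprn_gt0.
  have [z [tz Pz uz]] := H t _ Pt e0.
  have [d d0 Hd] := singular_at_near hu e0 uz.
  pose m := Num.max t (z - d).
  have mz : m < z by rewrite gt_max tz ltrBlDr ltrDl.
  have [tm dm] : t <= m /\ z - d <= m by rewrite !le_max !lexx orbT.
  (* Both ends lie strictly between [m] and [z]: the left end exceeds [t], and a right end below [z]
     preserves [P]. *)
  exists ((2 * m + z) / 3, (m + 2 * z) / 3) => _ /=; split; first by lra.
    by apply: Pz; lra.
  by apply: Hd; lra.
have [f Hf] := choice H'.
pose st := fix st n := if n is n'.+1 then f (n, (st n').2) else f (0%N, t0).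
have stP n : P (st n).2 /\ singular_at u l (1 / 16 ^+ n) (st n).1 (st n).2.
  elim: n => [|n [IH _]]; first by have [] := Hf (0%N, t0) P0.
  by have [] := Hf (n.+1, (st n).2) IH.
apply: (@not_finite_codim_of_singular _ u l (fun n => (st n).1) (fun n => (st n).2)) => //.
  by move=> n; have [] := stP n.
by move=> n; have [] := Hf (n.+1, (st n).2) (stP n).1.
Qed.

(** The point [x] itself serves as [z] at every stage; the intervals accumulate at it from the
    left. *)
Lemma not_finite_codim_range u x : H1R u ->
  ~ finite_codim H1 ((fun v => opM u v - (real_complex R (u x ^+ 2)) *: v) @` H1).
Proof.
move=> hu; apply: (@not_finite_codim_of_approx _ _ (fun t => t < x) (x - 1)) => //.
  by rewrite ltrBlDr ltrDl.
by move=> t eta tx eta0; exists x; split=> //; rewrite expr2 subrr normr0.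
Qed.

(** By integrability [u^2] is small at some point beyond any given one; here the intervals run off
    to infinity. *)
Lemma not_finite_codim_0 u : H1R u ->
  ~ finite_codim H1 ((fun v => opM u v - (real_complex R 0) *: v) @` H1).
Proof.
move=> hu; apply: (@not_finite_codim_of_approx _ _ (fun=> True) 0) => // t eta _ eta0.
have [_ lu _] := hu.
have [z tz uz] := L1_small_right (t + 1) (L2_sqr lu) (fun x => sqr_ge0 (u x)) eta0.
exists z; split=> //; first by rewrite (lt_le_trans _ tz)// ltrDl.
by rewrite subr0 -expr2 ger0_norm ?sqr_ge0.
Qed.

End SingularIntervals.

(** * Fredholmness elsewhere *)

Section finite_rank.
Context {R : realType} {V : lmodType R[i]}.
Variables (H : set V) (Nv : V -> R) (T B Bi : V -> V) (n : nat).
Variables (l : 'I_n -> V -> R[i]) (g : 'I_n -> V) (C : R).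
Hypotheses (Nv0 : forall v, 0 <= Nv v) (H_0 : H 0) (H_D : forall u v, H u -> H v -> H (u + v))
  (H_Z : forall c u, H u -> H (c *: u))
  (TE : forall v, H v -> T v = B v + \sum_(i < n) l i v *: g i)
  (Hg : forall i, H (g i)) (HBm : forall v, H v -> H (B v)) (HBi : forall y, H y -> H (Bi y))
  (BBi : forall y, H y -> B (Bi y) = y) (BiB : forall v, H v -> Bi (B v) = v)
  (BD : forall u v, H u -> H v -> B (u + v) = B u + B v)
  (BZ : forall c u, H u -> B (c *: u) = c *: B u)
  (lD : forall i u v, H u -> H v -> l i (u + v) = l i u + l i v)
  (lZ : forall i c u, H u -> l i (c *: u) = c * l i u)
  (lBi : forall i y, H y -> Normc.normc (l i (Bi y)) <= C * Nv y).

Let H_N u : H u -> H (- u).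
Proof. by rewrite -scaleN1r; exact: H_Z. Qed.

Let H_B u v : H u -> H v -> H (u - v).
Proof. by move=> hu hv; apply: H_D => //; exact: H_N. Qed.

Let H_sum (c : 'I_n -> R[i]) (f : 'I_n -> V) : (forall i, H (f i)) ->
  H (\sum_(i < n) c i *: f i).
Proof.
move=> Hf; apply: (big_ind (fun v => H v)) => //.
by move=> i _; exact: H_Z.
Qed.

Let B0 : B 0 = 0. Proof. by have := BZ 0 H_0; rewrite !scale0r. Qed.

Let Bi0 : Bi 0 = 0. Proof. by rewrite -{1}B0 BiB. Qed.

Let l0 i : l i 0 = 0. Proof. by have := lZ i 0 H_0; rewrite scale0r mul0r. Qed.

Let l_B i u v : H u -> H v -> l i (u - v) = l i u - l i v.
Proof.
by move=> hu hv; rewrite lD//; [rewrite -[- v]scaleN1r lZ// mulN1r|exact: H_N].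
Qed.

Let B_sum (c : 'I_n -> R[i]) (f : 'I_n -> V) : (forall i, H (f i)) ->
  B (\sum_(i < n) c i *: f i) = \sum_(i < n) c i *: B (f i).
Proof.
move=> Hf.
suff [] : B (\sum_(i < n) c i *: f i) = \sum_(i < n) c i *: B (f i) /\
  H (\sum_(i < n) c i *: f i) by [].
apply: (big_ind2 (fun a b => B a = b /\ H a)) => //.
  by move=> x1 x2 y1 y2 [<- h1] [<- h2]; split; [exact: BD|exact: H_D].
by move=> i _; split; [exact: BZ|exact: H_Z].
Qed.

Let l_sum j (c : 'I_n -> R[i]) (f : 'I_n -> V) : (forall i, H (f i)) ->
  l j (\sum_(i < n) c i *: f i) = \sum_(i < n) c i * l j (f i).
Proof.
move=> Hf.
suff [] : l j (\sum_(i < n) c i *: f i) = \sum_(i < n) c i * l j (f i) /\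
  H (\sum_(i < n) c i *: f i) by [].
apply: (big_ind2 (fun a b => l j a = b /\ H a)) => //.
  by move=> x1 x2 y1 y2 [<- h1] [<- h2]; split; [exact: lD|exact: H_D].
by move=> i _; split; [exact: lZ|exact: H_Z].
Qed.

Let Bi_B u v : H u -> H v -> Bi (u - v) = Bi u - Bi v.
Proof.
move=> hu hv; have h1 := HBi hu; have h2 := HBi hv.
have -> : u - v = B (Bi u - Bi v).
  rewrite BD//; last exact: H_N.
  by rewrite -[- Bi v]scaleN1r BZ// scaleN1r !BBi.
by rewrite BiB//; exact: H_B.
Qed.

Let b i := Bi (g i).
Let Hb i : H (b i). Proof. exact: HBi. Qed.

(** Applying [Bi] and then the functionals [l j] to [T v = y] gives [c *m K = ly y] for the row [c]
    of the values [l i v]. Conversely, a solution [c] yields the preimage [Bi y] minus the sum of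
    the [c i *: b i]. *)
Let K : 'M[R[i]]_n := 1%:M + \matrix_(i, j) l j (b i).

Let lb (c : 'rV[R[i]]_n) j :
  l j (\sum_(i < n) c ord0 i *: b i) = (c *m K) ord0 j - c ord0 j.
Proof.
have -> : (c *m K) ord0 j = c ord0 j + (c *m \matrix_(i, j) l j (b i)) ord0 j.
  by rewrite /K mulmxDr mulmx1 mxE.
rewrite l_sum// addrC addKr mxE.
by apply: eq_bigr => i _; rewrite mxE.
Qed.

Let Bb (c : 'I_n -> R[i]) : B (\sum_(i < n) c i *: b i) = \sum_(i < n) c i *: g i.
Proof. by rewrite B_sum//; apply: eq_bigr => i _; rewrite /b BBi. Qed.

Let ly y : 'rV[R[i]]_n := \row_i l i (Bi y).

Let range_mul v : H v -> ly (T v) *m cokermx K = 0.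
Proof.
move=> hv; pose c := \row_i l i v.
have Hs : H (\sum_(i < n) c ord0 i *: b i) by exact: H_sum.
have -> : ly (T v) = c *m K.
  apply/rowP => j; rewrite mxE.
  have -> : T v = B (v + \sum_(i < n) c ord0 i *: b i).
    by rewrite TE// BD// Bb; congr (_ + _); apply: eq_bigr => i _; rewrite mxE.
  rewrite BiB; last exact: H_D.
  by rewrite lD// lb !mxE addrC subrK.
by rewrite -mulmxA mulmx_coker mulmx0.
Qed.

(** With [range_mul], membership in the range becomes finitely many linear equations in [ly y]: the
    cokernel matrix tests whether a row lies in the row space of [K]. *)
Let range_of_mul y : H y -> ly y *m cokermx K = 0 -> (T @` H) y.
Proof.
move=> hy /eqP; rewrite -submxE => /submxP[c lyc].
have Hs : H (\sum_(i < n) c ord0 i *: b i) by exact: H_sum.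
have hy' := HBi hy.
have HN : H (- \sum_(i < n) c ord0 i *: b i) by exact: H_N.
exists (Bi y - \sum_(i < n) c ord0 i *: b i); first exact: H_B.
rewrite TE; last exact: H_B.
have lc i : l i (Bi y - \sum_(i < n) c ord0 i *: b i) = c ord0 i.
  rewrite lD// -scaleN1r lZ// lb -lyc mxE; ring.
rewrite BD// BBi// -scaleN1r BZ// Bb scaleN1r -addrA -[RHS]addr0; congr (_ + _).
by apply/eqP; rewrite scaleN1r addrC subr_eq0; apply/eqP/eq_bigr => i _; rewrite lc.
Qed.

(* Composed with the inverse of [B], [T] is the identity plus an operator of
   rank at most [n], so the question reduces to the [n x n] matrix [K]. *)
Lemma fredholm_of_finite_rank : fredholm H Nv T.
Proof.
split.
(* An element of the kernel is minus the combination of the [b j] with its own values [l j v] as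
   coefficients, and these form a row in the kernel of [K]. *)
- exists n, (fun i => - \sum_(j < n) kermx K i j *: b j).
  split=> [i|v [hv Tv]].
    have Hs : H (\sum_(j < n) kermx K i j *: b j) by exact: H_sum.
    have HN : H (- \sum_(j < n) kermx K i j *: b j) by exact: H_N.
    split=> //; rewrite TE// -scaleN1r BZ// Bb scaleN1r.
    apply/eqP; rewrite ?scaleN1r addrC subr_eq0; apply/eqP; apply: eq_bigr => j _.
    congr (_ *: _); rewrite ?scaleN1r -?[- (\sum_(_ < _) _)]scaleN1r lZ//.
    have -> : \sum_(j < n) kermx K i j *: b j = \sum_(j < n) row i (kermx K) ord0 j *: b j.
      by apply: eq_bigr => k _; rewrite [in RHS]mxE.
    rewrite lb -row_mul mulmx_ker [row i 0]linear0 [(0 : 'rV_n) _ _]mxE [row _ _ _ _]mxE.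
    ring.
  pose c := \row_i l i v.
  have vE : v = - \sum_(j < n) c ord0 j *: b j.
    have Hs : H (\sum_(j < n) c ord0 j *: b j) by exact: H_sum.
    have : B (v + \sum_(j < n) c ord0 j *: b j) = 0.
      by rewrite BD// Bb -[RHS]Tv TE//; congr (_ + _); apply: eq_bigr => i _; rewrite mxE.
    move=> /(congr1 Bi); rewrite BiB; last exact: H_D.
    by rewrite Bi0 => /eqP; rewrite addr_eq0 => /eqP.
  have cK : c *m K = 0.
    apply/rowP => j; rewrite [RHS]mxE; apply/eqP.
    have := lb c j.
    have -> : \sum_(i < n) c ord0 i *: b i = - v by rewrite vE opprK.
    rewrite -scaleN1r lZ// => E.
    by rewrite -[_ ord0 j](subrK (c ord0 j)) -E mxE; apply/eqP; ring.
  have /submxP[d cd] : (c <= kermx K)%MS by apply/sub_kermxP.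
  exists (d ord0); rewrite /= {1}vE cd.
  apply/eqP; rewrite subr_eq0; apply/eqP.
  under [RHS]eq_bigr do rewrite scalerN scaler_sumr.
  rewrite sumrN exchange_big /=; congr (- _); apply: eq_bigr => j _.
  by rewrite mxE scaler_suml; apply: eq_bigr => i _; rewrite scalerA.
(* The range is closed because the equations describing it involve only the bounded functionals
   [l i] composed with [Bi]. *)
- move=> f hf Hf; apply: range_of_mul => //; apply/rowP => j; rewrite [RHS]mxE.
  apply: Normc.eq0_normc; apply/eqP; rewrite eq_le; apply/andP; split; last first.
    by case: (_ ord0 j) => p q /=; exact: sqrtr_ge0.
  pose D := \sum_(i < n) Normc.normc (cokermx K i j).
  have D0 : 0 <= D.
    by apply: sumr_ge0 => i _; case: (cokermx K i j) => p q /=; exact: sqrtr_ge0.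
  apply: (@le_of_eps _ _ _ (`|C| * D)) => e e0; rewrite add0r.
  have [_ [v hv <-] fe] := Hf e e0.
  have hTv : H (T v).
    by rewrite TE//; apply: H_D; [exact: HBm|exact: H_sum].
  have -> : ly f *m cokermx K = ly (f - T v) *m cokermx K.
    have -> : ly (f - T v) = ly f - ly (T v).
      by apply/rowP => i; rewrite !mxE Bi_B// l_B//; exact: HBi.
    by rewrite mulmxBl range_mul// subr0.
  rewrite mxE.
  have hd := H_B hf hTv.
  have : Normc.normc (\sum_j0 ly (f - T v) ord0 j0 * cokermx K j0 j) <=
      \sum_(i < n) `|C| * e * Normc.normc (cokermx K i j).
    apply: le_trans (normc_sum _) _; apply: ler_sum => i _.
    rewrite Normc.normcM mxE ler_wpM2r//.
      by case: (cokermx K i j) => p q /=; exact: sqrtr_ge0.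
    apply: le_trans (lBi i hd) _.
    apply: le_trans (ler_wpM2r (Nv0 _) (ler_norm C)) _.
    by rewrite ler_wpM2l// ltW.
  by rewrite -mulr_sumr -/D -mulrA mulrCA.
- exists n, g; split=> // y hy; exists (fun i => - l i (Bi y)).
  exists (Bi y); first exact: HBi.
  rewrite TE; last exact: HBi.
  rewrite BBi//; congr (_ + _).
  by rewrite -sumrN; apply: eq_bigr => i _; rewrite scaleNr opprK.
Qed.

End finite_rank.

(** * Approximation of the remainder by step functions *)

Section step_approximation.
Context {R : realType}.
Local Notation mu := (@lebesgue_measure R).
Local Notation N := (nm (@hip R)).
Implicit Types (f g F G phi v : R -> R) (a b c d e x y z : R).

(** Half-open, so that the cells below partition the complement exactly. *)
Definition outside (n : nat) : set R := ~` `[- n%:R, n%:R[%classic.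

Lemma measurable_outside n : measurable (outside n).
Proof. exact: measurableC. Qed.

Lemma L1_tail f e : L1 f -> (forall x, 0 <= f x) -> 0 < e ->
  exists2 n : nat, (0 < n)%N & \int[mu]_x (f x * \1_(outside n) x) < e.
Proof.
move=> lf f0 e0.
pose h (n : nat) x := f x * \1_(outside n) x.
have lh n : L1 (h n) by apply: L1_indic => //; exact: measurable_outside.
have cvh x : h n x @[n --> \oo] --> (0 : R).
  apply: cvg_near_cst; exists (Num.truncn `|x|).+1 => // n /= xn.
  have : `|x| < n%:R.
    have /andP[_] := truncn_itv (normr_ge0 x); move=> /lt_le_trans; apply.
    by rewrite ler_nat.
  rewrite ltr_norml => /andP[nx xn'].
  rewrite /h indicE memNset ?mulr0// /outside => -[].
  by rewrite /= in_itv/= (ltW nx).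
have cv : (\int[mu]_x (h n x)%:E)%E @[n --> \oo] --> (0 : R)%:E.
  rewrite -[X in _ --> X](integral0 mu setT).
  apply: (@dominated_cvg _ _ R mu setT measurableT _ _ (EFin \o f)) => //.
  - by move=> n; apply/measurable_EFinP; exact: L1_measurable.
  - by move=> x _; apply: cvg_EFin; [exact: nearW|exact: cvh].
  - move=> n x _; rewrite /= lee_fin /h normrM (ger0_norm (f0 x)) indicE.
    by case: (_ \in _); rewrite ?normr1 ?normr0 ?mulr1 ?mulr0.
have cv' : (fun n => \int[mu]_x h n x) @ \oo --> (0 : R) by exact: (fine_cvg cv).
have [n0 _ Hn] : \forall n \near \oo, \int[mu]_x h n x < e.
  by move/cvgrPdist_lt : cv' => /(_ e e0); apply: filterS => m /=; rewrite sub0r normrN => /(le_lt_trans (ler_norm _)).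
by exists n0.+1 => //; apply: (Hn n0.+1); rewrite /= leqnSn.
Qed.

Lemma weight_outside u e : H1R u -> 0 < e -> exists2 n, (0 < n)%N & weight u (outside n) <= e.
Proof.
move=> hu e0; have [lu lU _] := H1R_h1 hu.
pose c := 3 + 4 * N u.
have c0 : 0 < c by rewrite /c ltr_wpDr// mulr_ge0 ?nm_ge0.
(* If the L^2 norms on the tail are at most [s], and [s^2 <= s], then the weight is at most
   [s * (3 + 4 * N u) = s * c]. *)
pose s := Num.min 1 (e / c).
have s0 : 0 < s by rewrite /s lt_min ltr01 divr_gt0.
have s1 : s <= 1 by rewrite /s ge_min lexx.
have se : s * c <= e by rewrite -ler_pdivlMr// /s ge_min lexx orbT.
pose f x := u x ^+ 2 + wderiv u x ^+ 2.
have lf : L1 f by apply: L1D; exact: L2_sqr.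
have f0 x : 0 <= f x by rewrite addr_ge0 ?sqr_ge0.
have [n n0 Hn] := L1_tail lf f0 (exprn_gt0 2 s0).
exists n => //.
have mA := measurable_outside n.
have part g : L2 g -> (forall x, g x ^+ 2 <= f x) ->
    ip (fun x => g x * \1_(outside n) x) (fun x => g x * \1_(outside n) x) <= s ^+ 2.
  move=> lg gf; apply: le_trans (ltW Hn); apply: le_Rintegral => //.
  - by apply: L2M; exact: L2_indic.
  - exact: L1_indic.
  - move=> x _; rewrite indicE; case: (_ \in _); rewrite ?mulr1 ?mulr0// -expr2//.
have fU x : wderiv u x ^+ 2 <= f x by rewrite lerDr sqr_ge0.
have fu x : u x ^+ 2 <= f x by rewrite lerDl sqr_ge0.
have h1' := part _ lU fU.
have h2' := part _ lu fu.
have nU : nm ip (fun x => wderiv u x * \1_(outside n) x) <= s.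
  by rewrite -[leRHS]ger0_norm ?(ltW s0)// -sqrtr_sqr ler_wsqrtr.
rewrite /weight.
have aux (p q r m : R) : 0 <= m -> p <= s ^+ 2 -> q <= s -> r <= s ^+ 2 ->
    2 * p + 4 * m * q + r <= s * (3 + 4 * m).
  move=> m0 hp hq hr; have : s ^+ 2 <= s by rewrite expr2 ler_piMl// ltW.
  by have := ler_wpM2l m0 hq; nra.
apply: le_trans (aux _ _ _ _ (nm_ge0 _ _) h1' nU h2') _.
exact: se.
Qed.

Lemma H1R_modulus phi a b : H1R phi -> a <= b ->
  `|phi b - phi a| <= Num.sqrt (b - a) * N phi.
Proof.
move=> /H1R_h1 hp ab; have [_ lP [_ ->//]] := hp.
apply: le_trans (int_itv_cs ab lP) _.
by rewrite ler_wpM2l ?sqrtr_ge0//; exact: (nm_h1_le hp).2.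
Qed.

(** The nodes cut [[-n, n[] into [k + 1] cells of equal length. *)
Definition node (n k : nat) (i : nat) : R := - n%:R + i%:R * (2 * n%:R / k.+1%:R).

Definition cell (n k : nat) (i : nat) : set R := `[node n k i, node n k i.+1[%classic.

Lemma measurable_cell n k i : measurable (cell n k i).
Proof. exact: measurable_itv. Qed.

Lemma nodeS n k i : node n k i.+1 = node n k i + 2 * n%:R / k.+1%:R.
Proof. by rewrite /node -addn1 natrD; ring. Qed.

Lemma cell_outside n k (i : 'I_k.+1) x : (0 < n)%N -> cell n k i x -> ~ outside n x.
Proof.
move=> n0; rewrite /cell /= in_itv/= => /andP[x1 x2]; rewrite /outside => -[].
rewrite /= in_itv/=; apply/andP; split.
  by apply: le_trans x1; rewrite lerDl mulr_ge0// divr_ge0// mulr_ge0.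
apply: lt_le_trans x2 _; rewrite /node.
have : i.+1%:R * (2 * n%:R / k.+1%:R) <= 2 * n%:R :> R.
  rewrite mulrA ler_pdivrMr ?ltr0n// mulrC ler_wpM2l ?mulr_ge0//.
  by rewrite ler_nat.
by move: (i.+1%:R * _) => t; lra.
Qed.

Lemma cell_uniq n k i j x : (0 < n)%N -> cell n k i x -> cell n k j x -> (i <= j)%N.
Proof.
move=> n0; rewrite /cell /= !in_itv/= => /andP[x1 _] /andP[_ x2].
have := le_lt_trans x1 x2; rewrite /node ltrD2l ltr_pM2r ?ltr_nat//.
by rewrite divr_gt0 ?mulr_gt0 ?ltr0n.
Qed.

Lemma cell_ex n k x : (0 < n)%N -> ~ outside n x -> exists i : 'I_k.+1, cell n k i x.
Proof.
move=> n0 /contrapT; rewrite /= in_itv/= => /andP[x1 x2].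
have h0 : 0 < 2 * n%:R / k.+1%:R :> R by rewrite divr_gt0 ?mulr_gt0 ?ltr0n.
set h := 2 * n%:R / k.+1%:R in h0.
have t0 : 0 <= (x + n%:R) / h by rewrite divr_ge0 ?(ltW h0)//; lra.
have /andP[t1 t2] := truncn_itv t0.
have lt : (Num.truncn ((x + n%:R) / h) < k.+1)%N.
  rewrite -(ltr_nat R); apply: le_lt_trans t1 _; rewrite ltr_pdivrMr//.
  rewrite /h mulrC divfK ?pnatr_eq0//; lra.
exists (Ordinal lt); rewrite /cell /= in_itv/= /node -/h.
move: t1 t2; rewrite ler_pdivlMr// ltr_pdivrMr// => t1 t2.
by apply/andP; split; lra.
Qed.

(** Outside [[-n, n[] the step function is 0 and only the sup bound is left; inside, [x] lies in one
    cell, and [phi] varies there by at most [N phi] times the square root of the cell length. *)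
Lemma step_pointwise phi n k d x : H1R phi -> (0 < n)%N -> 0 <= d ->
  2 * n%:R / k.+1%:R <= d ^+ 2 ->
  `|phi x - \sum_(i < k.+1) phi (node n k i) * \1_(cell n k i) x| <=
  N phi * d + N phi * \1_(outside n) x.
Proof.
move=> hp n0 d0 hd; have [xo|xo] := pselect (outside n x).
  rewrite big1 ?subr0; last first.
    move=> i _; rewrite indicE memNset ?mulr0// => /(@cell_outside n k i x n0).
    exact.
  rewrite indicE mem_set// mulr1; apply: le_trans (H1R_nm_sup x hp) _.
  by rewrite lerDr mulr_ge0 ?nm_ge0.
have [i xi] := cell_ex k n0 xo.
rewrite (bigD1 i)//= [X in _ * \1_X x]/cell indicE mem_set// mulr1 big1 ?addr0; last first.
  move=> j ji; rewrite indicE memNset ?mulr0// => xj; move/eqP: ji; apply.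
  by apply/val_inj/eqP; rewrite eqn_leq (cell_uniq n0 xj xi) (cell_uniq n0 xi xj).
rewrite indicE memNset// mulr0 addr0.
move: xi; rewrite /cell/= in_itv/= nodeS => /andP[x1 x2].
apply: le_trans (H1R_modulus hp x1) _; rewrite mulrC ler_wpM2l ?nm_ge0//.
by rewrite -[leRHS]ger0_norm// -sqrtr_sqr ler_wsqrtr// (le_trans _ hd)// lerBlDl ltW.
Qed.

Lemma measurable_step phi n k :
  measurable_fun setT (fun x => \sum_(i < k.+1) phi (node n k i) * \1_(cell n k i) x).
Proof.
apply: measurable_sum => i; apply: measurable_funM => //.
by apply: measurable_indic; exact: measurable_cell.
Qed.

(* [kappa u v] is integrable with small tails and [phi] is Hoelder continuous of
   exponent 1/2, so replacing [phi] by a step function costs little, uniformly in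
   the unit ball of H^1. *)
Lemma step_approx u e : H1R u -> 0 < e -> exists n k, forall v phi, H1R v -> H1R phi ->
  L1 (fun x => kappa u v x * (phi x - \sum_(i < k.+1) phi (node n k i) * \1_(cell n k i) x)) /\
  `|\int[mu]_x (kappa u v x *
     (phi x - \sum_(i < k.+1) phi (node n k i) * \1_(cell n k i) x))| <= e * N v * N phi.
Proof.
move=> hu e0; have e20 : 0 < e / 2 by rewrite divr_gt0.
have [n n0 Hn] := weight_outside hu e20.
have W0 : 0 < weight u setT + 1 by rewrite ltr_wpDl// weight_ge0.
pose d := e / 2 / (weight u setT + 1).
have d0 : 0 < d by rewrite divr_gt0.
have dW : d * weight u setT <= e / 2.
  rewrite /d mulrAC ler_pdivrMr// ler_wpM2l ?(ltW e20)//.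
  by rewrite lerDl.
pose k := Num.truncn (2 * n%:R / d ^+ 2).
have kd : 2 * n%:R / k.+1%:R <= d ^+ 2.
  have t0 : 0 <= 2 * n%:R / d ^+ 2 by apply: divr_ge0; [exact: mulr_ge0|exact: sqr_ge0].
  have /andP[_] := truncn_itv t0; rewrite -/k ltr_pdivrMr ?exprn_gt0// => H.
  by rewrite ler_pdivrMr ?ltr0n// [leRHS]mulrC ltW.
exists n, k => v phi hv hp.
pose psi x := phi x - \sum_(i < k.+1) phi (node n k i) * \1_(cell n k i) x.
suff : L1 (fun x => kappa u v x * psi x) /\
  `|\int[mu]_x (kappa u v x * psi x)| <= e * N v * N phi by [].
have psib x : `|psi x| <= N phi * d + N phi * \1_(outside n) x.
  by apply: step_pointwise => //; exact: ltW.
have mpsi : measurable_fun setT psi.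
  by apply: measurable_funB; [exact: H1R_measurable|exact: measurable_step].
have lk := L1_kappa hu hv.
have lko : L1 (fun x => `|kappa u v x * \1_(outside n) x|).
  by apply: L1_norm; apply: L1_indic => //; exact: measurable_outside.
have lp : L1 (fun x => kappa u v x * psi x).
  apply: (L1Mb (c := N phi * d + N phi)) => // x; apply: le_trans (psib x) _.
  by rewrite lerD2l ler_piMr ?nm_ge0// indicE; case: (_ \in _).
split=> //.
apply: le_trans (le_normr_Rintegral _ lp) _ => //.
have b1 : L1 (fun x => N phi * d * `|kappa u v x|) by apply: L1Z; exact: L1_norm.
have b2 : L1 (fun x => N phi * `|kappa u v x * \1_(outside n) x|) by exact: L1Z.
apply: le_trans (le_Rintegral _ (L1_norm lp) (L1D b1 b2) _) _ => //.
  move=> x _; rewrite normrM normrM.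
  have -> : `|\1_(outside n) x| = \1_(outside n) x :> R by rewrite ger0_norm.
  have aux (p q m i : R) : 0 <= p -> q <= m * d + m * i -> p * q <= m * d * p + m * (p * i).
    by move=> p0 h; have := ler_wpM2l p0 h; lra.
  exact: aux.
rewrite (RintegralD measurableT b1 b2).
rewrite (RintegralZl (N phi * d) measurableT (L1_norm lk)) (RintegralZl (N phi) measurableT lko).
have h1 := int_kappa hu hv.
have h2 := int_kappa_indic hu (measurable_outside n) hv.
have h3 : \int[mu]_x `|kappa u v x| * d <= e / 2 * N v.
  rewrite mulrC; apply: le_trans (ler_wpM2l (ltW d0) h1) _.
  by rewrite mulrA ler_wpM2r ?nm_ge0.
have h4 : \int[mu]_x `|kappa u v x * \1_(outside n) x| <= e / 2 * N v.
  by apply: le_trans h2 _; rewrite ler_wpM2r ?nm_ge0.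
have aux (p q m w : R) : 0 <= m -> p * d <= w -> q <= w -> m * d * p + m * q <= (w + w) * m.
  by move=> m0 a1 a2; have := ler_wpM2l m0 a1; have := ler_wpM2l m0 a2; lra.
apply: le_trans (aux _ _ _ _ (nm_ge0 _ _) h3 h4) _.
have half (p q r : R) : (p / 2 * q + p / 2 * q) * r <= p * q * r.
  by rewrite le_eqVlt; apply/orP; left; apply/eqP; field.
exact: half.
Qed.

End step_approximation.

Section semi_ip_sums.
Context {R : realType} {V : lmodType R}.
Variables (H : set V) (B : V -> V -> R).
Hypothesis HB : semi_ip H B.

Lemma sip_sum n (c : 'I_n -> R) (f : 'I_n -> V) : (forall i, H (f i)) ->
  H (\sum_(i < n) c i *: f i).
Proof.
elim: n c f => [|n IH] c f Hf; first by rewrite big_ord0; exact: (sip_0 HB).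
rewrite big_ord_recr /=; apply: (sip_D HB); last exact: (sip_Z HB).
by apply: IH => i; exact: Hf.
Qed.

Lemma sip_suml n (c : 'I_n -> R) (f : 'I_n -> V) w : (forall i, H (f i)) -> H w ->
  B (\sum_(i < n) c i *: f i) w = \sum_(i < n) c i * B (f i) w.
Proof.
move=> + Hw; elim: n c f => [|n IH] c f Hf.
  rewrite !big_ord0; have := sip_Zl HB 0 Hw Hw.
  by rewrite scale0r mul0r.
rewrite !big_ord_recr /= (sip_Dl HB)//; last 2 first.
- by apply: sip_sum => i; exact: Hf.
- exact: (sip_Z HB).
by rewrite (sip_Zl HB)// IH.
Qed.

End semi_ip_sums.

Section splitting.
Context {R : realType}.
Local Notation mu := (@lebesgue_measure R).
Local Notation N := (nm (@hip R)).
Implicit Types (f g F G phi v : R -> R) (a b c d e x y z : R).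
Variable u : R -> R.
Hypothesis hu : H1R u.

(** Linearity holds only almost everywhere, since [wderiv] of the combination is chosen
    independently of those of [f] and [g]. *)
Lemma kappa_lin c f g : H1R f -> H1R g ->
  ae_eq mu setT (kappa u (c *: f + g)) (fun x => c * kappa u f x + kappa u g x).
Proof.
move=> hf hg; have := h1_uniq (h1D (h1Z c (H1R_h1 hf)) (H1R_h1 hg)).
apply: ae_imp => x H /H {}H; rewrite /kappa.
rewrite -[wderiv (c *: f + g)]/(wderiv (fun x => c * f x + g x)) H.
by rewrite -[(c *: f + g) x]/(c * f x + g x); ring.
Qed.

Lemma int_kappa_lin c f g psi : H1R f -> H1R g -> measurable_fun setT psi ->
  L1 (fun x => kappa u f x * psi x) -> L1 (fun x => kappa u g x * psi x) ->
  \int[mu]_x (kappa u (c *: f + g) x * psi x) =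
  c * \int[mu]_x (kappa u f x * psi x) + \int[mu]_x (kappa u g x * psi x).
Proof.
move=> hf hg mpsi l1 l2.
have hfg : H1R (c *: f + g) by apply: (sip_D semi_ip_H1R) => //; exact: (sip_Z semi_ip_H1R).
rewrite -(RintegralZl c measurableT l1) -(RintegralD measurableT (L1Z c l1) l2).
rewrite /Rintegral; congr fine; apply: ae_eq_integral => //.
- apply/measurable_EFinP; apply: measurable_funM => //.
  by apply: L1_measurable; exact: L1_kappa.
- apply/measurable_EFinP; apply: L1_measurable.
  by apply: L1D => //; exact: L1Z.
- by apply: ae_imp (kappa_lin c hf hg) => x H /H {}H; rewrite /= H; congr EFin; ring.
Qed.

Lemma H1R_eq_of_hip f g : H1R f -> H1R g ->
  (forall phi, H1R phi -> hip f phi = hip g phi) -> f = g.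
Proof.
move=> hf hg H; apply/eqP; rewrite -subr_eq0; apply/eqP.
have hd := sip_B semi_ip_H1R hf hg.
by apply: H1R_eq0 => //; rewrite (sip_Bl semi_ip_H1R)// H// subrr.
Qed.

Lemma opK_lin c f g : H1R f -> H1R g ->
  opK hu (c *: f + g) = c *: opK hu f + opK hu g.
Proof.
move=> hf hg; have hcf := sip_Z semi_ip_H1R c hf.
have hfg := sip_D semi_ip_H1R hcf hg.
have hKf := H1R_opK hu hf; have hKg := H1R_opK hu hg.
have hcK := sip_Z semi_ip_H1R c hKf.
apply: H1R_eq_of_hip; [exact: H1R_opK|exact: (sip_D semi_ip_H1R)|].
move=> phi hp; rewrite (sip_Dl semi_ip_H1R)// (sip_Zl semi_ip_H1R)// !hip_opK//.
by apply: int_kappa_lin => //; [exact: H1R_measurable|exact: L1_kappaM|exact: L1_kappaM].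
Qed.

(** Evaluation is bounded by the sup bound. The function found here is [exp (- |y - x|) / 2], the
    Green function of [1 - d^2]. *)
Lemma eval_riesz x : exists2 w, H1R w & forall phi, H1R phi -> hip w phi = phi x.
Proof.
apply: (riesz semi_ip_H1R (M := 1) (@H1R_complete R)) => //.
by move=> f hf; rewrite mul1r; exact: H1R_nm_sup.
Qed.

(** The step approximation of [phi] turns the pairing of [opK v] with [phi] into a sum of integrals
    of [kappa v] over cells times values of [phi] at nodes. This is a finite-rank operator whose
    vectors represent the evaluations at the nodes. *)
Lemma opK_split e : 0 < e -> exists m (l : 'I_m -> (R -> R) -> R) (g : 'I_m -> R -> R)
    (S : (R -> R) -> R -> R) (C : R),
  [/\ forall i, H1R (g i),
      forall v, H1R v -> [/\ H1R (S v), opK hu v = S v + \sum_(i < m) l i v *: g i,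
        N (S v) <= e * N v & forall i, `|l i v| <= C * N v],
      forall c v w, H1R v -> H1R w -> S (c *: v + w) = c *: S v + S w &
      forall i c v w, H1R v -> H1R w -> l i (c *: v + w) = c * l i v + l i w].
Proof.
move=> e0; have [n [k Hnk]] := step_approx hu e0.
have /choice [g Hg] : forall i : 'I_k.+1, exists w, H1R w /\
    forall phi, H1R phi -> hip w phi = phi (node n k i).
  by move=> i; have [w w1 w2] := eval_riesz (node n k i); exists w.
pose l (i : 'I_k.+1) v := \int[mu]_x (kappa u v x * \1_(cell n k i) x).
have mi (i : 'I_k.+1) : measurable_fun setT (\1_(cell n k i) : R -> R).
  by apply: measurable_indic; exact: measurable_cell.
have b1 (i : 'I_k.+1) x : `|(\1_(cell n k i) x : R)| <= 1.
  by rewrite indicE; case: (_ \in _); rewrite ?normr1 ?normr0.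
have ll i v : H1R v -> L1 (fun x => kappa u v x * \1_(cell n k i) x).
  by move=> hv; apply: L1_indic; [exact: measurable_cell|exact: L1_kappa].
have llin i c v w : H1R v -> H1R w -> l i (c *: v + w) = c * l i v + l i w.
  move=> hv hw; exact: (int_kappa_lin c hv hw (mi i) (ll i v hv) (ll i w hw)).
pose S v := opK hu v - \sum_(i < k.+1) l i v *: g i.
have HG v : H1R (\sum_(i < k.+1) l i v *: g i).
  exact: (sip_sum semi_ip_H1R (fun i => l i v) (fun i => (Hg i).1)).
have HS v : H1R v -> H1R (S v).
  by move=> hv; exact: (sip_B semi_ip_H1R (H1R_opK hu hv) (HG v)).
have hipG v phi : H1R phi ->
    hip (\sum_(i < k.+1) l i v *: g i) phi = \sum_(i < k.+1) l i v * phi (node n k i).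
  move=> hp.
  rewrite (sip_suml semi_ip_H1R (fun i => l i v) (fun i => (Hg i).1) hp).
  by apply: eq_bigr => i _; rewrite (Hg i).2.
have hipS v phi : H1R v -> H1R phi -> hip (S v) phi =
    \int[mu]_x (kappa u v x * (phi x - \sum_(i < k.+1) phi (node n k i) * \1_(cell n k i) x)).
  move=> hv hp; rewrite /S (sip_Bl semi_ip_H1R (H1R_opK hu hv) (HG v) hp).
  rewrite (hip_opK hu hv hp) (hipG v phi hp).
  have lsi (i : 'I_k.+1) : L1 (fun x => phi (node n k i) * (kappa u v x * \1_(cell n k i) x)).
    by apply: L1Z; exact: ll.
  have -> : \sum_(i < k.+1) l i v * phi (node n k i) =
      \int[mu]_x (\sum_(i < k.+1) phi (node n k i) * (kappa u v x * \1_(cell n k i) x)).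
    rewrite (int_sum lsi); apply: eq_bigr => i _.
    by rewrite (RintegralZl (phi (node n k i)) measurableT (ll i v hv)) mulrC.
  rewrite -(RintegralB measurableT (L1_kappaM hu hv hp) (L1_sum lsi)).
  apply: eq_Rintegral => x _; rewrite mulrBr mulr_sumr; congr (_ - _).
  by apply: eq_bigr => i _; rewrite mulrCA.
exists k.+1, l, g, S, (weight u setT); split=> //.
- by move=> i; exact: (Hg i).1.
- move=> v hv; split; [exact: HS|by rewrite subrK| |].
    have hS := HS v hv.
    (* The bound on pairings becomes a bound on the norm by pairing [S v] with itself. *)
    have H : N (S v) ^+ 2 <= e * N v * N (S v).
      rewrite (nm_sqr semi_ip_H1R)// hipS//.
      by apply: le_trans (ler_norm _) _; exact: (Hnk v (S v) hv hS).2.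
    have [N0|N0] := leP (N (S v)) 0.
      by apply: le_trans N0 _; rewrite mulr_ge0 ?nm_ge0// ltW.
    by move: H; rewrite expr2 ler_pM2r.
  move=> i; apply: le_trans (int_normM_le (mi i) (b1 i) (L1_kappa hu hv)) _.
  by rewrite mul1r; exact: int_kappa.
- move=> c v w hv hw; rewrite /S opK_lin// scalerBr addrACA; congr (_ + _).
  rewrite -opprD; congr (- _); rewrite scaler_sumr -big_split /=.
  by apply: eq_bigr => i _; rewrite llin// scalerDl scalerA.
Qed.

End splitting.

(** * Multipliers of H^1 *)

Section multipliers.
Context {R : realType}.
Local Notation N := (nm (@hip R)).
Implicit Types (f g q Q : R -> R).

(** Bounded functions with square integrable derivative. In contrast to H^1 this class contains the
    constants, hence the real and imaginary parts of [u^2 - z] and of its reciprocal. *)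
Definition mult q := exists Q (c : R), [/\ ac q Q, L2 Q & forall x, `|q x| <= c].

Lemma mult_H1R q : mult q -> exists2 C, 0 <= C &
  forall f, H1R f -> H1R (fun x => q x * f x) /\ N (fun x => q x * f x) <= C * N f.
Proof.
move=> [Q [c [acq lQ qc]]].
have mq : measurable_fun setT q by exact: continuous_measurable_fun (ac_continuous acq).
have c0 : 0 <= c by exact: le_trans (normr_ge0 _) (qc 0).
exists (c + (nm ip Q + c)); first by rewrite !addr_ge0 ?nm_ge0.
move=> f hf; have h_f := H1R_h1 hf; have [lf lF acf] := h_f.
have l1 : L2 (fun x => q x * f x) by exact: L2Mb qc lf.
have l2 : L2 (fun x => Q x * f x) by under eq_fun do rewrite mulrC; exact: L2Mh.
have l3 : L2 (fun x => q x * wderiv f x) by exact: L2Mb qc lF.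
have h : h1 (fun x => q x * f x) (fun x => Q x * f x + q x * wderiv f x).
  by split; [exact: l1|exact: L2D|exact: ac_mul].
split; first exact: h1_H1R h.
have nb (g : R -> R) : L2 g -> nm ip (fun x => q x * g x) <= c * nm ip g.
  move=> lg; have lqg : L2 (fun x => q x * g x) by exact: L2Mb qc lg.
  have -> : c * nm ip g = nm ip (c *: g) by rewrite (nmZ semi_ip_L2)// ger0_norm.
  rewrite ler_wsqrtr//; apply: le_Rintegral => //; [exact: L2M| |].
    by apply: L2M; exact: L2Z.
  move=> x _; rewrite -!expr2 -[X in X <= _]real_normK ?num_real//.
  rewrite -[X in _ <= X]real_normK ?num_real// lerXn2r ?nnegrE//.
  by rewrite normrM [leRHS]normrM ler_wpM2r// (le_trans (qc x))// ler_norm.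
have nQ : nm ip (fun x => Q x * f x) <= nm ip Q * N f.
  have -> : nm ip Q * N f = nm ip (N f *: Q).
    by rewrite (nmZ semi_ip_L2)// ger0_norm ?nm_ge0// mulrC.
  have lNQ : L2 (N f *: Q) by exact: L2Z.
  rewrite ler_wsqrtr//; apply: le_Rintegral => //; [exact: L2M|exact: L2M|].
  move=> x _; rewrite -!expr2 -[X in X <= _]real_normK ?num_real//.
  rewrite -[X in _ <= X]real_normK ?num_real// lerXn2r ?nnegrE//.
  rewrite normrM [leRHS]normrM mulrC ler_wpM2r//.
  by rewrite (le_trans (H1R_nm_sup x hf))// ler_norm.
apply: le_trans (nm_h1_ge h) _.
apply: le_trans (lerD (lexx _) (nmD semi_ip_L2 l2 l3)) _.
rewrite mulrDl mulrDl; apply: lerD.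
  by apply: le_trans (nb _ lf) _; rewrite ler_wpM2l//; exact: (nm_h1_le h_f).1.
apply: lerD => //.
by apply: le_trans (nb _ lF) _; rewrite ler_wpM2l//; exact: (nm_h1_le h_f).2.
Qed.

Lemma mult_cst (k : R) : mult (fun=> k).
Proof. by exists (fun=> 0), `|k|; split=> //; [exact: ac_cst|exact: L2_0]. Qed.

Lemma multD f g : mult f -> mult g -> mult (fun x => f x + g x).
Proof.
move=> [F [c [a1 l1 b1]]] [G [d [a2 l2 b2]]]; exists (fun x => F x + G x), (c + d).
split; [exact: acD|exact: L2D|].
by move=> x; rewrite (le_trans (ler_normD _ _))// lerD.
Qed.

Lemma multM f g : mult f -> mult g -> mult (fun x => f x * g x).
Proof.
move=> [F [c [a1 l1 b1]]] [G [d [a2 l2 b2]]].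
exists (fun x => F x * g x + f x * G x), (c * d); split; first exact: ac_mul.
  apply: L2D; last first.
    by apply: L2Mb b1 l2; exact: continuous_measurable_fun (ac_continuous a1).
  under eq_fun do rewrite mulrC.
  by apply: L2Mb b2 l1; exact: continuous_measurable_fun (ac_continuous a2).
by move=> x; rewrite normrM ler_pM.
Qed.

Lemma mult_inv f (d : R) : 0 < d -> (forall x, d <= f x) -> mult f -> mult (fun x => (f x)^-1).
Proof.
move=> d0 fd [F [c [a1 l1 b1]]].
have f0 x : 0 < f x by exact: lt_le_trans (fd x).
have fi x : `|(f x)^-1| <= d^-1.
  by rewrite ger0_norm ?invr_ge0 ?(ltW (f0 x))// lef_pV2 ?posrE.
have ai := ac_inv d0 fd a1.
exists (fun x => - (f x) ^- 2 * F x), d^-1; split=> //.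
apply: (L2Mb (c := d^-1 * d^-1)) l1.
  apply: measurableT_comp => //.
  have -> : (fun x => f x ^- 2) = (fun x => (f x)^-1 ^+ 2).
    by apply/funext => x; rewrite exprVn.
  by apply: measurable_funX; exact: continuous_measurable_fun (ac_continuous ai).
by move=> x; rewrite normrN -exprVn expr2 normrM ler_pM.
Qed.

Lemma mult_H1R_fun f : H1R f -> mult f.
Proof.
move=> hf; have [_ lF acf] := H1R_h1 hf; exists (wderiv f), (N f); split=> //.
by move=> x; exact: H1R_nm_sup.
Qed.

End multipliers.

Section complex_norm.
Context {R : realType}.
Local Notation N := (nm (@hip R)).
Local Notation re f := (fun x => complex.Re (f x)).
Local Notation im f := (fun x => complex.Im (f x)).
Implicit Types (f g : R -> R[i]).

(** Equivalent to [H1_norm]; estimates for the real and imaginary parts simply add up. *)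
Definition nc f := N (re f) + N (im f).

Lemma nc_ge0 f : 0 <= nc f.
Proof. by rewrite addr_ge0 ?nm_ge0. Qed.

Lemma ncD f g : H1 f -> H1 g -> nc (f + g) <= nc f + nc g.
Proof.
move=> [f1 f2] [g1 g2]; rewrite /nc re_add im_add addrACA.
by apply: lerD; exact: (nmD semi_ip_H1R).
Qed.

Lemma ncN f : H1 f -> nc (- f) = nc f.
Proof. by move=> [f1 f2]; rewrite /nc re_opp im_opp !(nmN semi_ip_H1R). Qed.

Lemma nc_dist f g : H1 f -> H1 g -> nc (f - g) = nc (g - f).
Proof. by move=> hf hg; rewrite -ncN ?opprB//; exact: H1B. Qed.

Lemma nc_le_norm f : nc f <= 2 * H1_norm f.
Proof.
rewrite /nc /nm !hip_normsq /H1_norm.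
have h p q : 0 <= p -> 0 <= q -> Num.sqrt p + Num.sqrt q <= 2 * Num.sqrt (p + q) :> R.
  by move=> p0 q0; rewrite mulrDl mul1r; apply: lerD; rewrite ler_wsqrtr ?lerDl ?lerDr.
by apply: h; rewrite -hip_normsq hip_ge0.
Qed.

Lemma eqC f g : re f = re g -> im f = im g -> f = g.
Proof.
move=> h1 h2; apply/funext => x.
have /= a := congr1 (@^~ x) h1; have /= b := congr1 (@^~ x) h2.
by move: a b; case: (f x) (g x) => [p q] [p' q'] /= -> ->.
Qed.

Lemma nc_eq0 f : H1 f -> nc f <= 0 -> f = 0.
Proof.
move=> [f1 f2] h.
have n0 (k : R -> R) : H1R k -> N k <= 0 -> k = fun=> 0.
  move=> hk h0; apply: H1R_eq0 => //.
  rewrite -(nm_sqr semi_ip_H1R)//; apply/eqP; rewrite sqrf_eq0.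
  by rewrite eq_le h0 nm_ge0.
have e1 := n0 _ f1 (le_trans (ler_wpDr (nm_ge0 _ _) (lexx _)) h).
have e2 := n0 _ f2 (le_trans (ler_wpDl (nm_ge0 _ _) (lexx _)) h).
by apply: eqC.
Qed.

End complex_norm.

Section contraction.
Context {R : realFieldType}.
Implicit Types a b c d k t w : R.

Lemma contraction_step a b c d w :
  a <= 2 * c / w -> b <= 1 / 4 * d -> d <= 8 * c / w -> a + b <= 4 * c / w.
Proof. by move=> ha hb hd; lra. Qed.

Lemma contraction_bound k t : 0 <= k -> 0 <= t -> t <= k + 1 / 4 * t -> t <= 2 * k.
Proof. by lra. Qed.

Lemma contraction_le0 t : t <= 1 / 4 * t -> t <= 0.
Proof. by lra. Qed.

End contraction.

(** * Inversion of multiplication plus a small operator *)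

Section resolvent.
Context {R : realType}.
Local Notation mu := (@lebesgue_measure R).
Local Notation N := (nm (@hip R)).
Local Notation re f := (fun x => complex.Re (f x)).
Local Notation im f := (fun x => complex.Im (f x)).
Implicit Types (f g : R -> R[i]).

Definition cx (p q : R -> R) : R -> R[i] := fun x => Complex (p x) (q x).

(* multiplication by [r + i s] *)
Definition cmul (r s : R -> R) f : R -> R[i] :=
  cx (fun x => r x * complex.Re (f x) - s x * complex.Im (f x))
     (fun x => r x * complex.Im (f x) + s x * complex.Re (f x)).

Lemma cmulD r s f g : cmul r s (f + g) = cmul r s f + cmul r s g.
Proof.
apply: eqC; rewrite ?re_add ?im_add; apply/funext => x.
- change (r x * complex.Re (f x + g x) - s x * complex.Im (f x + g x) =
    (r x * complex.Re (f x) - s x * complex.Im (f x)) +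
    (r x * complex.Re (g x) - s x * complex.Im (g x))).
  by case: (f x) (g x) => [a b] [a' b'] /=; ring.
- change (r x * complex.Im (f x + g x) + s x * complex.Re (f x + g x) =
    (r x * complex.Im (f x) + s x * complex.Re (f x)) +
    (r x * complex.Im (g x) + s x * complex.Re (g x))).
  by case: (f x) (g x) => [a b] [a' b'] /=; ring.
Qed.

Lemma cmulZ r s (c : R[i]) f : cmul r s (c *: f) = c *: cmul r s f.
Proof.
apply/funext => x; rewrite [RHS]/GRing.scale/= /cmul /cx [(c *: f) x]/GRing.scale/=.
case: c (f x) => [a b] [p q] /=.
by apply/eqP; rewrite eq_complex /=; apply/andP; split; apply/eqP; ring.
Qed.

Lemma cmulN r s f : cmul r s (- f) = - cmul r s f.
Proof. by rewrite -scaleN1r cmulZ scaleN1r. Qed.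

Lemma cmul_bound r s : mult r -> mult s -> exists2 C, 0 <= C &
  forall f, H1 f -> H1 (cmul r s f) /\ nc (cmul r s f) <= C * nc f.
Proof.
move=> /mult_H1R[Cr Cr0 Hr] /mult_H1R[Cs Cs0 Hs]; exists (Cr + Cs).
  by rewrite addr_ge0.
move=> f [f1 f2].
have [r1 r1b] := Hr _ f1; have [r2 r2b] := Hr _ f2.
have [s1 s1b] := Hs _ f1; have [s2 s2b] := Hs _ f2.
have h1 : H1R (re (cmul r s f)) by exact: (sip_B semi_ip_H1R r1 s2).
have h2 : H1R (im (cmul r s f)) by exact: (sip_D semi_ip_H1R r2 s1).
split=> //.
have b1 : N (re (cmul r s f)) <= Cr * N (re f) + Cs * N (im f).
  apply: le_trans (nmD semi_ip_H1R r1 (sip_N semi_ip_H1R s2)) _.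
  apply: lerD; first exact: r1b.
  by rewrite (nmN semi_ip_H1R s2); exact: s2b.
have b2 : N (im (cmul r s f)) <= Cr * N (im f) + Cs * N (re f).
  by apply: le_trans (nmD semi_ip_H1R r2 s1) _; exact: (lerD r2b s1b).
have aux (p q : R) : (Cr * p + Cs * q) + (Cr * q + Cs * p) <= (Cr + Cs) * (p + q).
  by rewrite le_eqVlt; apply/orP; left; apply/eqP; ring.
exact: le_trans (lerD b1 b2) (aux _ _).
Qed.

Variables (S : (R -> R) -> R -> R).
Hypotheses (HS : forall v, H1R v -> H1R (S v))
  (S_lin : forall c v w, H1R v -> H1R w -> S (c *: v + w) = c *: S v + S w).

Definition cext f := cx (S (re f)) (S (im f)).

Lemma H1_cext f : H1 f -> H1 (cext f).
Proof. by move=> [f1 f2]; split; exact: HS. Qed.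

Let SD v w : H1R v -> H1R w -> S (v + w) = S v + S w.
Proof. by move=> hv hw; have := S_lin 1 hv hw; rewrite !scale1r. Qed.

Let S0 : S 0 = 0.
Proof.
have := SD (@H1R0 R) (@H1R0 R).
rewrite -[(fun=> 0) + (fun=> 0)]/(0 + 0) addr0 => /eqP.
by rewrite -subr_eq0 opprD addNKr oppr_eq0 => /eqP.
Qed.

Let SZ c v : H1R v -> S (c *: v) = c *: S v.
Proof. by move=> hv; have := S_lin c hv (@H1R0 R); rewrite S0 !addr0. Qed.

Lemma cextD f g : H1 f -> H1 g -> cext (f + g) = cext f + cext g.
Proof.
move=> [f1 f2] [g1 g2]; apply: eqC.
  by rewrite re_add /cext /= re_add SD.
by rewrite im_add /cext /= im_add SD.
Qed.

Lemma cextZ (c : R[i]) f : H1 f -> cext (c *: f) = c *: cext f.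
Proof.
move=> [f1 f2].
have hz (k : R) (v : R -> R) : H1R v -> H1R (k *: v) by exact: (sip_Z semi_ip_H1R).
apply: eqC.
  rewrite re_scale /cext /= re_scale -scaleNr SD ?SZ//; try exact: hz.
  by rewrite scaleNr.
rewrite im_scale /cext /= im_scale SD ?SZ//; exact: hz.
Qed.

Lemma cextN f : H1 f -> cext (- f) = - cext f.
Proof. by move=> hf; rewrite -scaleN1r cextZ// scaleN1r. Qed.

Lemma cext_bound e : (forall v, H1R v -> N (S v) <= e * N v) ->
  forall f, H1 f -> nc (cext f) <= e * nc f.
Proof. by move=> Se f [f1 f2]; rewrite /nc mulrDr; apply: lerD; exact: Se. Qed.

(** Banach's fixed point theorem for [v = (y - S v) / (u^2 - z)], where [r + i s] is the reciprocal
    of [u^2 - z]. The contraction factor 1/4 is the ratio in [geom_complete]; the fixed point has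
    norm at most 4/3 of [C * nc y], rounded up to twice. *)
Lemma fixpoint_ex r s (C e : R) :
  (forall f, H1 f -> H1 (cmul r s f) /\ nc (cmul r s f) <= C * nc f) -> 0 <= C ->
  (forall v, H1R v -> N (S v) <= e * N v) -> C * e <= 1 / 4 ->
  forall y, H1 y -> exists v, [/\ H1 v, v = cmul r s (y - cext v), nc v <= 2 * C * nc y &
    forall w, H1 w -> w = cmul r s (y - cext w) -> w = v].
Proof.
move=> HC C0 Se Ce y hy.
have contr f : H1 f -> nc (cmul r s (cext f)) <= 1 / 4 * nc f.
  move=> hf; apply: le_trans (HC _ (H1_cext hf)).2 _.
  apply: le_trans (ler_wpM2l C0 (cext_bound Se hf)) _.
  by rewrite mulrA ler_wpM2r ?nc_ge0.
pose Phi f := cmul r s (y - cext f).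
have HPhi f : H1 f -> H1 (Phi f).
  by move=> hf; apply: (HC _ _).1; apply: H1B => //; exact: H1_cext.
have PhiB f g : H1 f -> H1 g -> Phi f - Phi g = cmul r s (cext (g - f)).
  move=> hf hg; rewrite /Phi !cmulD !cmulN cextD//; last exact: H1N.
  by rewrite cextN// cmulD cmulN opprD opprK addrACA subrr add0r addrC.
have Phic f g : H1 f -> H1 g -> nc (Phi f - Phi g) <= 1 / 4 * nc (f - g).
  move=> hf hg; rewrite PhiB// (nc_dist hf hg); apply: contr; exact: H1B.
pose x n := iter n Phi 0.
have Hx n : H1 (x n) by elim: n => [|n IH]; [exact: H1_0|exact: HPhi].
pose c := nc (x 1%N - x 0%N).
have c0 : 0 <= c by exact: nc_ge0.
have xc n : nc (x n.+1 - x n) <= c / 4 ^+ n.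
  elim: n => [|n IH]; first by rewrite expr0 divr1.
  apply: le_trans (Phic _ _ (Hx n.+1) (Hx n)) _.
  apply: le_trans (ler_wpM2l _ IH) _ => //.
  rewrite exprS le_eqVlt; apply/orP; left; apply/eqP; field.
  by rewrite expf_neq0.
have xre n : N (re (x n.+1) - re (x n)) <= c / 4 ^+ n.
  apply: le_trans (xc n); rewrite /nc re_add re_opp.
  by rewrite lerDl nm_ge0.
have xim n : N (im (x n.+1) - im (x n)) <= c / 4 ^+ n.
  apply: le_trans (xc n); rewrite /nc im_add im_opp.
  by rewrite lerDr nm_ge0.
have [p hp pl] := H1R_complete (fun n => (Hx n).1) xre.
have [q hq ql] := H1R_complete (fun n => (Hx n).2) xim.
pose v := cx p q.
have hv : H1 v by [].
have vx n : nc (v - x n) <= 8 * c / 4 ^+ n.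
  rewrite /nc re_add re_opp im_add im_opp.
  apply: le_trans (lerD (pl n) (ql n)) _.
  by rewrite -mulrDl ler_wpM2r ?invr_ge0 ?exprn_ge0// -mulrDl ler_wpM2r//; lra.
have hPv := HPhi _ hv.
have vE : v = Phi v.
  apply/eqP; rewrite -subr_eq0; apply/eqP/nc_eq0; first exact: H1B.
  apply: (@le0_of_geometric _ _ (4 * c)) => n.
  have -> : v - Phi v = (v - x n.+1) + (Phi (x n) - Phi v) by rewrite addrA subrK.
  apply: le_trans (ncD (H1B hv (Hx _)) (H1B (HPhi _ (Hx n)) hPv)) _.
  have h1 := vx n.+1; have h2 := Phic _ _ (Hx n) hv.
  rewrite (nc_dist (Hx n) hv) in h2; have h3 := vx n.
  have p4 : 4 ^+ n != 0 :> R by rewrite expf_neq0.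
  have h4 : 8 * c / 4 ^+ n.+1 = 2 * c / 4 ^+ n by rewrite exprS; field.
  rewrite h4 in h1.
  exact: (contraction_step h1 h2 h3).
have H v1 : H1 v1 -> nc (cmul r s y) <= C * nc y -> v1 = Phi v1 -> nc v1 <= 2 * C * nc y.
  move=> hv1 h1 h2; have h3 := contr _ hv1.
  have : nc (Phi v1) <= C * nc y + 1 / 4 * nc v1.
    rewrite /Phi cmulD cmulN.
    have hc := (HC _ (H1_cext hv1)).1; have hcy := (HC _ hy).1.
    apply: le_trans (ncD hcy (H1N hc)) _; rewrite (ncN hc); exact: (lerD h1 h3).
  rewrite -h2; have := nc_ge0 v1; have := mulr_ge0 C0 (nc_ge0 y).
  by move=> p0 q0 /(contraction_bound p0 q0); rewrite mulrA.
exists v; split=> //; first exact: H (HC _ hy).2 vE.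
move=> w hw wE; apply/eqP; rewrite -subr_eq0; apply/eqP/nc_eq0; first exact: H1B.
have := Phic _ _ hw hv; rewrite {1}/Phi -wE -vE.
exact: contraction_le0.
Qed.

End resolvent.

Section fredholm.
Context {R : realType}.
Local Notation N := (nm (@hip R)).
Local Notation re f := (fun x => complex.Re (f x)).
Local Notation im f := (fun x => complex.Im (f x)).

Lemma re_sum n (F : 'I_n -> R -> R[i]) : re (\sum_(i < n) F i) = \sum_(i < n) re (F i).
Proof.
elim: n F => [|n IH] F; first by rewrite !big_ord0.
by rewrite !big_ord_recr /= re_add IH.
Qed.

Lemma im_sum n (F : 'I_n -> R -> R[i]) : im (\sum_(i < n) F i) = \sum_(i < n) im (F i).
Proof.
elim: n F => [|n IH] F; first by rewrite !big_ord0.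
by rewrite !big_ord_recr /= im_add IH.
Qed.

Lemma fredholm_of_resolvent (u : R -> R) (z : R[i]) (d : R) : H1R u -> 0 < d ->
  (forall x, d <= (u x ^+ 2 - complex.Re z) ^+ 2 + complex.Im z ^+ 2) ->
  fredholm H1 H1_norm (fun v => opM u v - z *: v).
Proof.
move=> hu d0 hd.
pose a := complex.Re z; pose b := complex.Im z.
(* [u^2 - z = A - i b] has squared modulus [D], so [r + i s = (A + i b) / D] is its reciprocal. [D]
   is bounded below, which makes [r] and [s] multipliers. *)
pose A x := u x * u x + - a.
pose D x := A x * A x + b * b.
have mu_ := mult_H1R_fun hu.
have mA : mult A by apply: multD; [exact: multM|exact: mult_cst].
have mD : mult D by apply: multD; [exact: multM|exact: mult_cst].
have dD x : d <= D x by have := hd x; rewrite /D /A !expr2.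
have D0 x : D x != 0 by rewrite gt_eqF// (lt_le_trans d0).
have mDi := mult_inv d0 dD mD.
pose r x := A x * (D x)^-1; pose s x := b * (D x)^-1.
have mr : mult r by exact: multM.
have ms : mult s by apply: multM => //; exact: mult_cst.
have [C C0 HC] := cmul_bound mr ms.
have [C' C'0 HC'] := cmul_bound mA (mult_cst (- b)).
(* Makes [C * e] at most 1/4, including the case [C = 0]. *)
pose e := 1 / (4 * (C + 1)).
have C1 : 0 < C + 1 by rewrite ltr_wpDl.
have e0 : 0 < e by rewrite divr_gt0// mulr_gt0.
have Ce : C * e <= 1 / 4.
  have -> : 1 / 4 = (C + 1) * e by rewrite /e; field; rewrite gt_eqF.
  by rewrite ler_wpM2r ?(ltW e0)// lerDl.
have [m [l [g [S [K [Hg HK S_lin l_lin]]]]]] := opK_split hu e0.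
have HS v : H1R v -> H1R (S v) by move=> /HK[].
have Se v : H1R v -> N (S v) <= e * N v by move=> /HK[].
have lK i v : H1R v -> `|l i v| <= `|K| * N v.
  move=> /HK[_ _ _ /(_ i)] /le_trans; apply.
  by rewrite ler_wpM2r ?nm_ge0// ler_norm.
pose Am f := cmul A (fun=> - b) f.
pose B f := Am f + cext S f.
have rA f : cmul r s (Am f) = f.
  apply: eqC; apply/funext => x; rewrite /cmul /Am /cx /= /r /s.
    rewrite -[RHS](mulfK (D0 x)); rewrite {3}/D; ring.
  rewrite -[RHS](mulfK (D0 x)); rewrite {3}/D; ring.
have Ar f : Am (cmul r s f) = f.
  apply: eqC; apply/funext => x; rewrite /cmul /Am /cx /= /r /s.
    rewrite -[RHS](mulfK (D0 x)); rewrite {5}/D; ring.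
  rewrite -[RHS](mulfK (D0 x)); rewrite {5}/D; ring.
(* The fixed point as a function of [y] inverts [B]: existence gives the right inverse, uniqueness
   the left inverse. *)
have /choice [Bi HBi] : forall y, exists v, H1 y -> [/\ H1 v, v = cmul r s (y - cext S v),
    nc v <= 2 * C * nc y & forall w, H1 w -> w = cmul r s (y - cext S w) -> w = v].
  move=> y; have [hy|] := pselect (H1 y); last by exists 0.
  by have [v Hv] := fixpoint_ex HS S_lin HC C0 Se Ce hy; exists v.
pose L i f : R[i] := Complex (l i (re f)) (l i (im f)).
pose G i : R -> R[i] := cx (g i) 0.
have HG i : H1 (G i) by split; [exact: Hg|exact: H1R0].
have HB v : H1 v -> H1 (B v).
  by move=> hv; apply: H1D; [exact: (HC' _ hv).1|exact: H1_cext].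
have BBi y : H1 y -> B (Bi y) = y.
  by move=> hy; have [_ E _ _] := HBi y hy; rewrite /B {1}E Ar subrK.
have BiB v : H1 v -> Bi (B v) = v.
  move=> hv; have [_ _ _ U] := HBi _ (HB v hv).
  by apply/esym/U => //; rewrite /B addrK rA.
have TE v : H1 v -> opM u v - z *: v = B v + \sum_(i < m) L i v *: G i.
  move=> [v1 v2]; have [_ E1 _ _] := HK _ v1; have [_ E2 _ _] := HK _ v2.
  apply: eqC.
    rewrite re_add re_opp re_scale re_add re_sum.
    have -> : re (opM u v) = (fun x => u x ^+ 2 * complex.Re (v x)) + opK hu (re v).
      by rewrite -(opMRE hu v1).
    rewrite E1.
    have -> : re (B v) = (fun x => A x * complex.Re (v x) - (- b) * complex.Im (v x)) + S (re v).
      by rewrite /B re_add.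
    have -> : \sum_(i < m) re (L i v *: G i) = \sum_(i < m) l i (re v) *: g i.
      by apply: eq_bigr => i _; rewrite re_scale /= scaler0 subr0.
    move: (\sum_(i < m) _ *: _) (S (re v)) => W P; apply/funext => x.
    change (u x ^+ 2 * complex.Re (v x) + (P x + W x) -
      (a * complex.Re (v x) - b * complex.Im (v x)) =
      A x * complex.Re (v x) - (- b) * complex.Im (v x) + P x + W x).
    by rewrite /A; ring.
  rewrite im_add im_opp im_scale im_add im_sum.
  have -> : im (opM u v) = (fun x => u x ^+ 2 * complex.Im (v x)) + opK hu (im v).
    by rewrite -(opMRE hu v2).
  rewrite E2.
  have -> : im (B v) = (fun x => A x * complex.Im (v x) + (- b) * complex.Re (v x)) + S (im v).
    by rewrite /B im_add.
  have -> : \sum_(i < m) im (L i v *: G i) = \sum_(i < m) l i (im v) *: g i.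
    by apply: eq_bigr => i _; rewrite im_scale /= scaler0 add0r.
  move: (\sum_(i < m) _ *: _) (S (im v)) => W P; apply/funext => x.
  change (u x ^+ 2 * complex.Im (v x) + (P x + W x) -
    (a * complex.Im (v x) + b * complex.Re (v x)) =
    A x * complex.Im (v x) + (- b) * complex.Re (v x) + P x + W x).
  by rewrite /A; ring.
have Nge0 (v : R -> R[i]) : 0 <= H1_norm v by exact: sqrtr_ge0.
have BiH y : H1 y -> H1 (Bi y) by move=> /HBi[].
have BD v w : H1 v -> H1 w -> B (v + w) = B v + B w.
  by move=> hv hw; rewrite /B /Am cmulD cextD// addrACA.
have BZ c v : H1 v -> B (c *: v) = c *: B v.
  by move=> hv; rewrite /B /Am cmulZ cextZ// scalerDr.
have l0 i : l i 0 = 0.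
  have := l_lin i 1 0 0 (@H1R0 R) (@H1R0 R); rewrite scale1r addr0 mul1r => /eqP.
  by rewrite -subr_eq0 opprD addNKr oppr_eq0 => /eqP.
have lD i v w : H1R v -> H1R w -> l i (v + w) = l i v + l i w.
  by move=> hv hw; have := l_lin i 1 _ _ hv hw; rewrite scale1r mul1r.
have lZ i c v : H1R v -> l i (c *: v) = c * l i v.
  by move=> hv; have := l_lin i c _ _ hv (@H1R0 R); rewrite [l i (fun=> 0)]l0 !addr0.
have hz (k : R) (v : R -> R) : H1R v -> H1R (k *: v) by exact: (sip_Z semi_ip_H1R).
have LD i v w : H1 v -> H1 w -> L i (v + w) = L i v + L i w.
  move=> [v1 v2] [w1 w2]; rewrite /L re_add im_add.
  by rewrite (lD i _ _ v1 w1) (lD i _ _ v2 w2).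
have LZ i c v : H1 v -> L i (c *: v) = c * L i v.
  move=> [v1 v2]; rewrite /L re_scale im_scale -scaleNr.
  rewrite (lD i _ _ (hz _ _ v1) (hz _ _ v2)) (lD i _ _ (hz _ _ v2) (hz _ _ v1)).
  rewrite !(lZ i _ _ v1) !(lZ i _ _ v2) mulNr.
  by case: c.
(* The constant collects the bound of [l i], the bound [2 * C] of [Bi], and the factor 2 between
   [nc] and [H1_norm]. *)
have Lb i y : H1 y -> Normc.normc (L i (Bi y)) <= `|K| * (2 * C) * 2 * H1_norm y.
  move=> hy; have [[b1 b2] _ hb _] := HBi y hy.
  apply: le_trans (le_normc_ReIm _) _.
  apply: le_trans (lerD (lK i _ b1) (lK i _ b2)) _; rewrite -mulrDr -/(nc (Bi y)).
  rewrite -!mulrA ler_wpM2l//; apply: le_trans hb _; rewrite -mulrA ler_wpM2l//.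
  by rewrite ler_wpM2l//; exact: nc_le_norm.
exact: (@fredholm_of_finite_rank _ _ H1 H1_norm (fun v => opM u v - z *: v)
  B Bi m L G (`|K| * (2 * C) * 2)
  Nge0 H1_0 H1D H1Z TE HG HB BiH BBi BiB BD BZ LD LZ Lb).
Qed.

End fredholm.

(** * The solitary wave *)

Section AcOfDerive.
Context {R : realType}.
Local Notation mu := (@lebesgue_measure R).
Implicit Types (u g h : R -> R) (a b x y z : R).

Lemma is_derive_linear_approx u z (l e : R) : is_derive z 1 u l -> 0 < e ->
  exists2 d : R, 0 < d & forall y, `|y - z| < d -> `|u y - u z - l * (y - z)| <= e * `|y - z|.
Proof.
move=> du e0; have [du1 du2] := du.
have H : forall d, 'D_1 u z = d -> h^-1 *: (u (h *: (1 : R) + z) - u z) @[h --> 0^'] --> d.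
  by move=> d <-; exact: du1.
have /cvgrPdist_le/(_ e e0)[d /= d0 Hd] := H _ du2.
exists d => // y yz; have [->|yz0] := eqVneq y z.
  by rewrite !subrr mulr0 subr0 normr0 mulr0.
have y0 : y - z != 0 by rewrite subr_eq0.
have := Hd (y - z).
rewrite /ball_/= sub0r normrN => /(_ yz y0).
rewrite -[(y - z) *: 1]/((y - z) * 1) mulr1 subrK -[_ *: _]/((y - z)^-1 * (u y - u z)) => K.
have -> : u y - u z - l * (y - z) = - ((l - (y - z)^-1 * (u y - u z)) * (y - z)).
  by field.
by rewrite normrN normrM ler_wpM2r.
Qed.

Lemma small_increments_of_derive u g z (e : R) : locL1 g -> 0 < e -> is_derive z 1 u (g z) ->
  {for z, continuous g} ->
  exists2 d : R, 0 < d & forall x y, x <= z -> z <= y -> z - d < x -> y < z + d ->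
    `|u y - u x - \int[mu]_(t in `[x, y]) g t| <= e * (y - x).
Proof.
move=> lg e0 du cg; have e20 : 0 < e / 2 by rewrite divr_gt0.
have [d1 d10 H1] := is_derive_linear_approx du e20.
have /cvgrPdist_le/(_ _ e20)[d2 /= d20 H2] := cg.
exists (Num.min d1 d2); first by rewrite lt_min d10.
move=> x y xz zy xd yd.
have [m1 m2] : Num.min d1 d2 <= d1 /\ Num.min d1 d2 <= d2 by rewrite !ge_min !lexx orbT.
have xy := le_trans xz zy.
have ux : `|u x - u z - g z * (x - z)| <= e / 2 * `|x - z|.
  by apply: H1; rewrite ltr_norml; lra.
have uy : `|u y - u z - g z * (y - z)| <= e / 2 * `|y - z|.
  by apply: H1; rewrite ltr_norml; lra.
have ic c : mu.-integrable `[x, y] (EFin \o (fun=> c : R)).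
  exact: (locL1_cont (@cst_continuous _ _ c)).
have I : `|\int[mu]_(t in `[x, y]) (g t - g z)| <= e / 2 * (y - x).
  rewrite -int_itv_cst//.
  have ig : mu.-integrable `[x, y] (EFin \o (fun t => g t - g z)).
    exact: (integrableB _ (lg x y) (ic _)).
  apply: le_trans (le_normr_Rintegral _ ig) _ => //.
  apply: le_Rintegral => //; first exact: integrable_norm ig.
  move=> t /= /andP[]; rewrite !bnd_simp => xt ty.
  by rewrite distrC; apply: H2; rewrite /ball_/= ltr_norml; lra.
rewrite RintegralB// int_itv_cst// in I.
have -> : u y - u x - \int[mu]_(t in `[x, y]) g t =
  (u y - u z - g z * (y - z)) - (u x - u z - g z * (x - z))
   - (\int[mu]_(t in `[x, y]) g t - g z * (y - x)) by ring.
apply: le_trans (ler_normB _ _) _; apply: le_trans (lerD (ler_normB _ _) I) _.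
rewrite (ger0_norm (_ : 0 <= y - z)) ?subr_ge0// in uy.
rewrite (ler0_norm (_ : x - z <= 0)) ?subr_le0// in ux.
by apply: le_trans (lerD (lerD uy ux) (lexx _)) _; lra.
Qed.

(* The jumps of the comparison function [W] at the points of [s] allow for the
   increments of [u] there. *)
Lemma ac_of_derive u g (s : seq R) : continuous u -> locL1 g ->
  (forall z, z \notin s -> is_derive z 1 u (g z)) ->
  (forall z, z \notin s -> {for z, continuous g}) -> ac u g.
Proof.
move=> cu lg du cg; split=> // a b ab.
have [G [acG _]] := ac_primitive lg.
pose E x := u x - G x.
suff : E b = E a by rewrite /E -acG.2//; lra.
apply/eqP; rewrite -subr_eq0 -normr_le0.
(* Jumps by 1 on reaching [z] and by 1 on leaving it, so every nondegenerate interval that contains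
   [z], even as an endpoint, gains at least 1. *)
pose phi z x : R := (z <= x)%R%:R + (z < x)%R%:R.
have phi_mono z x y : x <= y -> phi z x <= phi z y.
  move=> xy; rewrite /phi lerD// ler_nat.
  - by case: (leP z x) => //= zx; rewrite (le_trans zx xy).
  - by case: (ltP z x) => //= zx; rewrite (lt_le_trans zx xy).
pose V x := x + \sum_(z <- s) phi z x.
apply: (@le_of_eps _ _ _ (V b - V a)) => e e0; rewrite add0r mulrBr.
have cE : continuous E by move=> x; apply: cvgB; [exact: cu|exact: (ac_continuous acG)].
apply: (@le_of_small_increments _ E (fun x => e * V x)) => // z _.
have Vmono x y : x <= y -> y - x <= V y - V x.
  move=> xy; rewrite /V.
  have : \sum_(w <- s) phi w x <= \sum_(w <- s) phi w y by apply: ler_sum => w _; exact: phi_mono.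
  lra.
have [zs|zs] := boolP (z \in s); last first.
  have [d d0 Hd] := small_increments_of_derive lg e0 (du z zs) (cg z zs).
  exists d => // x y /andP[_ xz] /andP[zy _] xd yd.
  have -> : E y - E x = u y - u x - \int[mu]_(t in `[x, y]) g t.
    by rewrite /E -acG.2 ?(le_trans xz zy)//; ring.
  apply: le_trans (Hd _ _ xz zy xd yd) _.
  by rewrite -mulrBr ler_pM2l// Vmono// (le_trans xz zy).
have e20 : 0 < e / 2 by rewrite divr_gt0.
have /cvgrPdist_le/(_ _ e20)[d /= d0 Hd] := cE z.
exists d => // x y /andP[_ xz] /andP[zy _] xd yd.
have [->|xy] := eqVneq x y; first by rewrite !subrr normr0.
have Vz : 1 <= V y - V x.
  have xy' : x < y by rewrite lt_neqAle xy (le_trans xz zy).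
  rewrite /V (perm_big _ (perm_to_rem zs)) /= big_cons.
  rewrite [X in _ - X](_ : _ = x + (phi z x + \sum_(w <- rem z s) phi w x)); last first.
    by rewrite (perm_big _ (perm_to_rem zs)) /= big_cons.
  have : \sum_(w <- rem z s) phi w x <= \sum_(w <- rem z s) phi w y.
    by apply: ler_sum => w _; apply: phi_mono; exact: ltW.
  suff : phi z x + 1 <= phi z y by move: xy'; lra.
  rewrite /phi zy (ltNge z x) xz/= addr0.
  move: (xz); rewrite le_eqVlt => /predU1P[E1|xz'].
    by rewrite -E1 lexx xy'.
  by rewrite (leNgt z x) xz'/= add0r lerDl.
have Ex : `|E z - E x| <= e / 2 by apply: Hd; rewrite /ball_/= ltr_norml; lra.
have Ey : `|E z - E y| <= e / 2 by apply: Hd; rewrite /ball_/= ltr_norml; lra.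
have -> : E y - E x = (E z - E x) - (E z - E y) by ring.
apply: le_trans (ler_normB _ _) _; apply: le_trans (lerD Ex Ey) _.
rewrite -mulrBr; apply: le_trans (_ : e * 1 <= _); first by lra.
by rewrite ler_pM2l.
Qed.

Lemma L1_exhaust h (J : set R) (s t : nat -> R) (B : R) : measurable_fun setT h ->
  (forall n m, (n <= m)%N -> s m <= s n) -> (forall n m, (n <= m)%N -> t n <= t m) ->
  (forall z, J z <-> exists n, s n <= z <= t n) -> (forall z, J z -> 0 <= h z) ->
  (forall n, (\int[mu]_(z in `[s n, t n]%classic) (h z)%:E <= B%:E)%E) ->
  L1 (fun z => h z * \1_J z).
Proof.
move=> mh ms mt HJ h0 HB.
have JE : J = \bigcup_n `[s n, t n]%classic.
  apply/seteqP; split=> z.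
    by move=> /HJ[n sn]; exists n => //=; rewrite in_itv.
  by move=> [n _ /=]; rewrite in_itv/= => sn; apply/HJ; exists n.
have mJ : measurable J by rewrite JE; apply: bigcup_measurable.
apply/(L1_setE _ mJ)/integrableP; split.
  by apply/measurable_EFinP; exact: measurable_funTS.
under eq_integral => z /set_mem Jz do rewrite /= ger0_norm ?h0//.
apply: le_lt_trans (_ : _ <= B%:E)%E _; last by rewrite ltry.
have cv : (\int[mu]_(z in `[s n, t n]%classic) (h z)%:E @[n --> \oo] -->
    \int[mu]_(z in \bigcup_n `[s n, t n]%classic) (h z)%:E)%E.
  apply: ge0_nondecreasing_set_cvg_integral => //.
  - move=> n m nm; apply/subsetPset => z /=; rewrite !in_itv/= => /andP[sz zt].
    by rewrite (le_trans (ms _ _ nm) sz) (le_trans zt (mt _ _ nm)).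
  - by move=> n; apply/measurable_EFinP; apply: measurable_funTS.
  - move=> i z /= zi; rewrite lee_fin h0//; apply/HJ; exists i; by move: zi; rewrite in_itv.
rewrite JE.
have -> : (\int[mu]_(z in \bigcup_n `[s n, t n]%classic) (h z)%:E = lim (\int[mu]_(z in `[s n, t n]%classic) (h z)%:E @[n --> \oo]))%E.
  by apply/esym/cvg_lim.
apply: lime_le; last by apply: nearW => n; exact: HB.
by apply: cvgP cv.
Qed.

(** The integral of [h] over a compact part of [J] is at most an increment of [F], hence at most
    [2 M], and the parts exhaust [J]. The majorant [f] may blow up at the ends of [J] as long as its
    primitive stays bounded. *)
Lemma L1_of_primitive h f F (J : set R) (s t : nat -> R) (M : R) :
  measurable_fun setT h ->
  (forall n m, (n <= m)%N -> s m <= s n) -> (forall n m, (n <= m)%N -> t n <= t m) ->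
  (forall z, J z <-> exists n, s n <= z <= t n) ->
  (forall z, J z -> [/\ is_derive z 1 F (f z), {for z, continuous f} & 0 <= h z <= f z]) ->
  (forall z, J z -> `|F z| <= M) ->
  L1 (fun z => h z * \1_J z).
Proof.
(* The maximum with 0 covers stages where the interval from [s n] to [t n] is empty or a point;
   there nothing is known about [M]. *)
move=> mh ms mt HJ H FM; apply: (@L1_exhaust _ _ s t (Num.max 0 (2 * M))) => //.
  by move=> z /H[_ _ /andP[]].
move=> n; have [st|ts] := ltP (s n) (t n); last first.
  move: ts; rewrite le_eqVlt => /predU1P[->|ts].
    by rewrite set_itv1 integral_set1// lee_fin le_max lexx.
  by rewrite set_itv_ge ?bnd_simp -?ltNge// integral_set0 lee_fin le_max lexx.
have HJn z : s n <= z <= t n -> J z by move=> ?; apply/HJ; exists n.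
have cf : {within `[s n, t n], continuous f}.
  apply: continuous_in_subspaceT => z /set_mem /=; rewrite in_itv/= => zn.
  by have [] := H _ (HJn _ zn).
have cF z : s n <= z <= t n -> {for z, continuous F}.
  move=> zn; have [[dF _] _ _] := H _ (HJn _ zn).
  by apply/differentiable_continuous/derivable1_diffP.
have sJ : s n <= s n <= t n by rewrite lexx ltW.
have tJ : s n <= t n <= t n by rewrite lexx ltW.
apply: le_trans (_ : \int[mu]_(z in `[s n, t n]%classic) (f z)%:E <= _)%E.
  apply: ge0_le_integral => //.
  - by move=> z /=; rewrite in_itv/= => zn; have [_ _ /andP[? _]] := H _ (HJn _ zn); rewrite lee_fin.
  - by apply/measurable_EFinP; apply: measurable_funTS.
  - by apply/measurable_EFinP; apply: subspace_continuous_measurable_fun.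
  - by move=> z /=; rewrite in_itv/= => zn; have [_ _ /andP[_ ?]] := H _ (HJn _ zn); rewrite lee_fin.
rewrite (continuous_FTC2 st cf (F := F)).
- rewrite -EFinB lee_fin le_max; apply/orP; right.
  have := FM _ (HJn _ sJ); have := FM _ (HJn _ tJ); rewrite !ler_norml; lra.
- split.
  + move=> z; rewrite in_itv/= => /andP[/ltW z1 /ltW z2].
    by have [[? _] _ _] := H _ (HJn z (introT andP (conj z1 z2))).
  + by apply: cvg_at_right_filter; exact: cF.
  + by apply: cvg_at_left_filter; exact: cF.
- move=> z; rewrite in_itv/= => /andP[/ltW z1 /ltW z2]; rewrite derive1E.
  by have [[_ ?] _ _] := H _ (HJn z (introT andP (conj z1 z2))).
Qed.

Lemma is_derive_reflect f z (l : R) : is_derive (- z) 1 f l ->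
  is_derive z 1 (fun x => f (- x)) (- l).
Proof.
move=> df; have dN : is_derive z 1 (-%R : R -> R) (- 1).
  exact: (@is_deriveN _ _ _ id z 1 1 (is_derive_id _ _)).
by have := @is_derive1_comp _ f -%R z _ _ df dN; rewrite mulrN1.
Qed.

Lemma L1_of_primitive_sym h f F (J : set R) (s t : nat -> R) (M : R) :
  measurable_fun setT h -> (forall z, h (- z) = h z) ->
  (forall n m, (n <= m)%N -> s m <= s n) -> (forall n m, (n <= m)%N -> t n <= t m) ->
  (forall z, J z <-> (exists n, s n <= z) /\ exists n, z <= t n) ->
  (forall z, J z -> [/\ is_derive z 1 F (f z), {for z, continuous f} & 0 <= h z <= f z]) ->
  (forall z, J z -> `|F z| <= M) ->
  L1 (fun z => h z * \1_J z) /\ L1 (fun z => h z * \1_J (- z)).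
Proof.
move=> mh hN ms mt HJ H FM.
have HJ' z : J z <-> exists n, s n <= z <= t n.
  rewrite HJ; split=> [[[n sn] [m tm]]|[n /andP[sn tn]]]; last by split; exists n.
  exists (maxn n m); rewrite (le_trans (ms _ _ (leq_maxl n m)) sn)/=.
  exact: le_trans tm (mt _ _ (leq_maxr n m)).
split; first exact: (@L1_of_primitive h f F J s t M).
have -> : (fun z => h z * \1_J (- z)) = (fun z => h z * \1_(-%R @^-1` J) z).
  by apply/funext => z; rewrite !indicE; congr (h z * _%:R); apply/asboolP/asboolP.
apply: (@L1_of_primitive h (fun z => f (- z)) (fun z => - F (- z)) _ (fun n => - t n) (fun n => - s n) M) => //.
- by move=> n m nm; rewrite lerN2 mt.
- by move=> n m nm; rewrite lerN2 ms.
- move=> z; rewrite /= HJ'; split=> -[n]; exists n; lra.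
- move=> z /= /H[dF cf hf]; split.
  + by rewrite -[f (- z)]opprK; exact: is_deriveN (is_derive_reflect dF).
  + by apply: (@continuous_comp _ _ _ -%R f) => //; exact: opp_continuous.
  + by rewrite -(hN z).
- by move=> z /= /FM; rewrite normrN.
Qed.

Lemma L1_of_primitive_oo h f F a b (M : R) :
  measurable_fun setT h -> (forall z, h (- z) = h z) ->
  (forall z, a < z < b -> [/\ is_derive z 1 F (f z), {for z, continuous f} & 0 <= h z <= f z]) ->
  (forall z, a < z < b -> `|F z| <= M) ->
  L1 (fun z => h z * \1_`]a, b[ z) /\ L1 (fun z => h z * \1_`]a, b[ (- z)).
Proof.
move=> mh hN H FM.
apply: (@L1_of_primitive_sym _ f F _ (fun n => a + n.+1%:R^-1) (fun n => b - n.+1%:R^-1) M) => //.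
- by move=> n m nm; rewrite lerD2l lef_pV2 ?posrE// ler_nat.
- by move=> n m nm; rewrite lerD2l lerN2 lef_pV2 ?posrE// ler_nat.
- move=> z /=; rewrite in_itv/=; split=> [/andP[az zb]|[[n an] [m bm]]].
    have [n /ltW Hn] := ltr_add_invr az; have [m /ltW Hm] := ltr_add_invr zb.
    by split; [exists n|exists m; rewrite lerBrDr].
  apply/andP; split.
    by apply: lt_le_trans an; rewrite ltrDl invr_gt0.
  by apply: le_lt_trans bm _; rewrite ltrBlDr ltrDl invr_gt0.
Qed.

Lemma L1_of_primitive_oy h f F a (M : R) :
  measurable_fun setT h -> (forall z, h (- z) = h z) ->
  (forall z, a < z -> [/\ is_derive z 1 F (f z), {for z, continuous f} & 0 <= h z <= f z]) ->
  (forall z, a < z -> `|F z| <= M) ->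
  L1 (fun z => h z * \1_`]a, +oo[ z) /\ L1 (fun z => h z * \1_`]a, +oo[ (- z)).
Proof.
move=> mh hN H FM.
apply: (@L1_of_primitive_sym _ f F _ (fun n => a + n.+1%:R^-1) (fun n => n%:R) M) => //.
- by move=> n m nm; rewrite lerD2l lef_pV2 ?posrE// ler_nat.
- by move=> n m nm; rewrite ler_nat.
- move=> z /=; rewrite in_itv/= andbT; split=> [az|[[n an] _]].
    have [n /ltW Hn] := ltr_add_invr az; split; first by exists n.
    exists (Num.truncn `|z|).+1; apply: le_trans (ler_norm z) _; apply: ltW.
    by have /andP[] := truncn_itv (normr_ge0 z).
  by apply: lt_le_trans an; rewrite ltrDl invr_gt0.
- by move=> z /=; rewrite in_itv/= andbT; exact: H.
- by move=> z /=; rewrite in_itv/= andbT; exact: FM.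
Qed.

End AcOfDerive.

(** * The integrals that define the profiles implicitly *)

Section TailIntegral.
Context {R : realType}.
Local Notation mu := (@lebesgue_measure R).
Variables (a b : R) (p : R -> R).
Hypotheses (ab : a < b) (p0 : forall u, a < u < b -> 0 < p u)
  (cp : forall u, a < u < b -> {for u, continuous p}).

(** The distance travelled while the profile falls from [c] to [u] with slope [q]. The cusp is
    defined by this integral; for the head, [head_integral] is the full length minus it. It may
    diverge at the lower end, as for the cusp. *)
Definition tail (c : R) (q : R -> R) (u : R) : R := \int[mu]_(x in `]u, c[) (q x)^-1.

Local Notation I := (tail b p).
Local Notation intb r := (mu.-integrable `]r, b[ (EFin \o (fun x => (p x)^-1))).

Lemma tail_split r x : intb r -> r <= x -> x < b ->
  I x = I r - \int[mu]_(t in `]r, x]) (p t)^-1.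
Proof.
move=> ir rx xb; rewrite /tail.
have := @Rintegral_itvB _ (fun x => (p x)^-1) (BRight r) (BLeft b) x ir.
by rewrite !bnd_simp => /(_ rx xb) <-.
Qed.

Lemma tail_derive r u : intb r -> a <= r -> r < u -> u < b ->
  is_derive u 1 I (- (p u)^-1).
Proof.
move=> ir ar ru ub.
have aub : a < u < b by rewrite (le_lt_trans ar ru).
pose F x := \int[mu]_(t in `]r, x]) (p t)^-1.
have [dF F'] : derivable F u 1 /\ derive1 F u = (p u)^-1.
  apply: (@continuous_FTC1 _ _ (BRight r) _ ((u + b) / 2)).
  - lra.
  - by apply: integrableS ir => //; apply: subset_itvl; rewrite bnd_simp; lra.
  - by [].
  - by apply: cvgV; [rewrite gt_eqF// p0|exact: cp].
have : is_derive u 1 (fun x => I r - F x) (0 - (p u)^-1).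
  have HF : is_derive u 1 F (p u)^-1 by apply: DeriveDef dF _; rewrite -derive1E.
  exact: is_deriveB.
rewrite sub0r; apply: near_eq_is_derive; near=> x.
rewrite (@tail_split r x)//; last by near: x; exact: lt_nbhsl.
by apply/ltW; near: x; exact: lt_nbhsr.
Unshelve. all: by end_near. Qed.

Lemma tail_ge0 u : a <= u -> 0 <= I u.
Proof.
move=> au; apply: Rintegral_ge0 => x /=; rewrite in_itv/= => /andP[ux xb].
by rewrite invr_ge0 ltW// p0// xb (le_lt_trans au ux).
Qed.

Lemma tail_small (r e : R) : intb r -> a <= r -> r < b -> 0 < e -> exists v, r < v < b /\ I v < e.
Proof.
move=> ir ar rb e0.
have lK : L1 (fun x => (p x)^-1 * \1_`]r, b[ x) by apply/(L1_setE _ (measurable_itv _)).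
have [d d0 Hd] := int_eps b (L1_loc lK) e0.
pose v := Num.max ((r + b) / 2) (b - d / 2).
have [v1 v2] : (r + b) / 2 <= v /\ b - d / 2 <= v by rewrite !le_max !lexx orbT.
have vb : v < b by rewrite gt_max; apply/andP; split; lra.
have rv : r < v by lra.
exists v; split; first by rewrite rv.
apply: le_lt_trans (Hd v b (ltW vb) (lexx b) _ _); [|lra|lra].
rewrite /tail (@int_indic _ `]v, b[)// (@int_indic _ `[v, b])//.
have l1 : L1 (fun x => (p x)^-1 * \1_`]v, b[ x).
  by apply/(L1_setE _ (measurable_itv _)); apply: integrableS ir => //; apply: subset_itvr; rewrite bnd_simp ltW.
have l2 : L1 (fun x => `|(p x)^-1 * \1_`]r, b[ x| * \1_`[v, b] x).
  by apply: L1_indic => //; exact: L1_norm.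
apply: le_Rintegral => // x _; rewrite !indicE.
have [/set_mem/=|nx] := boolP (x \in `]v, b[%classic); last by rewrite mulr0 mulr_ge0.
rewrite in_itv/= => /andP[vx xb]; rewrite mem_set/= ?in_itv/= ?xb ?(lt_trans rv vx)//.
by rewrite mem_set/= ?in_itv/= ?(ltW vx) ?(ltW xb)// !mulr1 ler_norm.
Qed.

Lemma tail_approx (x : R) : intb a -> x < I a -> exists v, a < v < b /\ x < I v.
Proof.
move=> ia xI.
have lK : L1 (fun x => (p x)^-1 * \1_`]a, b[ x) by apply/(L1_setE _ (measurable_itv _)).
have e0 : 0 < I a - x by rewrite subr_gt0.
have [d d0 Hd] := int_eps a (L1_loc lK) e0.
pose v := Num.min ((a + b) / 2) (a + d / 2).
have [v1 v2] : v <= (a + b) / 2 /\ v <= a + d / 2 by rewrite !ge_min !lexx orbT.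
have va : a < v by rewrite lt_min (midf_lt ab) ltrDl divr_gt0.
have vb : v < b by rewrite (le_lt_trans v1)// (midf_lt ab).
exists v; split; first by rewrite va.
rewrite (tail_split ia (ltW va) vb).
suff : \int[mu]_(t in `]a, v]) (p t)^-1 < I a - x by lra.
apply: le_lt_trans (Hd a v (lexx a) (ltW va) _ _); [|by rewrite ltrBlDr ltrDl|by rewrite (le_lt_trans v2)// ltrD2l; lra].
rewrite (@int_indic _ `]a, v])// (@int_indic _ `[a, v])//.
have l1 : L1 (fun x => (p x)^-1 * \1_`]a, v] x).
  by apply/(L1_setE _ (measurable_itv _)); apply: integrableS ia => //; apply: subset_itvl; rewrite bnd_simp.
have l2 : L1 (fun x => `|(p x)^-1 * \1_`]a, b[ x| * \1_`[a, v] x).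
  by apply: L1_indic => //; exact: L1_norm.
apply: le_Rintegral => // y _; rewrite !indicE.
have [/set_mem/=|nx] := boolP (y \in `]a, v]%classic); last by rewrite mulr0 mulr_ge0.
rewrite in_itv/= => /andP[ay yv]; rewrite mem_set/= ?in_itv/= ?ay ?(le_lt_trans yv vb)//.
by rewrite mem_set/= ?in_itv/= ?(ltW ay) ?yv// !mulr1 ler_norm.
Qed.

Hypothesis ib : forall r, a < r < b -> intb r.

Lemma tail_is_derive u : a < u < b -> is_derive u 1 I (- (p u)^-1).
Proof.
move=> /andP[au ub]; apply: (@tail_derive ((a + u) / 2)); try lra.
by apply: ib; apply/andP; split; lra.
Qed.

Lemma tail_continuous u : a < u < b -> {for u, continuous I}.
Proof.
by move=> /tail_is_derive[dI _]; apply/differentiable_continuous/derivable1_diffP.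
Qed.

Lemma tail_lt x y : a < x -> x < y -> y < b -> I y < I x.
Proof.
move=> ax xy yb.
have D u : u \in `]a, b[ -> derivable I u 1 by rewrite in_itv/= => /tail_is_derive[].
have D' u : u \in `]a, b[ -> derive1 I u < 0.
  rewrite in_itv/= => /[dup] /p0 ? /tail_is_derive[_ E].
  by rewrite derive1E E oppr_lt0 invr_gt0.
have cI : {in `]a, b[%classic, continuous I}.
  by move=> u /set_mem/=; rewrite in_itv/=; exact: tail_continuous.
have H := ltr0_derive1_lt_oo D D' cI.
apply: (H y x) => //; rewrite in_itv/=.
  by rewrite (lt_trans ax xy).
by rewrite ax (lt_trans xy yb).
Qed.

Lemma tail_gt0 u : a < u < b -> 0 < I u.
Proof.
move=> /andP[au ub]; apply: le_lt_trans (@tail_lt u ((u + b) / 2) _ _ _); try lra.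
by apply: tail_ge0; lra.
Qed.

Lemma tail_lt_total u : intb a -> a < u < b -> I u < I a.
Proof.
move=> ia /andP[au ub]; apply: lt_le_trans (@tail_lt ((a + u) / 2) u _ _ _) _; try lra.
rewrite (@tail_split a ((a + u) / 2)) //; try lra.
rewrite lerBlDr lerDl; apply: Rintegral_ge0 => x /=; rewrite in_itv/= => /andP[ax xu].
by rewrite invr_ge0 ltW// p0// ax/=; lra.
Qed.

End TailIntegral.

(** * Inversion of the implicit equation *)

Section Inverse.
Context {R : realType}.
Variables (a b : R) (L : \bar R) (p I U : R -> R).
Hypotheses (ab : a < b) (p0 : forall u, a < u < b -> 0 < p u)
  (dI : forall u, a < u < b -> is_derive u 1 I (- (p u)^-1))
  (Ilt : forall x y, a < x -> x < y -> y < b -> I y < I x)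
  (I0 : forall u, a < u < b -> 0 < I u /\ ((I u)%:E < L)%E)
  (Ismall : forall e : R, 0 < e -> exists v, a < v < b /\ I v < e)
  (Ibig : forall x : R, (x%:E < L)%E -> exists v, a < v < b /\ x < I v).

(* [U] decreases from [b] at [0] to [a] at [L] and solves [U' = - p U]. *)
Definition profile (U : R -> R) :=
  [/\ forall x : R, 0 < x -> (x%:E < L)%E -> a < U x < b /\ is_derive x 1 U (- p (U x)),
      forall e : R, 0 < e -> exists2 d : R, 0 < d &
        forall x : R, 0 < x -> (x%:E < L)%E -> x < d -> b - e < U x &
      forall e : R, 0 < e -> exists d : R, [/\ 0 < d, (d%:E < L)%E &
        forall x : R, d < x -> (x%:E < L)%E -> U x < a + e]].

Lemma direct_continuous u : a < u < b -> {for u, continuous I}.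
Proof.
by move=> /dI[dI' _]; apply/differentiable_continuous/derivable1_diffP.
Qed.

Lemma inverse_ex x : 0 < x -> (x%:E < L)%E -> exists u, a < u < b /\ I u = x.
Proof.
move=> x0 xL; have [v [vab vx]] := Ismall x0; have [w [wab wx]] := Ibig xL.
have wv : w < v.
  rewrite ltNge; apply/negP; rewrite le_eqVlt => /predU1P[E|vw].
    by have := lt_trans vx wx; rewrite E ltxx.
  have := Ilt (andP vab).1 vw (andP wab).2; apply/negP; rewrite -leNgt ltW//.
  exact: lt_trans vx wx.
have [c cwv Ic] : exists2 c, c \in `[w, v] & I c = x.
  apply: IVT; first exact: ltW.
    apply: continuous_in_subspaceT => u /set_mem/=; rewrite in_itv/= => /andP[wu uv].
    apply: direct_continuous; rewrite (lt_le_trans (andP wab).1 wu) (le_lt_trans uv (andP vab).2)//.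
  by rewrite ge_min le_max (ltW vx) (ltW wx) orbT.
exists c; split=> //; move: cwv; rewrite in_itv/= => /andP[wc cv].
by rewrite (lt_le_trans (andP wab).1 wc) (le_lt_trans cv (andP vab).2).
Qed.

Hypothesis UI : forall x : R, 0 < x -> (x%:E < L)%E -> a < U x < b /\ I (U x) = x.

Lemma inverse_lt x v : 0 < x -> (x%:E < L)%E -> a < v < b -> (x < I v) = (v < U x).
Proof.
move=> x0 xL /andP[av vb]; have [/andP[aU Ub] IU] := UI x0 xL.
apply/idP/idP => [xI|vU]; last by rewrite -[ltLHS]IU; exact: Ilt.
rewrite ltNge; apply/negP; rewrite le_eqVlt => /predU1P[E|Uv].
  by move: xI; rewrite -E IU ltxx.
by have := Ilt aU Uv vb; rewrite IU => /(lt_trans xI); rewrite ltxx.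
Qed.

(** The differential equation is the inverse function rule. The limits at both ends follow from
    monotonicity: comparing [x] with [I v] is comparing [v] with [U x], for a test value [v] close
    to [b] or to [a]. *)
Lemma inverse_profile : profile U.
Proof.
split.
- move=> x x0 xL; have [Uab IU] := UI x0 xL; split=> //.
  have near_ab : \forall v \near U x, a < v < b.
    have /andP[aU Ub] := Uab.
    by apply: filterS2 (lt_nbhsr aU) (lt_nbhsl Ub) => v -> ->.
  rewrite -{1}IU -[p (U x)]invrK -invrN.
  apply: (@is_derive_inverse _ I U); last first.
  + by rewrite oppr_eq0 invr_eq0 gt_eqF// p0.
  + exact: dI.
  + by near=> v; apply: direct_continuous; near: v.
  + near=> v; have vab : a < v < b by near: v.
    have [Iv0 IvL] := I0 vab; have [Uvab IUv] := UI Iv0 IvL.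
    apply/eqP; rewrite eq_le !leNgt -inverse_lt// ltxx/=.
    apply/negP => Uv; have := Ilt (andP Uvab).1 Uv (andP vab).2.
    by rewrite IUv ltxx.
- move=> e e0; pose v := Num.max ((a + b) / 2) (b - e).
  have vab : a < v < b by rewrite lt_max gt_max !(midf_lt ab)/= ltrBlDr ltrDl.
  have [Iv0 IvL] := I0 vab; exists (I v) => // x x0 xL; rewrite inverse_lt//.
  by apply: le_lt_trans; rewrite le_max lexx orbT.
- move=> e e0; pose v := Num.min ((a + b) / 2) (a + e).
  have vab : a < v < b by rewrite lt_min gt_min !(midf_lt ab)/= ltrDl e0.
  have [Iv0 IvL] := I0 vab; exists (I v); split=> // x xI xL.
  have x0 := lt_trans Iv0 xI.
  apply: (@lt_le_trans _ _ v); last by rewrite ge_min lexx orbT.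
  have [Uab IU] := UI x0 xL; rewrite ltNge; apply/negP.
  rewrite le_eqVlt => /predU1P[E|vU]; first by move: xI; rewrite E IU ltxx.
  by have := Ilt (andP vab).1 vU (andP Uab).2; rewrite IU => /(lt_trans xI); rewrite ltxx.
Unshelve. all: by end_near. Qed.

End Inverse.

(** * The slopes as functions of the height, and their logarithmic majorants *)

Section Slopes.
Context {R : realType}.
Implicit Types (x y c m : R).

(** Its square comes from the first integral of [u'' = u / (1 - u^2)], obtained by multiplying by
    [2 u']. The constant of integration is 0 for the decaying tail and [2 c] in [head_slope]. *)
Definition cusp_slope (x : R) : R := Num.sqrt (- ln (1 - x ^+ 2)).

Definition head_slope (c x : R) : R := Num.sqrt (2 * c - ln (x ^+ 2 - 1)).

Lemma sqrt_le1D y : 0 <= y -> Num.sqrt y <= 1 + y.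
Proof.
move=> y0; have := sqr_ge0 (Num.sqrt y - 1); rewrite sqrrB1 sqr_sqrtr//.
have := sqrtr_ge0 y; lra.
Qed.

Lemma ln_continuous x : 0 < x -> {for x, continuous (@ln R)}.
Proof. by move=> x0; apply: continuous_ln. Qed.

Lemma xlnx_bound y : 0 < y -> `|y * ln y| <= 1 + y ^+ 2.
Proof.
move=> y0; have h1 : ln y <= y - 1.
  by have := @le_ln1Dx R (y - 1); rewrite addrCA subrr addr0; apply; rewrite ltrBrDr addNr.
have h2 : - ln y <= y^-1 - 1.
  rewrite -lnV ?posrE//; have := @le_ln1Dx R (y^-1 - 1).
  by rewrite addrCA subrr addr0; apply; rewrite ltrBrDr addNr invr_gt0.
have h3 : y * - ln y <= 1 - y.
  by apply: le_trans (ler_wpM2l (ltW y0) h2) _; rewrite mulrBr divff ?gt_eqF// mulr1.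
have h4 := ler_wpM2l (ltW y0) h1.
rewrite ler_norml; nra.
Qed.

Lemma is_derive_xlnx y : 0 < y -> is_derive y 1 (fun y => y * ln y) (1 + ln y).
Proof.
move=> y0; have dl := is_derive1_ln y0.
have := is_deriveM (is_derive_id y 1) dl.
by rewrite -![_ *: _]/(_ * _) mulfV ?gt_eqF// mulr1.
Qed.

Lemma cusp_arg x : 0 < x -> x < 1 -> 0 < 1 - x ^+ 2.
Proof. by move=> x0 x1; nra. Qed.

Lemma cusp_slope_ge x : 0 < x -> x < 1 -> x <= cusp_slope x.
Proof.
move=> x0 x1; apply: (@le_trans _ _ (Num.sqrt (x ^+ 2))).
  by rewrite sqrtr_sqr gtr0_norm.
apply: ler_wsqrtr.
have := @le_ln1Dx R (- x ^+ 2); have := cusp_arg x0 x1; lra.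
Qed.

Lemma cusp_slope_gt0 x : 0 < x -> x < 1 -> 0 < cusp_slope x.
Proof. by move=> x0 x1; exact: lt_le_trans x0 (cusp_slope_ge x0 x1). Qed.

Lemma cusp_slope_continuous x : 0 < x -> x < 1 -> {for x, continuous cusp_slope}.
Proof.
move=> x0 x1; apply: (@continuous_comp _ _ _ (fun x => - ln (1 - x ^+ 2)) Num.sqrt); last exact: sqrt_continuous.
apply: cvgN; apply: (@continuous_comp _ _ _ (fun x => 1 - x ^+ 2) (@ln R)).
  by apply: cvgB; [exact: cvg_cst|exact: exprn_continuous].
exact: ln_continuous (cusp_arg x0 x1).
Qed.

(** A primitive of [1 - ln (1 - x)], which dominates the slope. Since the derivative of [u] is minus
    the slope, the square of the slope is at most minus the derivative of [cusp_potential] along the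
    wave, and the potential stays bounded up to the cusp because [y ln y] does. *)
Definition cusp_potential x := (1 - x) * ln (1 - x) + 2 * x.

Lemma cusp_potential_derive x : x < 1 -> is_derive x 1 cusp_potential (1 - ln (1 - x)).
Proof.
move=> x1; have x0 : 0 < 1 - x by rewrite subr_gt0.
have d1 : is_derive x 1 (fun x => 1 - x) (0 - 1) by exact: is_deriveB.
have d2 := @is_derive1_comp _ (fun y => y * ln y) (fun x => 1 - x) x _ _ (is_derive_xlnx x0) d1.
have d3 : is_derive x 1 (fun x => 2 * x) (2 * 1) by exact: (is_deriveZ 2 (is_derive_id x 1)).
have := is_deriveD d2 d3; rewrite (_ : (1 + ln (1 - x)) * (0 - 1) + 2 * 1 = 1 - ln (1 - x)) //; ring.
Qed.

Lemma cusp_potential_bound x : 0 < x -> x < 1 -> `|cusp_potential x| <= 4.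
Proof.
move=> x0 x1; rewrite /cusp_potential.
have y0 : 0 < 1 - x by rewrite subr_gt0.
have := xlnx_bound y0; rewrite !ler_norml; set w := _ * ln _; nra.
Qed.

Lemma cusp_slope_le x : 0 < x -> x < 1 -> cusp_slope x <= 1 - ln (1 - x).
Proof.
move=> x0 x1; have h := cusp_arg x0 x1; rewrite /cusp_slope.
have h1 : ln (1 - x) <= ln (1 - x ^+ 2) by rewrite ler_ln ?posrE ?subr_gt0//; nra.
have h2 : ln (1 - x ^+ 2) <= 0 by rewrite ln_le0//; nra.
by apply: le_trans (sqrt_le1D _) _; lra.
Qed.

Section Head.
Variables (c : R).
Local Notation m := (Num.sqrt (1 + expR (2 * c))).

Lemma head_top_sqr : m ^+ 2 = 1 + expR (2 * c).
Proof. by rewrite sqr_sqrtr// addr_ge0// expR_ge0. Qed.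

Lemma head_top_gt1 : 1 < m.
Proof.
have := head_top_sqr; have := expR_gt0 (2 * c); have := sqrtr_ge0 (1 + expR (2 * c)).
set t := Num.sqrt _; nra.
Qed.

Lemma head_arg x : 1 < x -> 0 < x ^+ 2 - 1.
Proof. by move=> x1; nra. Qed.

Lemma head_ln x : 1 < x -> x < m -> ln (x ^+ 2 - 1) < 2 * c.
Proof.
move=> x1 xm; rewrite -[ltRHS]expRK ltr_ln ?posrE ?expR_gt0 ?head_arg//.
rewrite ltrBlDl -head_top_sqr; nra.
Qed.

Lemma head_slope_gt0 x : 1 < x -> x < m -> 0 < head_slope c x.
Proof. by move=> x1 xm; rewrite sqrtr_gt0 subr_gt0 head_ln. Qed.

Lemma head_slope_continuous x : 1 < x -> {for x, continuous (head_slope c)}.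
Proof.
move=> x1; apply: (@continuous_comp _ _ _ (fun x => 2 * c - ln (x ^+ 2 - 1)) Num.sqrt); last exact: sqrt_continuous.
apply: cvgB; first exact: cvg_cst.
apply: (@continuous_comp _ _ _ (fun x => x ^+ 2 - 1) (@ln R)).
  by apply: cvgB; [exact: exprn_continuous|exact: cvg_cst].
exact: ln_continuous (head_arg x1).
Qed.

(** The counterpart of [cusp_potential] above 1, with derivative [1 + 2 * c - ln (x - 1)]. *)
Definition head_potential x := (2 + 2 * c) * x - (x - 1) * ln (x - 1).

Lemma head_potential_derive x : 1 < x -> is_derive x 1 head_potential (1 + 2 * c - ln (x - 1)).
Proof.
move=> x1; have x0 : 0 < x - 1 by rewrite subr_gt0.
have d1 : is_derive x 1 (fun x => x - 1) (1 - 0) by exact: is_deriveB.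
have d2 := @is_derive1_comp _ (fun y => y * ln y) (fun x => x - 1) x _ _ (is_derive_xlnx x0) d1.
have d3 : is_derive x 1 (fun x => (2 + 2 * c) * x) ((2 + 2 * c) * 1) by exact: (is_deriveZ (2 + 2 * c) (is_derive_id x 1)).
have := is_deriveB d3 d2; rewrite (_ : (2 + 2 * c) * 1 - (1 + ln (x - 1)) * (1 - 0) = 1 + 2 * c - ln (x - 1)) //; ring.
Qed.

Lemma head_potential_bound x : 1 < x -> x < m ->
  `|head_potential x| <= (2 + 2 * `|c|) * m + (1 + m ^+ 2).
Proof.
move=> x1 xm; rewrite /head_potential; apply: le_trans (ler_normB _ _) _; apply: lerD.
  rewrite normrM; apply: ler_pM => //; last by rewrite ger0_norm ?ltW// (lt_trans _ x1).
  by apply: le_trans (ler_normD _ _) _; rewrite normrM !normr_nat.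
have y0 : 0 < x - 1 by rewrite subr_gt0.
apply: le_trans (xlnx_bound y0) _; rewrite lerD2l.
by rewrite lerXn2r ?nnegrE ?sqrtr_ge0 ?(ltW y0)//; move: x1 xm; set t := Num.sqrt _; lra.
Qed.

Lemma head_slope_le x : 1 < x -> x < m -> head_slope c x <= 1 + 2 * c - ln (x - 1).
Proof.
move=> x1 xm; rewrite /head_slope.
have h1 : ln (x - 1) <= ln (x ^+ 2 - 1) by rewrite ler_ln ?posrE ?subr_gt0 ?head_arg//; nra.
have h2 := head_ln x1 xm.
by apply: le_trans (sqrt_le1D _) _; lra.
Qed.

End Head.
End Slopes.

Lemma near_eq_continuous {R : realType} (f g : R -> R) (x : R) :
  (\forall y \near x, f y = g y) -> {for x, continuous f} -> {for x, continuous g}.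
Proof.
move=> fg cf; rewrite /prop_for /continuous_at -(nbhs_singleton fg).
by apply: cvg_trans cf; apply: near_eq_cvg; apply: filterS fg => y ->.
Qed.

Section IndicatorSums.
Context {R : realType}.
Implicit Types (A B : set R) (x : R).

Lemma indic_ge0 A x : 0 <= \1_A x :> R.
Proof. by rewrite indicE. Qed.

Lemma indic_in A x : A x -> \1_A x = 1 :> R.
Proof. by move=> Ax; rewrite indicE mem_set. Qed.

Lemma le_sum_l (a b : R) : 1 <= a -> 0 <= b -> 1 <= a + b.
Proof. lra. Qed.

Lemma le_sum_r (a b : R) : 0 <= a -> 1 <= b -> 1 <= a + b.
Proof. lra. Qed.

End IndicatorSums.

(** * The wave glued from a head and two cusped tails *)

Section Wave.
Context {R : realType}.
Local Notation mu := (@lebesgue_measure R).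
Variables (l m c : R) (H U : R -> R).
Hypotheses (l0 : 0 <= l) (m1 : 1 <= m) (H0 : H 0 = m) (Hl : H l = 1)
  (mE : 0 < l -> m = Num.sqrt (1 + expR (2 * c)))
  (profileH : 0 < l -> profile 1 m l%:E (head_slope c) H)
  (profileU : profile 0 1 +oo%E cusp_slope U).
Implicit Types (x y z e : R).

(** The profile on the half-line. With [l = 0] and [m = 1] there is no head, and the hypotheses
    about it are void; this is the cusped soliton. *)
Let V x : R := if x <= l then H x else U (x - l).

Definition wave x : R := V `|x|.

Local Notation u := wave.

Lemma V_head x : 0 < x -> x < l ->
  1 < V x < m /\ is_derive x 1 V (- head_slope c (V x)).
Proof.
move=> x0 xl; have [P _ _] := profileH (lt_trans x0 xl).
have [Hx dH] := P x x0 xl.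
have -> : V x = H x by rewrite /V ltW.
split=> //; apply: (near_eq_is_derive _ dH); near=> y; rewrite /V ltW//.
by near: y; exact: lt_nbhsl.
Unshelve. all: by end_near. Qed.

Lemma V_cusp x : l < x -> 0 < V x < 1 /\ is_derive x 1 V (- cusp_slope (V x)).
Proof.
move=> lx; have [P _ _] := profileU.
have [Hx dU] := P (x - l) (etrans (subr_gt0 _ _) lx) (ltry _).
have -> : V x = U (x - l) by rewrite /V leNgt lx.
split=> //.
have d1 : is_derive x 1 (fun x => x - l) (1 - 0) by exact: is_deriveB.
have := @is_derive1_comp _ U (fun x => x - l) x _ _ dU d1.
rewrite subr0 mulr1; apply: near_eq_is_derive; near=> y.
rewrite /V leNgt; suff -> : l < y by [].
by near: y; exact: lt_nbhsr.
Unshelve. all: by end_near. Qed.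

Lemma V_at0 : V 0 = m.
Proof. by rewrite /V l0. Qed.

Lemma V_at_length : V l = 1.
Proof. by rewrite /V lexx. Qed.

Lemma V_range x : 0 <= x -> 0 < V x <= m.
Proof.
rewrite le_eqVlt => /predU1P[<-|x0]; first by rewrite V_at0 lexx andbT (lt_le_trans _ m1).
have [xl|lx|->] := ltgtP x l.
- by have [/andP[V1 Vm] _] := V_head x0 xl; rewrite (lt_trans _ V1)//= ltW.
- by have [/andP[V1 Vm] _] := V_cusp lx; rewrite V1 (le_trans (ltW Vm) m1).
- by rewrite V_at_length ltr01.
Qed.

Lemma V_continuous_l e : 0 < e -> exists2 d : R, 0 < d &
  forall x, 0 <= x -> `|x - l| < d -> `|V x - V l| < e.
Proof.
move=> e0; have [_ PU _] := profileU; have [d1 d10 H1] := PU e e0.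
have [d2 d20 H2] : exists2 d : R, 0 < d & forall x, 0 < x -> x < l -> l - d < x -> V x < 1 + e.
  have [ll|l0'] := ltP 0 l; last by exists 1 => // x x0 xl; have := lt_trans x0 xl; rewrite ltNge l0'.
  have [_ _ PH] := profileH ll; have [d [d0 dl Hd]] := PH e e0.
  exists (l - d); first by rewrite subr_gt0.
  by move=> x x0 xl dx; rewrite /V ltW//; apply: Hd => //; lra.
(* The bound [l] keeps [x] positive, where the head profile applies; for [l = 0] no point lies to
   the left. *)
exists (if 0 < l then Num.min l (Num.min d1 d2) else d1).
  by case: ifP => // ll; rewrite !lt_min ll d10 d20.
move=> x x0 xl; rewrite V_at_length.
have xl1 : `|x - l| < d1.
  by apply: lt_le_trans xl _; case: ifP => // _; rewrite !ge_min lexx !orbT.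
have [xl'|lx|->] := ltgtP x l; last by rewrite V_at_length subrr normr0.
- have ll := le_lt_trans x0 xl'; move: xl; rewrite ll !lt_min => /and3P[xl _ xd].
  have x0' : 0 < x by move: xl; rewrite ltr_norml; lra.
  have [/andP[V1 _] _] := V_head x0' xl'.
  have : V x < 1 + e by apply: H2 => //; move: xd; rewrite ltr_norml; lra.
  by rewrite ltr_norml; lra.
- have [/andP[_ V1] _] := V_cusp lx.
  have : 1 - e < V x.
    rewrite /V leNgt lx/=; apply: H1; rewrite ?subr_gt0 ?ltry//.
    by move: xl1; rewrite ltr_norml; lra.
  by rewrite ltr_norml; lra.
Qed.

Lemma V_continuous_0 e : 0 < e -> exists2 d : R, 0 < d &
  forall x, 0 <= x -> `|x| < d -> `|V x - V 0| < e.
Proof.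
move=> e0; have [ll|l0'] := ltP 0 l; last first.
  have E : l = 0 by apply/eqP; rewrite eq_le l0 l0'.
  have [d d0 Hd] := V_continuous_l e0; exists d => // x x0 xd.
  by rewrite E in Hd; apply: Hd => //; rewrite subr0.
have [_ PH _] := profileH ll; have [d d0 Hd] := PH e e0.
exists (Num.min l d); first by rewrite lt_min ll.
move=> x; rewrite le_eqVlt => /predU1P[<-|x0]; first by rewrite subrr normr0.
rewrite gtr0_norm// lt_min => /andP[xl xd].
have [/andP[_ Vm] _] := V_head x0 xl; rewrite V_at0.
have : m - e < V x by rewrite /V (ltW xl); exact: Hd.
by rewrite ltr_norml; lra.
Qed.

Lemma waveN x : u (- x) = u x.
Proof. by rewrite /wave normrN. Qed.

(** The height alone decides which slope applies, as the wave exceeds 1 exactly for [|x| < l]. *)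
Let q x := if x <= 1 then cusp_slope x else head_slope c x.

Lemma V_derive x : 0 < x -> x != l -> is_derive x 1 V (- q (V x)).
Proof.
move=> x0; case: ltgtP => // [xl|lx] _.
  have [/andP[V1 _]] := V_head x0 xl.
  by rewrite /q leNgt V1.
by have [/andP[_ V1]] := V_cusp lx; rewrite /q ltW.
Qed.

Lemma wave_derive_pos x : 0 < x -> x != l -> is_derive x 1 u (- q (u x)).
Proof.
move=> x0 xl; rewrite /wave gtr0_norm//.
apply: (near_eq_is_derive _ (V_derive x0 xl)); near=> y; rewrite /wave gtr0_norm//.
by near: y; exact: lt_nbhsr.
Unshelve. all: by end_near. Qed.

Let g x := - (Num.sg x * q (u x)).

Lemma wave_derive x : x \notin [:: 0; l; - l] -> is_derive x 1 u (g x).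
Proof.
rewrite !inE !negb_or => /and3P[x0 xl xl']; rewrite /g.
move: x0; rewrite neq_lt => /orP[x0|x0].
  rewrite ltr0_sg// mulN1r -waveN.
  have d := @wave_derive_pos (- x); rewrite oppr_gt0 eqr_oppLR in d.
  have := is_derive_reflect (d x0 xl').
  by have -> : (fun x => u (- x)) = u by apply/funext => y; exact: waveN.
by rewrite gtr0_sg// mul1r; exact: wave_derive_pos.
Qed.

Lemma wave_continuous : continuous u.
Proof.
have near_continuous x (x0 : R) : 0 <= x0 -> `|x| = x0 ->
    (forall e, 0 < e -> exists2 d : R, 0 < d & forall y, 0 <= y -> `|y - x0| < d -> `|V y - V x0| < e) ->
    {for x, continuous u}.
  move=> x00 xx0 HV; apply/cvgrPdist_lt => e e0; have [d d0 Hd] := HV e e0.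
  exists d => // y /= xy; rewrite distrC /wave xx0; apply: Hd => //.
  by rewrite -xx0; apply: le_lt_trans (ler_dist_dist _ _) _; rewrite distrC.
move=> x; have [|xs] := boolP (x \in [:: 0; l; - l]); last first.
  by have [dx _] := wave_derive xs; apply/differentiable_continuous/derivable1_diffP.
rewrite !inE => /or3P[] /eqP->.
- apply: (near_continuous _ 0) => //; first exact: normr0.
  by move=> e /V_continuous_0[d d0 Hd]; exists d => // y y0; rewrite subr0; exact: Hd.
- by apply: (near_continuous _ l) => //; [rewrite ger0_norm|exact: V_continuous_l].
- by apply: (near_continuous _ l) => //; [rewrite normrN ger0_norm|exact: V_continuous_l].
Qed.

Lemma wave_head x : 0 < x -> x < l -> 1 < u x < m.
Proof. by move=> x0 xl; rewrite /wave gtr0_norm//; have [] := V_head x0 xl. Qed.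

Lemma wave_cusp x : l < x -> 0 < u x < 1.
Proof.
by move=> lx; rewrite /wave ger0_norm ?(le_trans l0 (ltW lx))//; have [] := V_cusp lx.
Qed.

Lemma q_continuous_pos x : 0 < x -> x != l -> {for x, continuous (fun x => q (u x))}.
Proof.
move=> x0; case: ltgtP => // [xl|lx] _.
  have /andP[u1 um] := wave_head x0 xl.
  apply: (@continuous_comp _ _ _ u q); first exact: wave_continuous.
  have cs := @head_slope_continuous _ c _ u1.
  apply: near_eq_continuous cs; near=> y.
  rewrite /q leNgt; suff -> : 1 < y by [].
  by near: y; exact: lt_nbhsr.
have /andP[u0 u1] := wave_cusp lx.
apply: (@continuous_comp _ _ _ u q); first exact: wave_continuous.
have cs := cusp_slope_continuous u0 u1.
apply: near_eq_continuous cs; near=> y.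
by rewrite /q ltW//; near: y; exact: lt_nbhsl.
Unshelve. all: by end_near. Qed.

Lemma wave_slope_continuous x : x \notin [:: 0; l; - l] -> {for x, continuous g}.
Proof.
rewrite !inE !negb_or => /and3P[x0 xl xl'].
move: x0; rewrite neq_lt => /orP[x0|x0].
  have cq : {for - x, continuous (fun x => q (u x))}.
    by apply: q_continuous_pos; rewrite ?oppr_gt0// eqr_oppLR.
  have : {for x, continuous (fun x => q (u (- x)))}.
    by apply: (@continuous_comp _ _ _ -%R (fun x => q (u x))) => //; exact: opp_continuous.
  apply: near_eq_continuous; near=> y; rewrite /g ltr0_sg ?waveN ?mulN1r ?opprK//.
  by near: y; exact: lt_nbhsl.
have : {for x, continuous (fun x => - q (u x))} by apply: cvgN; exact: q_continuous_pos.
apply: near_eq_continuous; near=> y; rewrite /g gtr0_sg ?mul1r//.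
by near: y; exact: lt_nbhsr.
Unshelve. all: by end_near. Qed.

Lemma wave_slope_measurable : measurable_fun setT g.
Proof.
have mu' : measurable_fun setT u by apply: continuous_measurable_fun; exact: wave_continuous.
have mln : measurable_fun setT (@ln R) by exact: measurable_ln.
have msqrt : measurable_fun setT (@Num.sqrt R).
  by apply: continuous_measurable_fun; exact: sqrt_continuous.
have mq : measurable_fun setT q.
  apply: measurable_fun_ifT.
  - exact: measurable_fun_ler.
  - apply: (measurableT_comp msqrt); apply: measurable_funN; apply: (measurableT_comp mln).
    by apply: measurable_funB => //; exact: measurable_funX.
  - apply: (measurableT_comp msqrt); apply: measurable_funB => //; apply: (measurableT_comp mln).
    by apply: measurable_funB => //; exact: measurable_funX.
have msg : measurable_fun setT (@Num.sg R).
  have -> : @Num.sg R = (fun x => if 0 < x then 1 else if x < 0 then -1 else 0).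
    by apply/funext => x; case: (sgrP x).
  apply: measurable_fun_ifT => //; first exact: measurable_fun_ltr.
  by apply: measurable_fun_ifT => //; exact: measurable_fun_ltr.
by apply: measurable_funN; apply: measurable_funM => //; exact: measurableT_comp.
Qed.

Lemma wave_ge0 x : 0 < u x <= m.
Proof. exact: V_range. Qed.

Lemma wave_cusp_slope x : l < x -> q (u x) = cusp_slope (u x).
Proof. by move=> /wave_cusp/andP[_ u1]; rewrite /q ltW. Qed.

Lemma wave_head_slope x : 0 < x -> x < l -> q (u x) = head_slope c (u x).
Proof. by move=> x0 xl; have /andP[u1 _] := wave_head x0 xl; rewrite /q leNgt u1. Qed.

Lemma wave_continuous_comp (f : R -> R) x : {for u x, continuous f} -> {for x, continuous (fun x => f (u x))}.
Proof. by move=> cf; apply: (@continuous_comp _ _ _ u f) => //; exact: wave_continuous. Qed.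

Lemma wave_derive_comp (f : R -> R) (d : R) x : 0 < x -> x != l -> is_derive (u x) 1 f d ->
  is_derive x 1 (fun x => - f (u x)) (d * q (u x)).
Proof.
move=> x0 xl df; have := @is_derive1_comp _ f u x _ _ df (wave_derive_pos x0 xl).
by rewrite mulrN => /is_deriveN; rewrite opprK.
Qed.

(** On the tail the slope is at least the height, so [u^2] is at most [u] times the slope, which is
    the derivative of [- u^2 / 2]. *)
Lemma wave_sqr_cusp : L1 (fun x => u x ^+ 2 * \1_`]l, +oo[ x) /\
  L1 (fun x => u x ^+ 2 * \1_`]l, +oo[ (- x)).
Proof.
apply: (@L1_of_primitive_oy _ (fun x => u x ^+ 2) (fun x => u x * q (u x))
  (fun x => - ((1 / 2) * (u x * u x))) l 1).
- by apply: measurable_funX; apply: continuous_measurable_fun; exact: wave_continuous.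
- by move=> x; rewrite waveN.
- move=> x lx; have x0 := le_lt_trans l0 lx; have xl : x != l by rewrite gt_eqF.
  have /andP[u0 u1] := wave_cusp lx; split.
  + apply: (@wave_derive_comp (fun y => (1 / 2) * (y * y))) => //.
    have := is_deriveZ (1 / 2) (is_deriveM (is_derive_id (u x) 1) (is_derive_id (u x) 1)).
    rewrite -![_ *: _]/(_ * _) !mulr1 (_ : 1 / 2 * (u x + u x) = u x)//; by field.
  + by apply: cvgM; [exact: wave_continuous|exact: q_continuous_pos].
  + by rewrite sqr_ge0 expr2 ler_pM2l// wave_cusp_slope// cusp_slope_ge.
- move=> x lx; have /andP[u0 u1] := wave_cusp lx; rewrite normrN ler_norml; nra.
Qed.

Lemma slopeN x : g (- x) = - g x.
Proof. by rewrite /g sgrN waveN mulNr. Qed.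

Lemma wave_slope_sqr x : 0 < x -> g x ^+ 2 = q (u x) ^+ 2.
Proof. by move=> x0; rewrite /g gtr0_sg// mul1r sqrrN. Qed.

Lemma slope_sqr_cusp : L1 (fun x => g x ^+ 2 * \1_`]l, +oo[ x) /\
  L1 (fun x => g x ^+ 2 * \1_`]l, +oo[ (- x)).
Proof.
apply: (@L1_of_primitive_oy _ (fun x => g x ^+ 2) (fun x => (1 - ln (1 - u x)) * q (u x))
  (fun x => - cusp_potential (u x)) l 4).
- by apply: measurable_funX; exact: wave_slope_measurable.
- by move=> x; rewrite slopeN sqrrN.
- move=> x lx; have x0 := le_lt_trans l0 lx; have xl : x != l by rewrite gt_eqF.
  have /andP[u0 u1] := wave_cusp lx; split.
  + exact: (wave_derive_comp x0 xl (cusp_potential_derive u1)).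
  + apply: cvgM; last exact: q_continuous_pos.
    apply: (@wave_continuous_comp (fun y => 1 - ln (1 - y))); apply: cvgB; first exact: cvg_cst.
    apply: (@continuous_comp _ _ _ (fun y => 1 - y) (@ln R)); last by apply: ln_continuous; rewrite subr_gt0.
    by apply: cvgB; [exact: cvg_cst|exact: cvg_id].
  + rewrite sqr_ge0 wave_slope_sqr// expr2 wave_cusp_slope// ler_pM2r ?cusp_slope_gt0//.
    exact: cusp_slope_le.
- by move=> x lx; have /andP[u0 u1] := wave_cusp lx; rewrite normrN cusp_potential_bound.
Qed.

Lemma slope_sqr_head : L1 (fun x => g x ^+ 2 * \1_`]0, l[ x) /\
  L1 (fun x => g x ^+ 2 * \1_`]0, l[ (- x)).
Proof.
apply: (@L1_of_primitive_oo _ (fun x => g x ^+ 2) (fun x => (1 + 2 * c - ln (u x - 1)) * q (u x))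
  (fun x => - head_potential c (u x)) 0 l ((2 + 2 * `|c|) * m + (1 + m ^+ 2))).
- by apply: measurable_funX; exact: wave_slope_measurable.
- by move=> x; rewrite slopeN sqrrN.
- move=> x /andP[x0 lx]; have xl : x != l by rewrite lt_eqF.
  have /andP[u1 um] := wave_head x0 lx; have ll := lt_trans x0 lx; rewrite (mE ll) in um; split.
  + exact: (wave_derive_comp x0 xl (head_potential_derive c u1)).
  + apply: cvgM; last exact: q_continuous_pos.
    apply: (@wave_continuous_comp (fun y => 1 + 2 * c - ln (y - 1))); apply: cvgB; first exact: cvg_cst.
    apply: (@continuous_comp _ _ _ (fun y => y - 1) (@ln R)); last by apply: ln_continuous; rewrite subr_gt0.
    by apply: cvgB; [exact: cvg_id|exact: cvg_cst].
  + rewrite sqr_ge0 wave_slope_sqr// expr2 wave_head_slope// ler_pM2r ?head_slope_gt0//.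
    exact: head_slope_le.
- move=> x /andP[x0 lx]; have /andP[u1 um] := wave_head x0 lx.
  have ll := lt_trans x0 lx; rewrite (mE ll) in um *; rewrite normrN; exact: head_potential_bound.
Qed.

Lemma L2_wave : L2 u.
Proof.
have cu := wave_continuous; have [A B] := wave_sqr_cusp.
have cu2 : continuous (fun x => u x ^+ 2).
  by move=> x; apply: (@continuous_comp _ _ _ u (fun y => y ^+ 2)); [exact: cu|exact: exprn_continuous].
have D : L1 (fun x => u x ^+ 2 * \1_`[- l, l] x).
  by apply/(L1_setE _ (measurable_itv _)); exact: (locL1_cont cu2).
apply/L2P; split; first exact: continuous_measurable_fun.
apply: le_L1 (L1D (L1D A B) D); first exact: continuous_measurable_fun.
move=> x; rewrite ger0_norm ?sqr_ge0// -!mulrDr ler_peMr ?sqr_ge0//.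
have [xl|lx] := ltP l x.
  apply: le_sum_l; last exact: indic_ge0.
  apply: le_sum_l; last exact: indic_ge0.
  by rewrite indic_in //= in_itv/= xl.
have [xl'|lx'] := ltP x (- l).
  apply: le_sum_l; last exact: indic_ge0.
  apply: le_sum_r; first exact: indic_ge0.
  by rewrite indic_in //= in_itv/= ltrNr xl'.
apply: le_sum_r; first by apply: addr_ge0; exact: indic_ge0.
by rewrite indic_in //= in_itv/= lx'.
Qed.

Lemma L2_wave_slope : L2 g.
Proof.
have [A B] := slope_sqr_cusp; have [D E] := slope_sqr_head.
apply/L2P; split; first exact: wave_slope_measurable.
apply: le_L1 (L1D (L1D A B) (L1D D E)).
  by apply: measurable_funX; exact: wave_slope_measurable.
move=> x; rewrite ger0_norm ?sqr_ge0// -!mulrDr.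
have [->|x0] := eqVneq x 0; first by rewrite /g sgr0 mul0r oppr0 expr0n mul0r.
(* The slope is infinite at height 1, but [ln] takes the value 0 at 0. The density thus vanishes at
   0 and at the points with [|x| = l], which the indicators of the open intervals miss. *)
have q1 : q 1 = 0 by rewrite /q lexx /cusp_slope expr1n subrr ln0// oppr0 sqrtr0.
have [E1|xl] := eqVneq `|x| l.
  by rewrite /g /wave E1 V_at_length q1 mulr0 oppr0 expr0n mul0r.
rewrite ler_peMr ?sqr_ge0//.
have [xl'|lx] := ltP l `|x|.
  apply: le_sum_l; last by apply: addr_ge0; exact: indic_ge0.
  move: xl'; rewrite ltr_normr => /orP[] h.
    by apply: le_sum_l; [rewrite indic_in //= in_itv/= h|exact: indic_ge0].
  by apply: le_sum_r; [exact: indic_ge0|rewrite indic_in //= in_itv/= h].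
have {}lx : `|x| < l by rewrite lt_neqAle xl.
move: lx; rewrite ltr_norml => /andP[x1 x2].
apply: le_sum_r; first by apply: addr_ge0; exact: indic_ge0.
move: x0; rewrite neq_lt => /orP[x0|x0].
  by apply: le_sum_r; [exact: indic_ge0|rewrite indic_in //= in_itv/= oppr_gt0 x0 ltrNl].
by apply: le_sum_l; [rewrite indic_in //= in_itv/= x0|exact: indic_ge0].
Qed.

Lemma H1R_wave : H1R u.
Proof.
apply: (@h1_H1R _ u g); split; [exact: L2_wave|exact: L2_wave_slope|].
apply: (@ac_of_derive _ _ _ [:: 0; l; - l]).
- exact: wave_continuous.
- exact: L2_loc L2_wave_slope.
- exact: wave_derive.
- exact: wave_slope_continuous.
Qed.

Lemma wave_small e : 0 < e -> exists2 x, 0 <= x & u x < e.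
Proof.
move=> e0; have [_ _ PU] := profileU; have [d [d0 _ Hd]] := PU e e0.
exists (l + (d + 1)); first by rewrite !addr_ge0 ?(ltW d0).
rewrite /wave ger0_norm ?addr_ge0 ?(ltW d0)//.
rewrite /V leNgt ltrDl ltr_wpDr//= -[e]add0r addrC addKr.
by apply: Hd; rewrite ?ltry ?ltrDl.
Qed.

Lemma range_wave_sqr y : 0 < y -> y <= m ^+ 2 -> range (fun x => u x ^+ 2) y.
Proof.
have cu := wave_continuous; move=> y0 ym; have s0 : 0 < Num.sqrt y by rewrite sqrtr_gt0.
have [x x0 ux] := wave_small s0.
have [t _ ut] : exists2 t, t \in `[0, x] & u t = Num.sqrt y.
  apply: IVT => //; first exact: continuous_subspaceT.
  rewrite ge_min le_max (ltW ux) orbT/= {1}/wave normr0 V_at0.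
  rewrite -[m]ger0_norm ?(le_trans ler01)// -sqrtr_sqr ler_wsqrtr//.
by exists t => //; rewrite ut sqr_sqrtr// ltW.
Qed.

Lemma closure_range_wave_sqr : closure (range (fun x => u x ^+ 2)) = `[0, m ^+ 2]%classic.
Proof.
apply/seteqP; split.
  apply: (subset_trans (B := closure `[0, m ^+ 2]%classic)); last first.
    by rewrite -(iffLR (closure_id _))//; exact: itv_closed.
  apply: closure_subset => _ [x _ <-] /=; rewrite in_itv/= sqr_ge0/=.
  by have /andP[u0 um] := wave_ge0 x; rewrite lerXn2r ?nnegrE ?(ltW u0)// (le_trans ler01).
move=> y /=; rewrite in_itv/= => /andP[]; rewrite le_eqVlt => /predU1P[<-|y0] ym; last first.
  by apply: subset_closure; exact: range_wave_sqr.
move=> B [d /= d0 Bd].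
(* The value 0 is not attained but is a limit: [e] is an attained value within [d] of it. *)
have [e [e0 em ed]] : exists e : R, [/\ 0 < e, e <= m ^+ 2 & e < d].
  have m20 : 0 < m ^+ 2 by rewrite exprn_gt0// (lt_le_trans ltr01).
  exists (Num.min (m ^+ 2) (d / 2)); split; first by rewrite lt_min m20 divr_gt0.
    by rewrite ge_min lexx.
  by rewrite gt_min; apply/orP; right; lra.
exists e; split; first exact: range_wave_sqr.
by apply: Bd; rewrite /ball_/= sub0r normrN gtr0_norm.
Qed.

End Wave.

(** * The cusp and the head are profiles *)

Section Profiles.
Context {R : realType}.
Local Notation mu := (@lebesgue_measure R).
Implicit Types (x u r : R).

(** Inversion is discontinuous at 0, so the reciprocal is written as [expR (- ln y)] for positive
    [y] and as 0 otherwise. *)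
Lemma measurable_sqrt_inv (f : R -> R) : measurable_fun setT f ->
  measurable_fun setT (fun x => (Num.sqrt (f x))^-1).
Proof.
move=> mf; have ms : measurable_fun setT (fun x => Num.sqrt (f x)).
  apply: (measurableT_comp _ mf).
  by apply: continuous_measurable_fun; exact: sqrt_continuous.
have -> : (fun x => (Num.sqrt (f x))^-1) =
    (fun x => if 0 < Num.sqrt (f x) then expR (- ln (Num.sqrt (f x))) else 0).
  apply/funext => x; case: ifP => [s0|]; first by rewrite -lnV ?posrE// lnK ?posrE ?invr_gt0.
  by rewrite lt_neqAle sqrtr_ge0 andbT => /negbFE/eqP <-; rewrite invr0.
apply: measurable_fun_ifT => //; first exact: measurable_fun_ltr.
apply: measurableT_comp => //; apply: measurable_funN.
by apply: (measurableT_comp (@measurable_ln R)).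
Qed.

Lemma cusp_slope_inv_measurable : measurable_fun setT (fun x => (@cusp_slope R x)^-1).
Proof.
apply: measurable_sqrt_inv; apply: measurable_funN; apply: (measurableT_comp (@measurable_ln R)).
by apply: measurable_funB => //; exact: measurable_funX.
Qed.

Lemma head_slope_inv_measurable (c : R) : measurable_fun setT (fun x => (head_slope c x)^-1).
Proof.
apply: measurable_sqrt_inv; apply: measurable_funB => //; apply: (measurableT_comp (@measurable_ln R)).
by apply: measurable_funB => //; exact: measurable_funX.
Qed.

Lemma cusp_slope_inv_integrable r : 0 < r < 1 ->
  mu.-integrable `]r, 1[ (EFin \o (fun x => (cusp_slope x)^-1)).
Proof.
move=> /andP[r0 r1]; apply/(L1_setE _ (measurable_itv _)).
have L : L1 (fun x : R => r^-1 * \1_`]r, 1[ x).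
  apply/(L1_setE (fun=> r^-1) (measurable_itv _)).
  have := locL1_cont (@cst_continuous _ _ r^-1) r 1.
  by apply: integrableS => //; apply: subset_itv; rewrite bnd_simp.
apply: le_L1 L; first apply: measurable_funM.
- exact: cusp_slope_inv_measurable.
- exact: measurable_indic.
move=> x; rewrite indicE; have [/set_mem/=|_] := boolP (_ \in _); last by rewrite !mulr0 normr0.
rewrite in_itv/= => /andP[rx x1]; have x0 := lt_trans r0 rx.
rewrite !mulr1 gtr0_norm ?invr_gt0 ?cusp_slope_gt0//.
rewrite lef_pV2 ?posrE ?cusp_slope_gt0//.
exact: le_trans (ltW rx) (cusp_slope_ge x0 x1).
Qed.

(** Linear growth of the slope at height 0 makes the integral defining the cusp diverge there; hence
    the soliton is defined on the whole line. *)
Lemma cusp_slope_le_lin x : 0 < x -> x < 2^-1 -> cusp_slope x <= 2 * x.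
Proof.
move=> x0 x2; have y0 : 0 < 1 - x ^+ 2 by nra.
have h : - ln (1 - x ^+ 2) <= (2 * x) ^+ 2.
  rewrite -lnV ?posrE//; have := @le_ln1Dx R ((1 - x ^+ 2)^-1 - 1).
  rewrite addrCA subrr addr0 ltrBrDr addNr invr_gt0 => /(_ y0) h.
  apply: le_trans h _; rewrite -(ler_pM2r y0) mulrBl mulVf ?gt_eqF// mul1r.
  have k : 0 <= 3 - 4 * x ^+ 2 by nra.
  have := mulr_ge0 (sqr_ge0 x) k; lra.
apply: (@le_trans _ _ (Num.sqrt ((2 * x) ^+ 2))); first exact: ler_wsqrtr.
by rewrite sqrtr_sqr ger0_norm// mulr_ge0// ltW.
Qed.

Let cp0 u : 0 < u < 1 -> 0 < cusp_slope u.
Proof. by move=> /andP[]; exact: cusp_slope_gt0. Qed.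

Let ccp u : 0 < u < 1 -> {for u, continuous (@cusp_slope R)}.
Proof. by move=> /andP[]; exact: cusp_slope_continuous. Qed.

Local Notation Ic := (tail 1 (@cusp_slope R)).

Lemma cusp_tail_big x : exists v, 0 < v < 1 /\ x < Ic v.
Proof.
(* The logarithm measures the divergence: [f] is nonincreasing below 1/2, since [1 / cusp_slope y]
   is at least [1 / (2 y)]. *)
pose f := fun y => Ic y + 2^-1 * ln y.
have df (y : R) : 0 < y < 1 -> is_derive y 1 f (- (cusp_slope y)^-1 + 2^-1 * y^-1).
  move=> /[dup] y01 /andP[y0 _].
  have d1 := @tail_is_derive _ 0 1 _ cp0 ccp cusp_slope_inv_integrable y y01.
  exact: (is_deriveD d1 (is_deriveZ 2^-1 (is_derive1_ln y0))).
have h1 : 2^-1 <= 1 :> R by rewrite invf_le1// ler1n.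
have in01 (y : R) : y \in `]0, 2^-1[ -> 0 < y < 1.
  by rewrite in_itv/= => /andP[-> y2]; exact: lt_le_trans y2 h1.
have D (y : R) : y \in `]0, 2^-1[ -> derivable f y 1 by move=> /in01/df[].
have D' (y : R) : y \in `]0, 2^-1[ -> derive1 f y <= 0.
  move=> yh; have [_ E] := df _ (in01 _ yh); move: yh; rewrite in_itv/= => /andP[y0 y2].
  rewrite derive1E E addrC subr_le0 -invfM lef_pV2 ?posrE ?mulr_gt0// ?cusp_slope_gt0//.
    exact: cusp_slope_le_lin.
  by lra.
have C : {in `]0, 2^-1[%classic, continuous f}.
  move=> y /set_mem/= /in01/df[dy _].
  by apply/differentiable_continuous/derivable1_diffP.
have H := ler0_derive1_le_oo D D' C.
pose w : R := 4^-1.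
have w0 : 0 < w by rewrite invr_gt0.
have w2 : w < 2^-1 by rewrite ltf_pV2 ?posrE// ltr_nat.
(* Chosen so that half of [ln w - ln v] is at least [x + 1/2]; the minimum keeps [v] in the range
   where [f] is monotone. *)
pose v := Num.min w (expR (- (2 * x) + ln w - 1)).
have v0 : 0 < v by rewrite lt_min w0 expR_gt0.
have vw : v <= w by rewrite ge_min lexx.
have v1 : v < 1 by lra.
have fvw : f w <= f v by apply: H => //; rewrite in_itv/= ?w0 ?v0//; lra.
have Iw : 0 <= Ic w by apply: (tail_ge0 cp0); exact: ltW.
have lv : ln v <= - (2 * x) + ln w - 1.
  by rewrite -[leRHS]expRK ler_ln ?posrE ?expR_gt0// ge_min lexx orbT.
by exists v; split; [rewrite v0|move: fvw Iw lv; rewrite /f; lra].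
Qed.

Lemma cusp_spec x : 0 < x -> 0 < cusp x < 1 /\ Ic (cusp x) = x.
Proof.
move=> x0; rewrite /cusp gt_eqF//.
have ex : exists u, 0 < u < 1 /\ Ic u = x.
  apply: (@inverse_ex _ 0 1 +oo%E (@cusp_slope R) Ic); rewrite ?ltry ?ltr01//.
  - exact: (tail_is_derive cp0 ccp cusp_slope_inv_integrable).
  - exact: (tail_lt cp0 ccp cusp_slope_inv_integrable).
  - move=> e e0; have h : 0 < (2^-1 : R) < 1 by apply/andP; split; lra.
    have /andP[h1 h2] := h.
    have [v [/andP[v1 v2] v3]] := tail_small (cusp_slope_inv_integrable h) (lexx _) h2 e0.
    by exists v; split=> //; rewrite v2 (lt_trans h1 v1).
  - by move=> y _; exact: cusp_tail_big.
have := @xgetPex _ 0 [set u | 0 < u < 1 /\ `|x| = Ic u].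
case; first by case: ex => u [u01 E]; exists u; split=> //; rewrite E gtr0_norm.
by rewrite gtr0_norm// => h1 h2; split.
Qed.

Lemma cusp_profile : profile 0 1 +oo%E (@cusp_slope R) cusp.
Proof.
apply: (@inverse_profile _ 0 1 +oo%E (@cusp_slope R) Ic); rewrite ?ltr01//.
- exact: (tail_is_derive cp0 ccp cusp_slope_inv_integrable).
- exact: (tail_lt cp0 ccp cusp_slope_inv_integrable).
- move=> u u01; split; last by rewrite ltry.
  exact: (tail_gt0 cp0 ccp cusp_slope_inv_integrable u01).
- by move=> x x0 _; exact: cusp_spec.
Qed.

Section HeadProfile.
Variable c : R.
Local Notation m := (Num.sqrt (1 + expR (2 * c))).
Local Notation p := (head_slope c).
Local Notation I := (tail m p).

Let m1 : 1 < m. Proof. exact: head_top_gt1. Qed.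

Let p0 u : 1 < u < m -> 0 < p u.
Proof. by move=> /andP[]; exact: head_slope_gt0. Qed.

Let cp u : 1 < u < m -> {for u, continuous p}.
Proof. by move=> /andP[u1 _]; exact: head_slope_continuous. Qed.

(** With [y = (x^2 - 1) / e^(2c)] the right side is [- ln y >= 1 - y = (m^2 - x^2) / e^(2c)], and
    [m + x >= 2]. So the slope vanishes at the crest no faster than a square root, and the head has
    finite length. *)
Lemma head_slope_sqr_ge x : 1 < x -> x < m -> 2 * (m - x) / expR (2 * c) <= 2 * c - ln (x ^+ 2 - 1).
Proof.
move=> x1 xm; have E0 := expR_gt0 (2 * c); have a0 := head_arg x1.
have h : ln ((x ^+ 2 - 1) / expR (2 * c)) <= (x ^+ 2 - 1) / expR (2 * c) - 1.
  have := @le_ln1Dx R ((x ^+ 2 - 1) / expR (2 * c) - 1).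
  by rewrite addrCA subrr addr0 ltrBrDr addNr divr_gt0//; apply.
rewrite ln_div ?posrE// expRK in h.
suff : 2 * (m - x) / expR (2 * c) <= 1 - (x ^+ 2 - 1) / expR (2 * c) by lra.
rewrite -(ler_pM2r E0) mulrBl !divfK ?gt_eqF// mul1r.
have := head_top_sqr c; move: x1 xm m1; set t := Num.sqrt _; nra.
Qed.

Lemma head_slope_inv_integrable : mu.-integrable `]1, m[ (EFin \o (fun x => (p x)^-1)).
Proof.
apply/(L1_setE _ (measurable_itv _)).
(* The constant of the majorant [K / sqrt (m - x)] of the reciprocal slope, whose primitive is
   bounded. *)
pose K := (Num.sqrt (2 / expR (2 * c)))^-1.
have E0 : 0 < 2 / expR (2 * c) by rewrite divr_gt0// expR_gt0.
have K0 : 0 < K by rewrite invr_gt0 sqrtr_gt0.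
have [] := @L1_of_primitive_oo _ (fun x => (p x)^-1) (fun x => K / Num.sqrt (m - x))
  (fun x => - ((2 * K) * Num.sqrt (m - x))) 1 m (2 * K * Num.sqrt m); last by [].
- exact: head_slope_inv_measurable.
- by move=> x; rewrite /head_slope sqrrN.
- move=> x /andP[x1 xm]; have y0 : 0 < m - x by rewrite subr_gt0.
  have s0 : 0 < Num.sqrt (m - x) by rewrite sqrtr_gt0.
  split.
  + have d1 : is_derive x 1 (fun x => m - x) (0 - 1) by exact: is_deriveB.
    have d2 := @is_derive1_comp _ Num.sqrt (fun x => m - x) x _ _ (is_derive1_sqrt y0) d1.
    have := is_deriveN (is_deriveZ (2 * K) d2).
    rewrite -[_ *: _]/(_ * _).
    have -> : - (2 * K * ((2 * Num.sqrt (m - x))^-1 * (0 - 1))) = K / Num.sqrt (m - x).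
      by move: s0; set t := Num.sqrt (m - x) => s0; field; rewrite gt_eqF.
    by [].
  + apply: cvgM; first exact: cvg_cst.
    apply: cvgV; first by rewrite gt_eqF.
    apply: (@continuous_comp _ _ _ (fun x => m - x) Num.sqrt); last exact: sqrt_continuous.
    by apply: cvgB; [exact: cvg_cst|exact: cvg_id].
  + rewrite invr_ge0 sqrtr_ge0/= /K -invfM lef_pV2 ?posrE ?mulr_gt0 ?sqrtr_gt0//; last first.
      by rewrite -sqrtr_gt0 head_slope_gt0.
    rewrite -sqrtrM ?(ltW E0)//; apply: ler_wsqrtr; rewrite mulrAC.
    exact: head_slope_sqr_ge.
- move=> x /andP[x1 xm]; rewrite normrN normrM !ger0_norm ?sqrtr_ge0 ?mulr_ge0 ?(ltW K0)//.
  rewrite ler_wpM2l ?mulr_ge0 ?(ltW K0)// ler_wsqrtr//.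
  by rewrite lerBlDr lerDl (le_trans ler01) ?ltW.
Qed.

Let ia := head_slope_inv_integrable.

Let ib r : 1 < r < m -> mu.-integrable `]r, m[ (EFin \o (fun x => (p x)^-1)).
Proof.
move=> /andP[r1 rm]; apply: integrableS ia => //.
by apply: subset_itvr; rewrite bnd_simp ltW.
Qed.

Lemma head_integralE u : 1 <= u -> u < m -> head_integral c u = head_length c - I u.
Proof.
move=> u1 um; rewrite (tail_split ia u1 um) opprB addrCA -[head_length c]/(I 1) subrr addr0.
apply: Rintegral_itv_bndo_bndc; apply: integrableS ia => //.
by apply: subset_itvl; rewrite bnd_simp ltW.
Qed.

Lemma head_length_gt0 : 0 < head_length c.
Proof.
have um : 1 < (1 + m) / 2 < m by rewrite !(midf_lt m1).
apply: lt_trans (tail_gt0 p0 cp ib um) _.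
exact: (tail_lt_total p0 cp ib ia um).
Qed.

Lemma head_ex x : 0 < x -> x < head_length c -> exists u, 1 < u < m /\ I u = x.
Proof.
move=> x0 xl; apply: (@inverse_ex _ 1 m (head_length c)%:E p I) => //.
- exact: (tail_is_derive p0 cp ib).
- exact: (tail_lt p0 cp ib).
- by move=> e e0; exact: (tail_small ia (lexx 1) m1 e0).
- by move=> y yl; apply: (tail_approx m1 ia).
Qed.

Lemma head_spec x : 0 <= x -> x <= head_length c ->
  1 <= Defs.head c x <= m /\ head_length c - x = head_integral c (Defs.head c x).
Proof.
move=> x0 xl.
have := @xgetPex _ 1 [set u | 1 <= u <= m /\ head_length c - `|x| = head_integral c u].
rewrite (ger0_norm x0) /Defs.head; case; last by move=> ? ?; rewrite (ger0_norm x0).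
(* The inversion covers only interior distances; at the crest and at the end of the head the heights
   [m] and 1 are solutions by inspection. *)
move: x0; rewrite le_eqVlt => /predU1P[<-|x0].
  by exists m; split; [rewrite lexx ltW|rewrite subr0].
move: xl; rewrite le_eqVlt => /predU1P[->|xl].
  exists 1; split; first by rewrite lexx ltW.
  by rewrite subrr /head_integral set_itvoo0 Rintegral_set0.
have [u [/andP[u1 um] Iu]] := head_ex x0 xl.
by exists u; split; [rewrite !ltW|rewrite (head_integralE (ltW u1) um) Iu].
Qed.

(** [head] is a choice among solutions, so its value at the crest needs uniqueness: any height below
    [m] leaves a positive tail integral. *)
Lemma head0 : Defs.head c 0 = m.
Proof.
have [/andP[h1]] := head_spec (lexx 0) (ltW head_length_gt0).
rewrite le_eqVlt => /predU1P[//|hm]; rewrite (head_integralE h1 hm) subr0.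
move=> /eqP; rewrite eq_sym subr_eq addrC -subr_eq subrr eq_sym => /eqP I0.
move: h1; rewrite le_eqVlt => /predU1P[h1|h1].
  by have := head_length_gt0; rewrite -h1 in I0; rewrite -[head_length c]/(I 1) I0 ltxx.
by have := tail_gt0 p0 cp ib (introT andP (conj h1 hm)); rewrite I0 ltxx.
Qed.

Lemma head_at_length : Defs.head c (head_length c) = 1.
Proof.
have [/andP[]] := head_spec (ltW head_length_gt0) (lexx _).
rewrite le_eqVlt => /predU1P[//|h1]; rewrite subrr.
rewrite le_eqVlt => /predU1P[->|hm].
  by move=> E; have := head_length_gt0; rewrite /head_length -E ltxx.
rewrite (head_integralE (ltW h1) hm) => /eqP; rewrite eq_sym subr_eq0 => /eqP E.
have := tail_lt_total p0 cp ib ia (introT andP (conj h1 hm)).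
by rewrite -E -[head_length c]/(I 1) ltxx.
Qed.

Lemma head_profile : profile 1 m (head_length c)%:E p (Defs.head c).
Proof.
apply: (@inverse_profile _ 1 m (head_length c)%:E p I) => //.
- exact: (tail_is_derive p0 cp ib).
- exact: (tail_lt p0 cp ib).
- move=> u um; split; first exact: (tail_gt0 p0 cp ib um).
  by rewrite lte_fin; exact: (tail_lt_total p0 cp ib ia um).
- move=> x x0; rewrite lte_fin => xl.
  have [/andP[]] := head_spec (ltW x0) (ltW xl).
  rewrite le_eqVlt => /predU1P[<-|h1].
    rewrite /head_integral set_itvoo0 Rintegral_set0 => _ /eqP; rewrite subr_eq0 => /eqP E.
    by rewrite E ltxx in xl.
  rewrite le_eqVlt => /predU1P[->|hm].
    rewrite -[head_integral c m]/(head_length c) => /eqP; rewrite subr_eq addrC -subr_eq subrr eq_sym => /eqP E.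
    by rewrite E ltxx in x0.
  rewrite (head_integralE (ltW h1) hm) => /addrI/oppr_inj E.
  by rewrite h1 hm.
Qed.

End HeadProfile.
End Profiles.

Section SolitaryWave.
Context {R : realType}.

Lemma solitary_wave_spec (C : \bar R) : C != +oo%E ->
  let u := solitary_wave C in
  [/\ H1R u, closure (range (fun x : R => u x ^+ 2)) = `[0, 1 + exp2 C]%classic &
      forall y : R, 0 < y -> y <= 1 + exp2 C -> range (fun x : R => u x ^+ 2) y].
Proof.
case: C => [c| |] // _ u.
- have E : u = wave (head_length c) (Defs.head c) cusp.
    apply/funext => x; rewrite /u /solitary_wave /wave.
    by case: ifP => // _; rewrite /Defs.head normr_id.
  have -> : 1 + exp2 c%:E = Num.sqrt (1 + expR (2 * c)) ^+ 2 by rewrite head_top_sqr.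
  have l0 := ltW (head_length_gt0 c); have m1 := ltW (head_top_gt1 c).
  rewrite E; split.
  + exact: (H1R_wave l0 (head0 c) (head_at_length c) (fun=> erefl) (fun=> head_profile c) cusp_profile).
  + exact: (closure_range_wave_sqr l0 m1 (head0 c) (head_at_length c) (fun=> head_profile c) cusp_profile).
  + exact: (range_wave_sqr l0 m1 (head0 c) (head_at_length c) (fun=> head_profile c) cusp_profile).
(* The cusped soliton as a wave with a head of length 0, of which only the value 1 at the cusp is
   seen. *)
- have E : u = wave 0 (fun=> 1) (@cusp R).
    apply/funext => x; rewrite /u /solitary_wave /wave subr0 normr_le0 /cusp normr_eq0.
    by case: ifP => // _; rewrite normr_id.
  have -> : 1 + exp2 (-oo%E : \bar R) = 1 ^+ 2.
    by rewrite /exp2 mulrNy gtr0_sg// mul1e/= addr0 expr1n.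
  have P0 : (0 : R) < 0 -> profile 1 1 0%:E (head_slope 0) (fun=> 1 : R) by rewrite ltxx.
  have E0 : (0 : R) < 0 -> 1 = Num.sqrt (1 + expR (2 * 0)) :> R by rewrite ltxx.
  rewrite E; split.
  + exact: (@H1R_wave _ 0 1 0 (fun=> 1) cusp (lexx 0) erefl erefl E0 P0 cusp_profile).
  + exact: (@closure_range_wave_sqr _ 0 1 0 (fun=> 1) cusp (lexx 0) (lexx 1) erefl erefl P0 cusp_profile).
  + exact: (@range_wave_sqr _ 0 1 0 (fun=> 1) cusp (lexx 0) (lexx 1) erefl erefl P0 cusp_profile).
Qed.

End SolitaryWave.

Theorem proposition6 (R : realType) (C : \bar R) (hC : C != +oo%E) :
  let u := solitary_wave C in
  continuous_spectrum H1 H1_norm (opM u)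
    = real_complex R @` closure (range (fun x : R => u x ^+ 2))
  /\ closure (range (fun x : R => u x ^+ 2)) = `[0, 1 + exp2 C]%classic.
Proof.
move=> u; have [hu cl rg] := solitary_wave_spec hC; rewrite -/u in hu cl rg.
split=> //; apply/seteqP; split=> [z|_ [l + <-]]; last first.
  (* The point 0 is treated apart: every other point of the interval is a value of [u^2], while 0 is
     only approached at infinity. *)
  rewrite cl/= in_itv/= => /andP[]; rewrite le_eqVlt => /predU1P[<-|l0] lM.
    by move=> [_ _]; exact: not_finite_codim_0.
  have [x _ <-] := rg l l0 lM.
  by move=> [_ _]; exact: not_finite_codim_range.
apply: contra_notP => nz.
have u0 x : 0 <= u x ^+ 2 by exact: sqr_ge0.
have uM x : u x ^+ 2 <= 1 + exp2 C.
  have : `[0, 1 + exp2 C]%classic (u x ^+ 2) by rewrite -cl; apply: subset_closure; exists x.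
  by rewrite /= in_itv/= => /andP[].
have nz' : complex.Im z = 0 -> ~ (0 <= complex.Re z <= 1 + exp2 C).
  move=> z0 zM; apply: nz; exists (complex.Re z); first by rewrite cl/= in_itv.
  by case: z z0 {zM} => x y /= ->.
(* Off the interval, the squared distance from [z] to the values of [u^2] is bounded below by the
   square of the imaginary part, or for real [z] by the square of the distance to the nearer end. *)
have [z0|z0] := eqVneq (complex.Im z) 0; last first.
  apply: (@fredholm_of_resolvent _ _ _ (complex.Im z ^+ 2)) => //.
    by rewrite exprn_even_gt0.
  by move=> x; rewrite lerDr sqr_ge0.
have [zneg|zpos] := ltP (complex.Re z) 0.
  apply: (@fredholm_of_resolvent _ _ _ (complex.Re z ^+ 2)) => //.
    by rewrite exprn_even_gt0//= lt_eqF.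
  move=> x; move: (u0 x) zneg; rewrite z0; set a := u x ^+ 2; set b := complex.Re z; clear; nra.
have zM : 1 + exp2 C < complex.Re z by rewrite ltNge; apply/negP => zM; apply: (nz' z0); rewrite zpos.
apply: (@fredholm_of_resolvent _ _ _ ((complex.Re z - (1 + exp2 C)) ^+ 2)) => //.
  by rewrite exprn_gt0// subr_gt0.
move=> x; move: (uM x) zM; rewrite z0; set a := u x ^+ 2; set b := complex.Re z.
by set M := 1 + exp2 C; clear; nra.
Qed.
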